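(* Let $r$ be an $\mathcal{A}$-stable rational approximation (of the exponential function) of order $k\in\mathbb{N}$. Let $-A$ generate an exponentially stable $C_0$-semigroup $(T(t))_{t\geq0}$ on a Banach space $X$ with type $p\in[1,2]$ and cotype $q\in[2,\infty)$. Suppose that $T(t)$ is invertible for all $t\geq0$. Then $(r(-\tfrac tnA)^n)_{n\in\mathbb{N}}$ converges strongly on $D_A(\frac1p-\frac1q,1)$ to $T(t)$ as $n\to\infty$, locally uniformly in $t\geq0$.
   Context: All Banach spaces are complex and nonzero; $\mathbb{N}=\{1,2,\dots\}$. A $C_0$-semigroup is exponentially stable if there are $M\geq1$, $\omega>0$ with $\|T(t)\|\leq Me^{-\omega t}$ for all $t\geq0$. Let $\mathbb{C}_-:=\{z\in\mathbb{C}\mid\mathrm{Re}(z)<0\}$. A rational function $r$ that is bounded and holomorphic on $\mathbb{C}_-$ is $\mathcal{A}$-stable if $\sup_{z\in\mathbb{C}_-}|r(z)|\leq1$. It is a rational approximation of the exponential function of order $k\in\mathbb{N}$ if there is a constant $C\geq0$ with $|r(z)-e^z|\leq C|z|^{k+1}$ for all $z$ in a complex neighborhood of $0$. Type and cotype: let $(\gamma_k)_{k\in\mathbb{N}}$ be independent standard complex Gaussian random variables. $X$ has type $p\in[1,2]$ if there is $C$ with $(\mathbb{E}\|\sum_{k=1}^n\gamma_kx_k\|^2)^{1/2}\leq C(\sum_{k=1}^n\|x_k\|^p)^{1/p}$ for all $n$ and $x_1,\dots,x_n\in X$; $X$ has cotype $q\in[2,\infty)$ if there is $C$ with $(\sum_{k=1}^n\|x_k\|^q)^{1/q}\leq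 C(\mathbb{E}\|\sum_{k=1}^n\gamma_kx_k\|^2)^{1/2}$ for all $n$ and $x_1,\dots,x_n\in X$. Real interpolation: $D_A(\theta,s):=(X,D(A))_{\theta,s}$ is the real interpolation space (K-method) between $X$ and $D(A)$ with graph norm; in particular $D_A(0,1)=\{0\}$. *)

(* Defs.v *)
(* Complex scalars are [R[i]] for [R : realType]; a complex Banach space is a
   [completeNormedModType R[i]]. *)
From HB Require Import structures.
From mathcomp Require Export all_boot all_order all_algebra complex.
From mathcomp Require Export all_classical all_reals all_analysis.

Set Implicit Arguments.
Unset Strict Implicit.
Unset Printing Implicit Defensive.

Export Order.TTheory GRing.Theory Num.Theory.
Export numFieldNormedType.Exports.


Local Open Scope classical_set_scope.
Local Open Scope ring_scope.
Local Open Scope complex_scope.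

(* Norms on an [R[i]]-normed space take values in [R[i]] (nonnegative reals);
   [rnorm] is the same norm as an element of [R]. *)
Definition rnorm (R : realType) (X : normedModType R[i]) (x : X) : R :=
  complex.Re `|x|.

Definition cexp (R : realType) (z : R[i]) : R[i] :=
  (expR (complex.Re z))%:C
  * (cos (complex.Im z) +i* sin (complex.Im z)).

(* Rational functions in lowest terms. At a pole, [num.[z] / den.[z]] has the
   junk value 0; it is discontinuous there, because the fraction is reduced. *)
Record ratfun (R : realType) := RatFun {
  num : {poly R[i]};
  den : {poly R[i]};
  den_neq0 : den != 0;
  num_den_coprime : coprimep num den }.

Definition ratfun_eval (R : realType) (r : ratfun R) (z : R[i]) : R[i] :=
  (num r).[z] / (den r).[z].

Coercion ratfun_eval : ratfun >-> Funclass.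

Definition left_half_plane (R : realType) : set R[i] :=
  [set z | complex.Re z < 0].

(* Differentiability is over the field [R[i]], i.e. complex. *)
Definition holomorphic_on (R : realType) (D : set R[i]) (f : R[i] -> R[i]) :=
  forall z, D z -> derivable (f : R[i]^o -> R[i]^o) z 1.

Definition A_stable (R : realType) (r : ratfun R) :=
  holomorphic_on (@left_half_plane R) r
  /\ forall z, left_half_plane z -> `|r z| <= 1.

Definition exp_approximation (R : realType) (r : ratfun R) (k : nat) :=
  exists C : R, 0 <= C /\
    \forall z \near (0 : R[i]^o), `|r z - cexp z| <= C%:C * `|z| ^+ k.+1.

Section Gaussian.
Context (R : realType) (d : measure_display) (Omega : measurableType d)
        (P : probability Omega R).

Definition plane := (measurableTypeR R * measurableTypeR R)%type.

Definition re_im (g : Omega -> R[i]) (w : Omega) : plane :=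
  (complex.Re (g w), complex.Im (g w)).

(* Normalised by E|g|^2 = 1: real and imaginary parts are independent centred
   normal variables with standard deviation 1/sqrt 2. *)
Definition standard_complex_gaussian (g : Omega -> R[i]) :=
  measurable_fun [set: Omega] (re_im g) /\
  forall B : set plane, measurable B ->
    P (re_im g @^-1` B)
    = (normal_prob (0 : R) (Num.sqrt 2)^-1
       \x normal_prob (0 : R) (Num.sqrt 2)^-1)%E B.

Definition mutually_independent (g : nat -> Omega -> R[i]) :=
  forall (J : seq nat) (B : nat -> set plane), uniq J ->
    (forall k, measurable (B k)) ->
    P (\bigcap_(k in [set` J]) (re_im (g k) @^-1` B k))
    = (\prod_(k <- J) P (re_im (g k) @^-1` B k))%E.

Definition gaussian_sequence (g : nat -> Omega -> R[i]) :=
  (forall k, standard_complex_gaussian (g k)) /\ mutually_independent g.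

Context (gamma : nat -> Omega -> R[i]) (X : normedModType R[i]).

(* (E ||sum_k gamma_k x_k||^2)^(1/2) *)
Definition gaussian_norm (n : nat) (x : 'I_n -> X) : \bar R :=
  ('E_P[fun w => (rnorm (\sum_(k < n) gamma k w *: x k) ^+ 2)%R]
    `^ 2^-1)%E.

Definition lp_norm (p : R) (n : nat) (x : 'I_n -> X) : R :=
  (\sum_(k < n) rnorm (x k) `^ p) `^ p^-1.

Definition has_type (p : R) :=
  1 <= p <= 2 /\
  exists C : R, forall (n : nat) (x : 'I_n -> X),
    (gaussian_norm x <= (C * lp_norm p x)%:E)%E.

Definition has_cotype (q : R) :=
  2 <= q /\
  exists C : R, forall (n : nat) (x : 'I_n -> X),
    ((lp_norm q x)%:E <= C%:E * gaussian_norm x)%E.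

End Gaussian.

Section Operators.
Context (R : realType) (X : normedModType R[i]).

(* Possibly unbounded operators on X; only the values of [op_fun] on [dom]
   are meaningful. *)
Record operator := Operator { dom : set X; op_fun :> X -> X }.

(* [c B], where [0 B] is the zero operator on all of X (the closure of
   [0 B] on [dom B] when B is densely defined). *)
Definition scale_op (c : R[i]) (B : operator) : operator :=
  if c == 0 then Operator setT (fun=> 0)
  else Operator (dom B) (fun x => c *: B x).

(* [p(B) = sum_i p_i B^i] with domain D(B^(deg p)). *)
Definition poly_op (p : {poly R[i]}) (B : operator) : operator :=
  Operator
    [set x | forall i, (i < (size p).-1)%N -> dom B (iter i B x)]
    (fun x => \sum_(i < size p) p`_i *: iter i B x).

(* [r(B) = num(B) den(B)^-1]; the junk value 0 is taken where this is
   undefined. *)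
Definition ratfun_op (r : ratfun R) (B : operator) (x : X) : X :=
  xget 0 [set y | exists u,
    [/\ dom (poly_op (den r) B) u, poly_op (den r) B u = x,
        dom (poly_op (num r) B) u & poly_op (num r) B u = y]].

(* The values [T t] with [t < 0] are irrelevant throughout. *)
Definition C0_semigroup (T : R -> {linear X -> X}) :=
  [/\ forall t : R, 0 <= t -> continuous (T t),
      forall x, T 0 x = x,
      forall (s t : R) x, 0 <= s -> 0 <= t -> T (s + t) x = T s (T t x)
    & forall x, T h x @[h --> (0 : R)^'+] --> x].

Definition is_generator (B : operator) (T : R -> {linear X -> X}) :=
  forall x y, (dom B x /\ B x = y) <->
    ((h^-1)%:C *: (T h x - x) @[h --> (0 : R)^'+] --> y).

Definition exponentially_stable (T : R -> {linear X -> X}) :=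
  exists M omega : R, [/\ 1 <= M, 0 < omega &
    forall t : R, 0 <= t ->
      forall x, rnorm (T t x) <= M * expR (- omega * t) * rnorm x].

Definition boundedly_invertible (S : {linear X -> X}) :=
  exists S' : {linear X -> X},
    [/\ continuous S', cancel S S' & cancel S' S].

Definition graph_norm (A : operator) (x : X) : R := rnorm x + rnorm (A x).

(* The K-functional of the couple (X, D(A)). *)
Definition K_functional (A : operator) (u : R) (x : X) : R :=
  inf [set c | exists a b,
    [/\ dom A b, a + b = x & c = rnorm a + u * graph_norm A b]].

(* [(X, D(A))_(theta, s)] for finite s: the x such that
   u |-> u^-theta K(u, x) belongs to L^s((0, oo), du/u). *)
Definition real_interpolation (A : operator) (theta s : R) : set X :=
  [set x | (\int[lebesgue_measure]_(u in `]0%R, +oo[)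
     ((u `^ (- theta) * K_functional A u x) `^ s / u)%:E < +oo)%E].

End Operators.

(* Main.v *)
(* Put B = -A and theta = 1/p - 1/q. The semigroup is sampled on the dyadic grids
   of step 2^-L, and all operators are obtained from polynomials in W = T(2^-L).

   Transference. Let KN = 2^L, let D_K be the average of the first K powers of W,
   and let g be a polynomial with |g| <= 1 on the unit circle. Then
   ||g(W) D_K^2 x|| <= C N^theta ||x||. Indeed, correlating a periodic sequence with
   the coefficients of g is a composition of rotations, phases and multiplications
   by scalars of modulus at most 1 (the fast Fourier transform), none of which
   increases E ||sum_k gamma_k x_k||^2. Writing x = T(1) x', this is applied to the
   orbit of x' sampled at step 1/N; type p bounds its Gaussian sum above, with
   exponential stability making the orbit l^p-summable, and cotype q bounds
   the result below. Telescoping D_K^2 over dyadic K bounds ||g(W) x|| by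
   C sum_l 2^(l theta) K(2^-l, x), which is finite on D_A(theta, 1).

   Resolvents of B are strong limits of truncated Neumann series in W, so that
   r(hB)^n is a strong limit of polynomials g_L(W) with sup_{|z| = 1} |g_L| -> 1, and
   r(hB)^n satisfies the same bound, uniformly in h and n. On D(A^3), consistency
   and the telescoping of r(hB)^n - T(h)^n give convergence, because
   theta < 1 controls the stability bound by the graph norm. The regularisations
   (aR(a))^3 x approximate x in the stability bound, hence the general case. *)

From HB Require Import structures.
Require Import Defs.
From mathcomp Require Import all_boot all_order all_algebra complex.
From mathcomp Require Import all_classical all_reals all_analysis.
From mathcomp Require Import measurable_realfun zify ring lra.

Set Implicit Arguments.
Unset Strict Implicit.
Unset Printing Implicit Defensive.

Local Open Scope classical_set_scope.
Local Open Scope ring_scope.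
Local Open Scope complex_scope.

(** A polynomial in [W] has no sup-norm bound on X itself, because [T] is merely bounded. Gaussian
    sums supply one: in any Banach space, unitary matrices acting on the coefficients preserve them
    and scalars of modulus at most 1 do not increase them. Entering the Gaussian setting through
    type and leaving it through cotype costs a power of the number of samples. Hence the orbit is
    sampled at the coarse step K: it takes K * N grid steps to cover unit time, but only N samples
    are paid for. The average D_K occurs squared because one factor rounds every exponent to a
    multiple of K, while the other becomes a compression by blocks of length K. Invertibility places
    x at the end of a unit-time orbit. The result is then the image, under operators of norm at most
    M, of each of the N output samples, and this yields the lower bound to which cotype applies.
    Dyadic grids are nested, and their lengths are the powers of two on which the Fourier transform
    recursion runs. No vector-valued integral occurs: generator estimates come from Riemann sums,
    resolvents from polynomials in [W], and rotation invariance from shears. *)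

(** * Real-valued norms and moduli *)

Section Rnorm.
Context {R : realType} {X : normedModType R[i]}.
Implicit Types (x y z : X).

Lemma rnormE x : `|x| = (rnorm x)%:C.
Proof. by rewrite /rnorm RRe_real// normr_real. Qed.

Lemma rnorm_ge0 x : 0 <= rnorm x.
Proof. by rewrite -ler0c -rnormE. Qed.

Lemma rnorm0 : rnorm (0 : X) = 0.
Proof. by apply: complexI; rewrite -rnormE normr0. Qed.

Lemma rnorm_eq0 x : rnorm x = 0 -> x = 0.
Proof. by move=> x0; apply/eqP; rewrite -normr_eq0 rnormE x0. Qed.

Lemma rnormD x y : rnorm (x + y) <= rnorm x + rnorm y.
Proof. by rewrite -lecR rmorphD/= -!rnormE ler_normD. Qed.

Lemma rnormN x : rnorm (- x) = rnorm x.
Proof. by apply: complexI; rewrite -!rnormE normrN. Qed.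

Lemma rnormB x y : rnorm (x - y) <= rnorm x + rnorm y.
Proof. by rewrite -(rnormN y) rnormD. Qed.

Lemma rdistC x y : rnorm (x - y) = rnorm (y - x).
Proof. by rewrite -rnormN opprB. Qed.

Lemma rdist_triangle y x z : rnorm (x - z) <= rnorm (x - y) + rnorm (y - z).
Proof. by rewrite (le_trans _ (rnormD _ _))// addrA subrK. Qed.

Lemma rnorm_sum (I : Type) (s : seq I) (P : pred I) (F : I -> X) :
  rnorm (\sum_(i <- s | P i) F i) <= \sum_(i <- s | P i) rnorm (F i).
Proof.
elim/big_ind2 : _ => [|u a v b ua vb|//]; first by rewrite rnorm0.
by rewrite (le_trans (rnormD _ _))// lerD.
Qed.

Lemma cvg_rnorm {T : Type} {F : set_system T} {FF : Filter F} (f : T -> X) x :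
  f @ F --> x <-> rnorm (f t - x) @[t --> F] --> (0 : R).
Proof.
split=> [/cvgrPdist_lt fx|/cvgrPdist_lt fx].
  apply/cvgrPdist_lt => e e0; have /fx : 0 < e%:C by rewrite ltcR.
  apply: filterS => t; rewrite rnormE ltcR sub0r normrN ger0_norm ?rnorm_ge0//.
  by rewrite rdistC.
apply/cvgrPdist_lt => e e0.
have eE : e = (complex.Re e)%:C by rewrite RRe_real// gtr0_real.
have /fx : 0 < complex.Re e by rewrite -ltcR -eE.
apply: filterS => t; rewrite sub0r normrN ger0_norm ?rnorm_ge0// => h.
by rewrite eE rnormE ltcR rdistC.
Qed.

End Rnorm.

Section Cabs.
Context {R : realType}.
Implicit Types (z w : R[i]) (a : R).

Definition cabs z : R := complex.Re `|z|.

Lemma cabsE z : `|z| = (cabs z)%:C.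
Proof. by rewrite /cabs RRe_real// normr_real. Qed.

Lemma cabs_ge0 z : 0 <= cabs z.
Proof. by rewrite -ler0c -cabsE. Qed.

Lemma cabsM z w : cabs (z * w) = cabs z * cabs w.
Proof. by apply: complexI; rewrite rmorphM/= -!cabsE normrM. Qed.

Lemma cabs0 : cabs 0 = 0.
Proof. by apply: complexI; rewrite -cabsE normr0. Qed.

Lemma cabs1 : cabs 1 = 1.
Proof. by apply: complexI; rewrite -cabsE normr1. Qed.

Lemma cabsX z n : cabs (z ^+ n) = cabs z ^+ n.
Proof. by apply: complexI; rewrite rmorphXn/= -!cabsE normrX. Qed.

Lemma cabsV z : cabs z^-1 = (cabs z)^-1.
Proof. by apply: complexI; rewrite fmorphV/= -!cabsE normfV. Qed.

Lemma cabsD z w : cabs (z + w) <= cabs z + cabs w.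
Proof. by rewrite -lecR rmorphD/= -!cabsE ler_normD. Qed.

Lemma cabsN z : cabs (- z) = cabs z.
Proof. by rewrite /cabs normrN. Qed.

Lemma cabs_eq0 z : (cabs z == 0) = (z == 0).
Proof. by rewrite -[RHS]normr_eq0 cabsE (inj_eq (@complexI R)). Qed.

Lemma cabs_real a : cabs a%:C = `|a|.
Proof. by rewrite /cabs normc_def/= expr0n addr0 sqrtr_sqr. Qed.

Lemma Re_le_cabs z : complex.Re z <= cabs z.
Proof. by rewrite (le_trans (ler_norm _))// -lecR -cabsE normc_ge_Re. Qed.

Lemma cabs_sum (I : Type) (s : seq I) (P : pred I) (F : I -> R[i]) :
  cabs (\sum_(i <- s | P i) F i) <= \sum_(i <- s | P i) cabs (F i).
Proof.
elim/big_ind2 : _ => [|u a v b ua vb|//]; first by rewrite cabs0.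
by rewrite (le_trans (cabsD _ _))// lerD.
Qed.

Lemma ReD z w : complex.Re (z + w) = complex.Re z + complex.Re w.
Proof. by case: z; case: w. Qed.

Lemma ReMr a z : complex.Re (a%:C * z) = a * complex.Re z.
Proof. by case: z => x y /=; rewrite mul0r subr0. Qed.

Context {X : normedModType R[i]}.

Lemma rnormZ z (x : X) : rnorm (z *: x) = cabs z * rnorm x.
Proof. by apply: complexI; rewrite rmorphM/= -!rnormE -cabsE normrZ. Qed.

Lemma rnormZr a (x : X) : rnorm (a%:C *: x) = `|a| * rnorm x.
Proof. by rewrite rnormZ cabs_real. Qed.

Lemma linear_rnorm_bounded (S : {linear X -> X}) : continuous S ->
  exists2 C : R, 0 <= C & forall x, rnorm (S x) <= C * rnorm x.
Proof.
move=> /(_ 0) /cvgrPdist_lt /(_ 1 ltr01); rewrite linear0.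
move=> /nbhs_ballP[e /= e0 he].
have eE : e = (complex.Re e)%:C by rewrite RRe_real// gtr0_real.
have d0 : 0 < complex.Re e by rewrite -ltcR -eE.
set d := complex.Re e in eE d0.
have hd y : rnorm y < d -> rnorm (S y) < 1.
  move=> yd; have := he y; rewrite -ball_normE /ball_/= !sub0r !normrN.
  by rewrite !rnormE eE ltcR -[1]/(1%:C) ltcR; exact.
exists (2 / d); first by rewrite divr_ge0// ltW.
move=> x; have [->|x0] := eqVneq x 0; first by rewrite linear0 rnorm0 mulr0.
have nx0 : 0 < rnorm x.
  by rewrite lt_neqAle rnorm_ge0 andbT eq_sym; apply: contra x0 => /eqP/rnorm_eq0 ->.
have c0 : 0 < d / 2 / rnorm x by rewrite !divr_gt0.
have := hd ((d / 2 / rnorm x)%:C *: x).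
rewrite linearZ !rnormZr gtr0_norm// divfK ?gt_eqF// => /(_ _)/wrap[].
  by rewrite ltr_pdivrMr// mulr_natr mulr2n ltrDl.
move=> /ltW h; rewrite -ler_pdivrMl ?divr_gt0// invf_div.
by move: h; rewrite mulrAC ler_pdivrMr// mul1r.
Qed.

End Cabs.

(** * Integration against a measure with a density *)

Section Density.
Local Open Scope ereal_scope.
Import HBNNSimple.
Context d (T : measurableType d) (R : realType).
Variables (mu nu : {measure set T -> \bar R}) (g : T -> R).
Hypotheses (mg : measurable_fun setT g) (g0 : forall x, (0 <= g x)%R).
Hypothesis nuE : forall A, measurable A -> nu A = \int[mu]_(x in A) (g x)%:E.

Let integral_density_nnsfun (f : {nnsfun T >-> R}) :
  \int[nu]_x (f x)%:E = \int[mu]_x ((f x)%:E * (g x)%:E).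
Proof.
under [LHS]eq_integral do rewrite fimfunE -fsumEFin//.
rewrite [LHS]ge0_integral_fsum//; last 2 first.
  - by move=> r; exact/measurable_EFinP/measurableT_comp.
  - by move=> n x _; rewrite EFinM nnfun_muleindic_ge0.
under [RHS]eq_integral.
  move=> x xD; rewrite fimfunE -fsumEFin// ge0_mule_fsuml; last first.
    by move=> r; rewrite EFinM nnfun_muleindic_ge0.
  over.
rewrite [RHS]ge0_integral_fsum//; last 2 first.
  - move=> r; apply: emeasurable_funM; last exact/measurable_EFinP.
    by apply/measurable_EFinP/measurableT_comp.
  - by move=> n x _; rewrite mule_ge0 ?lee_fin//= ?nnfun_muleindic_ge0//
       -lee_fin EFinM nnfun_muleindic_ge0.
apply: eq_fsbigr => r _.
rewrite integralZl_indic_nnsfun//= integral_indic// setIT nuE//.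
under [RHS]eq_integral do rewrite EFinM -muleA.
have [fr|fr] := eqVneq (f @^-1` [set r]) set0.
  rewrite fr integral_set0 mule0 integral0_eq// => x _.
  by rewrite indicE in_set0 mul0e mule0.
have r0 : (0 <= r)%R by move/set0P : fr => [x <-]; exact: fun_ge0.
rewrite ge0_integralZl//; last 2 first.
  - apply: emeasurable_funM; exact/measurable_EFinP.
  - by move=> x _; rewrite mule_ge0 ?lee_fin.
congr (_ * _); rewrite integral_mkcond; apply: eq_integral => x _.
by rewrite patchE indicE; case: ifPn => _; rewrite ?mul1e ?mul0e.
Qed.

(** Monotone convergence passes from simple functions to [f]. The identity turns integrals against
    [normal_prob] into Lebesgue integrals, where translation invariance is available. *)
Lemma ge0_integral_density (f : T -> \bar R) : measurable_fun setT f ->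
  (forall x, 0 <= f x) -> \int[nu]_x f x = \int[mu]_x (f x * (g x)%:E).
Proof.
move=> mf f0; pose f_ := nnsfun_approx measurableT mf.
transitivity (lim (\int[nu]_x (f_ n x)%:E @[n --> \oo])).
  rewrite -monotone_convergence//=.
  - apply: eq_integral => ? /[!inE] xD; apply/esym/cvg_lim => //=.
    exact: cvg_nnsfun_approx.
  - by move=> n; exact/measurable_EFinP/measurable_funTS.
  - by move=> n ? _; rewrite lee_fin.
  - by move=> ? _ ? ? mn; rewrite lee_fin; exact/lefP/nd_nnsfun_approx.
transitivity (lim (\int[mu]_x ((f_ n x)%:E * (g x)%:E) @[n --> \oo])).
  by apply: congr_lim; apply/funext => n; rewrite integral_density_nnsfun.
rewrite -monotone_convergence//=.
- apply: eq_integral => x _; apply/cvg_lim => //=.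
  apply: cvgeZr => //; first exact: cvg_nnsfun_approx.
- move=> n; apply: emeasurable_funM; first exact/measurable_EFinP.
  exact/measurable_EFinP.
- by move=> n x _; rewrite mule_ge0// lee_fin.
- move=> x _ a b ab; rewrite lee_wpmul2r ?lee_fin//.
  exact/lefP/nd_nnsfun_approx.
Qed.

End Density.

(** * Translation and rotation invariance of Lebesgue measure *)

Section Translation.
Local Open Scope ereal_scope.
Context {R : realType}.
Local Notation mu := (@lebesgue_measure R).

Lemma ge0_integral_translation (t : R) (f : measurableTypeR R -> \bar R) :
  measurable_fun setT f -> (forall x, 0 <= f x) ->
  \int[mu]_x f (x + t)%R = \int[mu]_x f x.
Proof.
move=> mf f0; pose phi (x : measurableTypeR R) : measurableTypeR R := (x + t)%R.
have mphi : measurable_fun setT phi by exact: measurable_funD.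
transitivity (\int[pushforward mu phi]_(x in setT) f x).
  by rewrite ge0_integral_pushforward.
apply: eq_measure_integral => //= A mA _.
apply/esym/(@lebesgue_measure_unique _ (pushforward mu phi)) => //= _ [[a b]] _ <-.
rewrite /pushforward.
have -> : phi @^-1` `]a, b]%classic = `](a - t)%R, (b - t)%R]%classic.
  by apply/seteqP; split => x /=; rewrite /phi !in_itv/= lerBrDr ltrBlDr.
rewrite !lebesgue_measure_itv/= !lte_fin ltrD2r -!EFinD.
by rewrite opprB addrA subrK.
Qed.

Let shear_inner (t : R) (G : measurableTypeR R * measurableTypeR R -> \bar R) :
  measurable_fun setT G ->
  (forall x, 0 <= G x) ->
  \int[mu]_a \int[mu]_b G (a, b + t * a)%R = \int[mu]_a \int[mu]_b G (a, b).
Proof.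
move=> mG G0; apply: eq_integral => a _.
apply: (ge0_integral_translation (t * a)%R (f := fun b => G (a, b))) => //.
exact: measurableT_comp.
Qed.

Let shear_outer (t : R) (G : measurableTypeR R * measurableTypeR R -> \bar R) :
  measurable_fun setT G ->
  (forall x, 0 <= G x) ->
  \int[mu]_a \int[mu]_b G (a + t * b, b)%R = \int[mu]_a \int[mu]_b G (a, b).
Proof.
move=> mG G0.
have m2 : measurable_fun setT (fun z : measurableTypeR R * measurableTypeR R =>
    G ((z.1 + t * z.2)%R, z.2)).
  apply: (measurableT_comp (f := G)) => //; apply/measurable_fun_pairP; split => /=.
    by apply: measurable_funD => //; exact: measurable_funM.
  exact: measurable_snd.
transitivity (\int[mu]_b \int[mu]_a G (a + t * b, b)%R).
  exact: (@fubini_tonelli _ _ _ _ _ mu mu _ m2).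
transitivity (\int[mu]_b \int[mu]_a G (a, b)); last first.
  exact/esym/(@fubini_tonelli _ _ _ _ _ mu mu _ mG).
apply: eq_integral => b _.
apply: (ge0_integral_translation (t * b)%R (f := fun a => G (a, b))) => //.
exact: measurableT_comp.
Qed.

(* A rotation by an angle other than pi is a product of three shears. *)
Lemma ge0_integral_rotation (c s : R) (G : measurableTypeR R * measurableTypeR R -> \bar R) :
  (c ^+ 2 + s ^+ 2 = 1)%R -> c != (-1)%R -> measurable_fun setT G ->
  (forall x, 0 <= G x) ->
  \int[mu]_a \int[mu]_b G (c * a - s * b, s * a + c * b)%R =
  \int[mu]_a \int[mu]_b G (a, b).
Proof.
(* For (c, s) = (cos a, sin a) this [t] is -tan(a / 2), which has no finite value at a = pi. *)
move=> cs c1 mG G0; set t := (- s / (1 + c))%R.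
have c10 : (1 + c != 0)%R by rewrite addrC addr_eq0.
have m1 : measurable_fun setT (fun z : measurableTypeR R * measurableTypeR R =>
    G (z.1 + t * z.2, z.2)%R).
  apply: (measurableT_comp (f := G)) => //; apply/measurable_fun_pairP; split => /=.
    by apply: measurable_funD => //; exact: measurable_funM.
  exact: measurable_snd.
have m2 : measurable_fun setT (fun z : measurableTypeR R * measurableTypeR R =>
    G (z.1 + t * (z.2 + s * z.1), z.2 + s * z.1)%R).
  have mz : measurable_fun setT (fun z : measurableTypeR R * measurableTypeR R =>
      (z.2 + s * z.1)%R).
    by apply: measurable_funD => //; exact: measurable_funM.
  apply: (measurableT_comp (f := G)) => //; apply/measurable_fun_pairP; split => //=.
  by apply: measurable_funD => //; exact: measurable_funM.
apply: etrans (shear_outer t mG G0).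
apply: etrans (shear_inner s m1 (fun z => G0 _)).
apply: etrans (shear_outer t m2 (fun z => G0 _)).
have tc : (t * (1 + c) = - s)%R by rewrite /t divfK.
have st : (1 + s * t = c)%R.
  apply: (mulIf c10); rewrite mulrDl mul1r -mulrA tc.
  have -> : (s * - s = c ^+ 2 - 1)%R by rewrite -cs; ring.
  by ring.
apply: eq_integral => a _; apply: eq_integral => b _ /=; congr (G (_, _)).
  transitivity ((1 + s * t) * a + t * (1 + c) * b)%R; first by rewrite st tc; ring.
  by rewrite -st; ring.
by rewrite -{1}st; ring.
Qed.

End Translation.

(** * Measurability of norms of random vectors *)

Section MeasurableCombinations.
Context {R : realType} {X : normedModType R[i]}.

(** Random vectors are restricted to finite combinations of fixed vectors with measurable real
    coefficients, so that their norms are measurable without any sigma-algebra on [X]. *)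
Inductive mcomb d (Z : measurableType d) : (Z -> X) -> Prop :=
| mcomb_cst v : mcomb (fun=> v)
| mcomb_add f (u : Z -> measurableTypeR R) x : mcomb f -> measurable_fun setT u ->
    mcomb (fun z => f z + (u z)%:C *: x).

Lemma mcomb_comp d d' (Z : measurableType d) (Z' : measurableType d')
  (g : Z' -> Z) (f : Z -> X) : measurable_fun setT g -> mcomb f -> mcomb (f \o g).
Proof.
move=> mg; elim => [v|{}f u x _ ih mu]; first exact: mcomb_cst.
by apply: (@mcomb_add _ _ (f \o g) (u \o g) x) => //; exact: measurableT_comp.
Qed.

(* The strict sublevel sets are countable unions over rational approximations
   of the last coefficient, so no separability of [X] is needed. *)
Lemma measurable_rnorm_mcomb d (Z : measurableType d) (f : Z -> X) : mcomb f ->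
  forall v, measurable_fun setT (fun z => rnorm (v + f z)).
Proof.
elim => [w|{}f u x _ ih mu] v; first exact: measurable_cst.
move=> mT; apply: (measurability _ (RGenInftyO.measurableE R)) => //.
move=> _ [_ [c ->] <-]; rewrite setTI.
pose E (q e : rat) := [set z | `|u z - ratr q| * rnorm x < ratr e] `&`
  [set z | rnorm (v + (ratr q)%:C *: x + f z) < c - ratr e].
have mE q e : measurable (E q e).
  apply: measurableI.
    have := @measurable_fun_ltr _ _ _ setT (fun z => `|u z - ratr q| * rnorm x)
      (cst (ratr e)).
    rewrite -[X in measurable X]setTI
      -[X in _ `&` X]/((fun z => `|u z - ratr q| * rnorm x < ratr e) @^-1` [set true]).
    apply => //; apply: measurable_funM => //.
    by apply: measurableT_comp => //; exact: measurable_funB.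
  have := @measurable_fun_ltr _ _ _ setT
    (fun z => rnorm (v + (ratr q)%:C *: x + f z)) (cst (c - ratr e)).
  rewrite -[X in measurable X]setTI
    -[X in _ `&` X]/((fun z => rnorm (v + (ratr q)%:C *: x + f z) < c - ratr e) @^-1` [set true]).
  by apply => //; exact: ih.
rewrite [X in measurable X](_ : _ = \bigcup_q \bigcup_e E q e); last first.
  apply/seteqP; split => z /=; rewrite in_itv/=.
    set F := rnorm _ => Fc; set gap := c - F.
    have gap0 : 0 < gap by rewrite subr_gt0.
    have [e /andP[e1 e2]] : exists e : rat, gap / 4 < ratr e < gap / 2.
      have [|e] := @rat_in_itvoo R (gap / 4) (gap / 2); first lra.
      by rewrite in_itv/=; exists e.
    pose dl := gap / 4 / (rnorm x + 1).
    have x1 : 0 < rnorm x + 1 by rewrite ltr_wpDl ?rnorm_ge0.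
    have dl0 : 0 < dl by rewrite !divr_gt0.
    have [q /andP[q1 q2]] : exists q : rat, u z - dl < ratr q < u z + dl.
      have [|q] := @rat_in_itvoo R (u z - dl) (u z + dl); first lra.
      by rewrite in_itv/=; exists q.
    have uq : `|u z - ratr q| * rnorm x <= gap / 4.
      rewrite (@le_trans _ _ (dl * (rnorm x + 1)))//; last by rewrite divfK ?gt_eqF.
      apply: ler_pM => //; first exact: rnorm_ge0; last lra.
      by rewrite ler_norml; lra.
    exists q => //; exists e => //; split => /=; first lra.
    have -> : v + (ratr q)%:C *: x + f z =
        (v + (f z + (u z)%:C *: x)) - (u z - ratr q)%:C *: x.
      rewrite rmorphB scalerBl opprB [_ *: x - _]addrC !addrA.
      by rewrite addrK addrAC.
    have gE : gap = c - F by [].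
    apply: le_lt_trans (rnormB _ _) _; rewrite rnormZr -/F; lra.
  move=> [q _ [e _ [/= h1 h2]]].
  have -> : v + (f z + (u z)%:C *: x) =
      (v + (ratr q)%:C *: x + f z) + (u z - ratr q)%:C *: x.
    rewrite rmorphB scalerBl [_ *: x - _]addrC [in RHS]addrAC !addrA.
    by rewrite addrK addrAC.
  by rewrite (le_lt_trans (rnormD _ _))// rnormZr; lra.
by apply: bigcupT_measurable_rat => q; exact: bigcupT_measurable_rat.
Qed.

End MeasurableCombinations.

(** * Gaussian sums as iterated integrals *)

Section GaussianIntegral.
Local Open Scope ereal_scope.
Context {R : realType} {X : normedModType R[i]} (sg : R).
Hypothesis sg0 : (sg != 0)%R.
Local Notation N := (normal_prob 0%R sg).
Implicit Types (v x y : X) (s : seq X).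

(* E ||v + sum_k g_k s_k||^2 for independent N(0, sg^2) variables g_k. *)
Fixpoint gI v s : \bar R :=
  if s is x :: s' then \int[N]_a gI (v + (a%:C)%C *: x)%R s'
  else ((rnorm v ^+ 2)%R)%:E.

Lemma gI_ge0 v s : 0 <= gI v s.
Proof.
elim: s v => [|x s ih] v /=; first by rewrite lee_fin sqr_ge0.
by apply: integral_ge0.
Qed.

(** An integrated variable becomes one more measurable coefficient of the combination, now over a
    product space; this is why [Z] and [f] vary in the induction. *)
Lemma measurable_gI s d (Z : measurableType d) (f : Z -> X) : mcomb f ->
  measurable_fun setT (fun z => gI (f z) s).
Proof.
elim: s d Z f => [|x s ih] d Z f mf /=.
  apply/measurable_EFinP/measurable_funX.
  by under eq_fun do rewrite -[f _]add0r; exact: measurable_rnorm_mcomb.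
apply: (measurable_fun_fubini_tonelli_F (m2 := N)
  (fun z : Z * measurableTypeR R => gI (f z.1 + z.2%:C *: x)%R s)) => /=.
  apply: ih; apply: mcomb_add; last exact: measurable_snd.
  by apply: (mcomb_comp _ mf); exact: measurable_fst.
by move=> z; exact: gI_ge0.
Qed.

Lemma measurable_gI2 v x y s :
  measurable_fun setT (fun z : measurableTypeR R * measurableTypeR R =>
    gI (v + (z.1%:C)%C *: x + (z.2%:C)%C *: y)%R s).
Proof.
apply: measurable_gI; apply: mcomb_add; last exact: measurable_snd.
by apply: mcomb_add; [exact: mcomb_cst|exact: measurable_fst].
Qed.

Lemma measurable_gI1 v x s :
  measurable_fun setT (fun a : measurableTypeR R => gI (v + (a%:C)%C *: x)%R s).
Proof. by apply: measurable_gI; apply: mcomb_add => //; exact: mcomb_cst. Qed.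

Lemma le_gI_cons x s s' : (forall v, gI v s <= gI v s') ->
  forall v, gI v (x :: s) <= gI v (x :: s').
Proof.
move=> h v /=; apply: ge0_le_integral => //.
- by move=> a _; exact: gI_ge0.
- exact: measurable_gI1.
- exact: measurable_gI1.
Qed.

Lemma gI_swap v x y s : gI v (x :: y :: s) = gI v (y :: x :: s).
Proof.
rewrite /=; have := @fubini_tonelli _ _ _ _ R N N
  (fun z => gI (v + (z.1%:C)%C *: x + (z.2%:C)%C *: y)%R s) (measurable_gI2 _ _ _ _)
  (fun=> gI_ge0 _ _).
rewrite /= => ->; apply: eq_integral => a _; apply: eq_integral => b _.
by rewrite addrAC.
Qed.

(** The joint density of two independent centred normal variables depends on [a ^+ 2 + b ^+ 2]
    alone, so it is invariant under rotations of (a, b); rotating the variables amounts to rotating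
    the two vectors. *)
Lemma gI_rot c t v x y s : (c ^+ 2 + t ^+ 2 = 1)%R -> (c != -1)%R ->
  gI v ((c%:C *: x + t%:C *: y) :: (- t%:C *: x + c%:C *: y) :: s)%R =
  gI v (x :: y :: s).
Proof.
move=> ct c1 /=; pose f := normal_pdf 0%R sg.
have mf : measurable_fun setT f by exact: measurable_normal_pdf.
have f0 a : (0 <= f a)%R by exact: normal_pdf_ge0.
have NE g : measurable_fun setT g -> (forall a, 0 <= g a) ->
    \int[N]_a g a = \int[lebesgue_measure]_a (g a * (f a)%:E).
  by move=> mg g0; apply: ge0_integral_density.
have NE2 w z : \int[N]_a \int[N]_b gI (v + (a%:C)%C *: w + (b%:C)%C *: z)%R s =
    \int[lebesgue_measure]_a \int[lebesgue_measure]_b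
      (gI (v + (a%:C)%C *: w + (b%:C)%C *: z)%R s * (f a * f b)%:E).
  rewrite NE; last 2 first.
  - exact: (measurable_gI1 v w (z :: s)).
  - by move=> a; apply: integral_ge0 => b _; exact: gI_ge0.
  apply: eq_integral => a _; rewrite NE; last 2 first.
  - exact: measurable_gI1.
  - by move=> b; exact: gI_ge0.
  rewrite -ge0_integralZr//; last 3 first.
  - apply: emeasurable_funM; first exact: measurable_gI1.
    exact/measurable_EFinP.
  - by move=> b _; rewrite mule_ge0 ?gI_ge0 ?lee_fin.
  - by rewrite lee_fin.
  by apply: eq_integral => b _; rewrite -muleA -EFinM [(f b * _)%R]mulrC.
rewrite !NE2.
have := @ge0_integral_rotation R c t (fun z =>
   gI (v + (z.1%:C)%C *: x + (z.2%:C)%C *: y)%R s * (f z.1 * f z.2)%:E) ct c1.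
move=> /(_ _ _)/wrap[||h].
- apply: emeasurable_funM; first exact: measurable_gI2.
  apply/measurable_EFinP/measurable_funM; apply: (measurableT_comp mf).
    exact: measurable_fst.
  exact: measurable_snd.
- by move=> z; rewrite mule_ge0 ?gI_ge0// lee_fin mulr_ge0.
rewrite /= in h; rewrite -h; apply: eq_integral => a _; apply: eq_integral => b _.
congr (gI _ _ * _%:E).
  rewrite !scalerDr !scalerA -!addrA; congr (_ + _)%R.
  rewrite addrA addrACA -!scalerDl; congr (_ *: _ + _ *: _)%R; simpc; congr (_ +i* _)%C; ring.
rewrite /f /normal_pdf (negbTE sg0) /normal_fun !subr0.
rewrite mulrACA -expRD [in RHS]mulrACA -expRD; congr (_ * _ * expR _)%R.
by rewrite -!mulrDl -!opprD; congr (- _ / _)%R; rewrite -[(a ^+ 2 + b ^+ 2)%R]mul1r -ct; ring.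
Qed.

End GaussianIntegral.

Lemma mcomb_sum {R : realType} {X : normedModType R[i]} d (Z : measurableType d)
    (I : Type) (r : seq I) (f : Z -> X) (u : I -> Z -> measurableTypeR R) (x : I -> X) :
  mcomb f -> (forall j, measurable_fun setT (u j)) ->
  mcomb (fun z => f z + \sum_(j <- r) (u j z)%:C *: x j).
Proof.
move=> mf mu; elim: r f mf => [|j r ih] f mf.
  by under eq_fun do rewrite big_nil addr0.
under eq_fun do rewrite big_cons addrA.
by apply: ih; exact: mcomb_add.
Qed.

(** * Independence of one variable from the block that follows it *)

Section IndependentSequence.
Local Open Scope ereal_scope.
Context {R : realType} d (Omega : measurableType d) (P : probability Omega R).
Variables (N : probability (measurableTypeR R) R).
Variable g : nat -> Omega -> measurableTypeR R.
Hypothesis mg : forall k, measurable_fun setT (g k).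
Hypothesis g_indep : forall n (B : nat -> set (measurableTypeR R)),
  (forall k, measurable (B k)) ->
  P (\bigcap_(k in `I_n) (g k @^-1` B k)) = \prod_(k < n) N (B k).

Definition block i n (w : Omega) : n.-tuple (measurableTypeR R) :=
  [tuple g (i + j)%N w | j < n].

Lemma measurable_block i n : measurable_fun setT (block i n).
Proof.
apply/measurable_fun_tnthP => j; apply: eq_measurable_fun (mg (i + j)) => w _ /=.
by rewrite tnth_mktuple.
Qed.

Definition cylinder n (B : nat -> set (measurableTypeR R)) :
  set (n.-tuple (measurableTypeR R)) := [set t | forall j : 'I_n, B j (tnth t j)].

Definition cylinders n := [set C | exists2 B, (forall k, measurable (B k)) & C = @cylinder n B].
Arguments cylinders : clear implicits.

Lemma cylinders_setT n : cylinders n setT.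
Proof. by exists (fun=> setT) => //; apply/seteqP; split. Qed.

Lemma cylinders_setI n : setI_closed (cylinders n).
Proof.
move=> _ _ [B mB ->] [C mC ->]; exists (fun k => B k `&` C k).
  by move=> k; exact: measurableI.
by apply/seteqP; split => t /=; [move=> [h1 h2] j; split|move=> h; split => j; case: (h j)].
Qed.

Lemma measurable_cylinder n B : (forall k, measurable (B k)) -> measurable (@cylinder n B).
Proof.
move=> mB; have -> : @cylinder n B = \bigcap_(j in [set: 'I_n]) ((@tnth n _)^~ j @^-1` B j).
  by apply/seteqP; split => t /= h j; [move=> _; exact: h|exact: h].
apply: fin_bigcap_measurable => // j _.
by rewrite -[X in measurable X]setTI; apply: measurable_tnth.
Qed.

Lemma measurable_tuple_cylinders n :
  @measurable _ (n.-tuple (measurableTypeR R)) = <<s cylinders n >>.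
Proof.
apply/seteqP; split.
  apply: smallest_sub; first exact: smallest_sigma_algebra.
  rewrite -bigcup_seq; apply: bigcup_sub => j _ _ [A mA <-].
  apply: sub_sigma_algebra; exists (fun k : nat => if k == j :> nat then A else setT).
    by move=> k; case: ifP.
  apply/seteqP; split => t /=; last by move=> /(_ j); rewrite eqxx.
  move=> [_ tA] i; case: ifP => // /eqP/val_inj ->; exact: tA.
apply: smallest_sub; first exact: sigma_algebra_measurable.
by move=> _ [B mB ->]; exact: measurable_cylinder.
Qed.

Lemma prob_cylinder i n A B : measurable A -> (forall k, measurable (B k)) ->
  P (g i @^-1` A `&` block i.+1 n @^-1` @cylinder n B) = N A * \prod_(j < n) N (B j).
Proof.
move=> mA mB.
(* Independence is given for initial segments of indices, so the indices below [i] receive the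
   trivial event. *)
pose C k := if (k < i)%N then setT else if k == i then A else B (k - i.+1)%N.
have mC k : measurable (C k) by rewrite /C; case: ifP => // _; case: ifP.
have := g_indep (i.+1 + n) mC.
rewrite big_split_ord/= big_ord_recr/= big1 ?mul1e; last first.
  by move=> k _; rewrite /C ltn_ord probability_setT.
have -> : C i = A by rewrite /C ltnn eqxx.
under [X in _ = _ * X -> _]eq_bigr => j _.
  rewrite /C ltnNge (leq_trans (leqnSn i) (leq_addr _ _))/= gtn_eqF ?leq_addr// addKn.
  over.
move=> <-; congr (P _); apply/seteqP; split => w /=.
  move=> [gA h] k kn; rewrite /C; case: ifPn => //; rewrite -leqNgt => ik.
  case: eqP => [->//|/eqP ki].
  have ik' : (i.+1 <= k)%N by rewrite ltn_neqAle eq_sym ki.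
  have kn' : (k - i.+1 < n)%N by rewrite ltn_subLR.
  by have := h (Ordinal kn'); rewrite tnth_mktuple/= subnKC.
move=> h; split; first by have := h i; rewrite /C ltnn eqxx; apply; rewrite /= ltn_addr.
move=> j; rewrite tnth_mktuple; have := h (i.+1 + j)%N; rewrite /C.
rewrite ltnNge (leq_trans (leqnSn i) (leq_addr _ _))/= gtn_eqF ?leq_addr// addKn.
by apply; rewrite ltn_add2l.
Qed.

(** Both sides are finite measures in [E] that agree on cylinders, and the cylinders form a
    pi-system generating the measurable sets of tuples. *)
Lemma prob_block i n A E : measurable A -> measurable E ->
  P (g i @^-1` A `&` block i.+1 n @^-1` E) = N A * P (block i.+1 n @^-1` E).
Proof.
move=> mA mE; have mY := @measurable_block i.+1 n.
have mgA : measurable (g i @^-1` A) by rewrite -[X in measurable X]setTI; exact: mg.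
have NA0 : (0 <= fine (N A))%R by rewrite fine_ge0.
have NAE : (fine (N A))%:E = N A by rewrite fineK// fin_num_measure.
pose Y : {mfun Omega >-> n.-tuple (measurableTypeR R)} := HB.pack (block i.+1 n)
  (isMeasurableFun.Build _ _ _ _ _ mY).
have : pushforward (mrestr P mgA) (block i.+1 n) E =
       mscale (NngNum NA0) (distribution P Y) E.
  apply: (measure_unique (cylinders n) (fun=> setT)) => //.
  - exact: measurable_tuple_cylinders.
  - exact: cylinders_setI.
  - by move=> _; exact: cylinders_setT.
  - by rewrite bigcup_const//; exists 0%N.
  - move=> _ [B mB ->].
    rewrite -[LHS]/(P (block i.+1 n @^-1` @cylinder n B `&` g i @^-1` A)).
    rewrite -[RHS]/((fine (N A))%:E * P (block i.+1 n @^-1` @cylinder n B)) NAE.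
    rewrite setIC prob_cylinder//; congr (_ * _).
    have := prob_cylinder i n measurableT mB.
    by rewrite preimage_setT setTI probability_setT mul1e => ->.
  - move=> _; rewrite -[X in X < _]/(P (block i.+1 n @^-1` setT `&` g i @^-1` A)).
    by rewrite (le_lt_trans (probability_le1 _ _)) ?ltry// preimage_setT setTI.
rewrite -[X in X = _ -> _]/(P (block i.+1 n @^-1` E `&` g i @^-1` A)).
rewrite -[X in _ = X -> _]/((fine (N A))%:E * P (block i.+1 n @^-1` E)) NAE.
by rewrite setIC.
Qed.

(** The joint law of [g i] and the next [n] variables is the product of [N] with the law of the
    block; Tonelli then integrates out [g i], one step of the recursion defining [gI]. *)
Lemma integral_block i n (F : measurableTypeR R * n.-tuple (measurableTypeR R) -> \bar R) :
  measurable_fun setT F -> (forall z, 0 <= F z) ->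
  \int[P]_w F (g i w, block i.+1 n w) = \int[N]_a \int[P]_w F (a, block i.+1 n w).
Proof.
move=> mF F0; have mY := @measurable_block i.+1 n.
pose h w := (g i w, block i.+1 n w).
have mh : measurable_fun setT h by apply/measurable_fun_pairP; split => //; exact: mg.
pose Y : {mfun Omega >-> n.-tuple (measurableTypeR R)} := HB.pack (block i.+1 n)
  (isMeasurableFun.Build _ _ _ _ _ mY).
pose Q := distribution P Y.
transitivity (\int[pushforward P h]_z F z); first by rewrite ge0_integral_pushforward.
transitivity (\int[N \x Q]_z F z).
  apply: eq_measure_integral => A mA _; apply/esym.
  apply: (product_measure_unique (m' := pushforward P h)) => // B E mB mE.
  by rewrite /pushforward -prob_block//; congr (P _).
rewrite fubini_tonelli1//; apply: eq_integral => a _ /=.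
rewrite /fubini_F/= /Q ge0_integral_distribution//.
exact: measurableT_comp.
Qed.

End IndependentSequence.

Section GaussianSum.
Local Open Scope ereal_scope.
Context {R : realType} d (Omega : measurableType d) (P : probability Omega R).
Context {X : normedModType R[i]} (sg : R).
Local Notation N := (normal_prob 0%R sg).
Variable g : nat -> Omega -> measurableTypeR R.
Hypothesis mg : forall k, measurable_fun setT (g k).
Hypothesis g_indep : forall n (B : nat -> set (measurableTypeR R)),
  (forall k, measurable (B k)) ->
  P (\bigcap_(k in `I_n) (g k @^-1` B k)) = \prod_(k < n) N (B k).

Lemma integral_gaussian_sum (s : seq X) v i :
  \int[P]_w (rnorm (v + \sum_(j < size s) (g (i + j)%N w)%:C%C *: s`_j)%R ^+ 2)%:E =
  gI sg v s.
Proof.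
elim: s v i => [|x s ih] v i /=.
  under eq_integral do rewrite big_ord0 addr0.
  by rewrite integral_cst//= probability_setT mule1.
pose f (z : measurableTypeR R * (size s).-tuple (measurableTypeR R)) : X :=
  (v + z.1%:C%C *: x + \sum_(j < size s) (tnth z.2 j)%:C%C *: s`_j)%R.
have mf : mcomb f.
  apply: mcomb_sum; first by apply: mcomb_add; [exact: mcomb_cst|exact: measurable_fst].
  by move=> j; apply: (measurableT_comp (measurable_tnth j)); exact: measurable_snd.
transitivity (\int[P]_w (rnorm (f (g i w, block g i.+1 (size s) w)) ^+ 2)%:E).
  apply: eq_integral => w _; congr (_ ^+ 2)%:E; congr rnorm.
  rewrite /f big_ord_recl /= addn0 addrA; congr (_ + _)%R; apply: eq_bigr => j _.
  by rewrite tnth_mktuple /= addnS addSn.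
rewrite (@integral_block _ _ _ _ _ g mg g_indep i _ (fun z => (rnorm (f z) ^+ 2)%:E)); last 2 first.
- apply/measurable_EFinP/measurable_funX.
  by under eq_fun do rewrite -[f _]add0r; exact: measurable_rnorm_mcomb.
- by move=> z; rewrite lee_fin sqr_ge0.
apply: eq_integral => a _; rewrite -(ih (v + a%:C%C *: x)%R i.+1).
apply: eq_integral => w _; congr (_ ^+ 2)%:E; congr rnorm; rewrite /f /=.
by congr (_ + _)%R; apply: eq_bigr => j _; rewrite tnth_mktuple.
Qed.

End GaussianSum.

(** * From complex to real Gaussian variables *)

Section ComplexGaussian.
Local Open Scope ereal_scope.
Context {R : realType} d (Omega : measurableType d) (P : probability Omega R).
Variable gamma : nat -> Omega -> R[i].
Hypothesis gammaP : gaussian_sequence P gamma.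
Context {X : normedModType R[i]}.
Local Notation sg := (Num.sqrt 2 : R)^-1%R.
Local Notation N := (normal_prob 0%R sg).

(** Interleaving gives one sequence of independent real normal variables, to which the iterated
    integrals [gI] apply. *)
Definition re_im_seq k : Omega -> measurableTypeR R :=
  fun w => if odd k then complex.Im (gamma k./2 w) else complex.Re (gamma k./2 w).

Lemma measurable_re_im_seq k : measurable_fun setT (re_im_seq k).
Proof.
have [/(_ k./2) [mk _] _] := gammaP.
rewrite /re_im_seq; case: (odd k).
  exact: (measurableT_comp measurable_snd mk).
exact: (measurableT_comp measurable_fst mk).
Qed.

Let indep_double n (B : nat -> set (measurableTypeR R)) :
  (forall k, measurable (B k)) ->
  P (\bigcap_(k in `I_n.*2) (re_im_seq k @^-1` B k)) = \prod_(k < n.*2) N (B k).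
Proof.
move=> mB; have [g1 g2] := gammaP.
pose C k : set (plane R) := B k.*2 `*` B k.*2.+1.
have mC k : measurable (C k) by exact: measurableX.
have := g2 (iota 0 n) C (iota_uniq 0 n) mC.
have -> : \prod_(k <- iota 0 n) P (re_im (gamma k) @^-1` C k) =
    \prod_(k < n.*2) N (B k).
  under eq_bigr => k _.
    have [_ ->//] := g1 k; rewrite product_measure1E//; over.
  rewrite -{1}[n]subn0 -/(index_iota 0 n) big_mkord.
  elim: n => [|n ih]; first by rewrite !big_ord0.
  by rewrite doubleS !big_ord_recr/= ih muleA.
move=> <-; congr (P _); apply/seteqP; split => w /= h k /=.
  rewrite mem_iota add0n /= => kn; split => /=.
    have := h k.*2; rewrite /re_im_seq odd_double doubleK; apply.
    by rewrite /= ltn_double.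
  have := h k.*2.+1; rewrite /re_im_seq /= odd_double/= uphalf_double; apply.
  by rewrite /= -doubleS leq_double.
move=> kn; rewrite /re_im_seq.
have [|h1 h2] := h k./2; first by rewrite /= mem_iota add0n /= ltn_half_double.
rewrite -{1}[k]odd_double_half.
by case: (odd k); rewrite /= ?add1n ?add0n.
Qed.

Lemma re_im_seq_indep n (B : nat -> set (measurableTypeR R)) :
  (forall k, measurable (B k)) ->
  P (\bigcap_(k in `I_n) (re_im_seq k @^-1` B k)) = \prod_(k < n) N (B k).
Proof.
(* Real and imaginary parts come in pairs, so the segment is padded to even length by trivial
   events. *)
move=> mB; pose C k := if (k < n)%N then B k else setT.
have mC k : measurable (C k) by rewrite /C; case: ifP.
have nn : (n <= n.*2)%N by rewrite -addnn leq_addr.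
have := indep_double n mC.
rewrite -(big_mkord xpredT (fun k => N (C k))) (big_cat_nat (n := n))//=.
rewrite [X in _ * X]big_nat [X in _ * X]big1 ?mule1; last first.
  by move=> k /andP[nk _]; rewrite /C ltnNge nk/= probability_setT.
rewrite big_mkord.
have -> : \prod_(k < n) N (C k) = \prod_(k < n) N (B k).
  by apply: eq_bigr => k _; rewrite /C ltn_ord.
move=> <-; congr (P _); apply/seteqP; split => w /= h k /=.
  by move=> _; rewrite /C; case: ifP => // kn; exact: h.
by move=> kn; have := h k (leq_trans kn nn); rewrite /C kn.
Qed.

(** A complex Gaussian multiple of [x] is a combination of [x] and ['i *: x] with two independent
    real coefficients. *)
Definition real_pairs (s : seq X) : seq X :=
  flatten [seq [:: x; 'i%C *: x] | x <- s].

Lemma expectation_gaussian_sum (s : seq X) :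
  'E_P[fun w => (rnorm (\sum_(k < size s) gamma k w *: s`_k) ^+ 2)%R] =
  gI sg 0%R (real_pairs s).
Proof.
rewrite unlock -(integral_gaussian_sum measurable_re_im_seq re_im_seq_indep _ _ 0%N).
apply: eq_integral => w _; congr (_ ^+ 2)%:E; congr rnorm; rewrite add0r.
have szE : size (real_pairs s) = (size s).*2.
  by elim: s => //= x s ih; rewrite doubleS -ih.
have nthE k : ((real_pairs s)`_k.*2 = s`_k /\ (real_pairs s)`_k.*2.+1 = 'i%C *: s`_k)%R.
  elim: s k {szE} => [|x s ih] [|k] //=; first by rewrite scaler0.
  by rewrite scaler0.
rewrite szE; elim: (size s) => [|n ih]; first by rewrite !big_ord0.
rewrite doubleS !big_ord_recr/= ih -addrA; congr (_ + _)%R.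
have [-> ->] := nthE n.
rewrite /re_im_seq !add0n /= odd_double/= doubleK uphalf_double scalerA -scalerDl.
by rewrite {1}(complexE (gamma n w)) mulrC.
Qed.

End ComplexGaussian.

(** * Operations on the coefficients that do not increase a Gaussian sum *)

Section Domination.
Context {R : realType} {X : normedModType R[i]}.
Local Notation sg := (Num.sqrt 2 : R)^-1.
Local Notation N := (normal_prob 0 sg).
Local Notation J v s := (@gI R X sg v%R s%R).
Local Arguments gI : simpl never.
Implicit Types (v x y : X) (l r s : seq X).

Let gI_cons v x s : J v (x :: s) = (\int[N]_a J (v + a%:C *: x) s)%E.
Proof. by []. Qed.

Let sg0 : sg != 0.
Proof. by rewrite invr_eq0 sqrtr_eq0 -ltNge. Qed.

Lemma le_gI_cat l s s' : (forall v, (J v s <= J v s')%E) ->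
  forall v, (J v (l ++ s) <= J v (l ++ s'))%E.
Proof. by move=> h; elim: l => //= x l ih v; exact: le_gI_cons. Qed.

Lemma eq_gI_cons x s s' : (forall v, J v s = J v s') ->
  forall v, J v (x :: s) = J v (x :: s').
Proof. by move=> h v; rewrite !gI_cons; apply: eq_integral => a _. Qed.

Lemma gI_catC_cons v l x r : J v (l ++ x :: r) = J v (x :: l ++ r).
Proof.
elim: l v => //= y l ih v; rewrite -[RHS]gI_swap.
exact: (@eq_gI_cons y (l ++ x :: r) (x :: l ++ r)).
Qed.

Lemma gI_perm s s' : perm_eq s s' -> forall v, J v s = J v s'.
Proof.
elim: s s' => [|x s ih] s' ss'; first by move: ss'; rewrite perm_sym => /perm_nilP ->.
have xs' : x \in s' by rewrite -(perm_mem ss') mem_head.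
move=> v; have [s1 [s2 E]] : exists s1 s2, s' = s1 ++ x :: s2.
  by case/splitPr: xs' => s1 s2; exists s1, s2.
rewrite E gI_catC_cons; apply: eq_gI_cons => {}v; apply: ih.
rewrite -(perm_cons x); apply: (perm_trans ss').
by rewrite E -[x :: s2]cat1s perm_catCA.
Qed.

Lemma gI_zero v s : J v (0 :: s) = J v s.
Proof.
rewrite gI_cons; under eq_integral do rewrite scaler0 addr0.
by rewrite integral_cst//= probability_setT mule1.
Qed.

(** A right-angle rotation of the pair (x, 0) produces (0, -x); the half turn is not covered by
    [gI_rot]. *)
Lemma gI_opp v x s : J v ((- x) :: s) = J v (x :: s).
Proof.
have := @gI_rot R X sg sg0 0 1 v x 0 s; rewrite expr0n expr1n add0r eq_sym oppr_eq0.
rewrite oner_eq0 => /(_ erefl isT).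
rewrite !scale0r !scaler0 add0r addr0 scaleN1r gI_zero => ->.
by rewrite gI_swap gI_zero.
Qed.

Lemma gI_convex (t : R) s : (0 <= t <= 1) -> forall u w : X,
  (J (t%:C *: u + (1 - t)%:C *: w) s <= t%:E * J u s + (1 - t)%:E * J w s)%E.
Proof.
move=> /andP[t0 t1]; elim: s => [|x s ih] u w.
  rewrite /gI -!EFinM -EFinD lee_fin.
  apply: (@le_trans _ _ ((t * rnorm u + (1 - t) * rnorm w) ^+ 2)).
    rewrite ler_pXn2r ?nnegrE ?rnorm_ge0//; last first.
      by rewrite addr_ge0 ?mulr_ge0 ?rnorm_ge0 ?subr_ge0.
    rewrite (le_trans (rnormD _ _))// !rnormZr !ger0_norm ?subr_ge0//.
  rewrite -subr_ge0.
  rewrite [X in (0 <= X)](_ : _ = t * (1 - t) * (rnorm u - rnorm w) ^+ 2).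
    by rewrite mulr_ge0 ?sqr_ge0// mulr_ge0// subr_ge0.
  ring.
have mg z := @measurable_gI1 R X sg z x s.
have g0 z := @gI_ge0 R X sg z s.
rewrite !gI_cons -!ge0_integralZl ?lee_fin ?subr_ge0//.
rewrite -ge0_integralD//; last 4 first.
- by move=> a _; rewrite mule_ge0// lee_fin.
- exact: measurable_funeM.
- by move=> a _; rewrite mule_ge0// lee_fin subr_ge0.
- exact: measurable_funeM.
apply: ge0_le_integral => //.
- by apply: emeasurable_funD; exact: measurable_funeM.
move=> a _; apply: le_trans (ih _ _).
rewrite le_eqVlt; apply/orP; left; apply/eqP; congr (J _ _).
rewrite !scalerDr addrACA; congr (_ + _).
by rewrite -scalerDl -rmorphD/= [t + _]addrC subrK scale1r.
Qed.

(** The vector t x is a convex combination of x and -x with weights (1 + t) / 2 and (1 - t) / 2.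
    Convexity in the offset applies, and both endpoints have the same integral by symmetry. *)
Lemma gI_shrink (t : R) v x s : (0 <= t <= 1) ->
  (J v ((t%:C *: x) :: s) <= J v (x :: s))%E.
Proof.
move=> /andP[t0 t1]; pose th := ((1 + t) / 2).
have th01 : (0 <= th <= 1) by rewrite /th; apply/andP; split; lra.
have /andP[th0 th1] := th01.
have mg z := @measurable_gI1 R X sg v z s.
have g0 z := @gI_ge0 R X sg z s.
have -> : J v (x :: s) = (th%:E * J v (x :: s) + (1 - th)%:E * J v ((- x) :: s))%E.
  by rewrite gI_opp -ge0_muleDl ?lee_fin ?subr_ge0// -EFinD addrC subrK mul1e.
rewrite !gI_cons -!ge0_integralZl ?lee_fin ?subr_ge0//.
rewrite -ge0_integralD//; last 4 first.
- by move=> a _; rewrite mule_ge0// lee_fin.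
- exact: measurable_funeM.
- by move=> a _; rewrite mule_ge0// lee_fin subr_ge0.
- exact: measurable_funeM.
apply: ge0_le_integral => //.
- by apply: emeasurable_funD; exact: measurable_funeM.
move=> a _; apply: le_trans (gI_convex s th01 _ _).
rewrite le_eqVlt; apply/orP; left; apply/eqP; congr (J _ _).
rewrite !scalerDr addrACA -scalerDl -rmorphD/= [th + _]addrC subrK scale1r; congr (_ + _).
rewrite !scalerN -scalerBl !scalerA -rmorphB -!rmorphM/=; congr (_%:C *: _).
by rewrite /th; field.
Qed.

Lemma gI_drop v x s : (J v s <= J v (x :: s))%E.
Proof.
have := @gI_shrink 0 v x s; rewrite lexx ler01 scale0r gI_zero; exact.
Qed.

(* [cle s s'] says that E ||v + sum_k gamma_k s'_k||^2 <= E ||v + sum_k gamma_k s_k||^2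
   for every Gaussian [v] independent of the [gamma_k]. *)
Definition cle (s s' : seq X) := forall v r,
  (J v (real_pairs s' ++ r) <= J v (real_pairs s ++ r))%E.

Lemma real_pairs_cat s s' : real_pairs (s ++ s') = real_pairs s ++ real_pairs s'.
Proof. by rewrite /real_pairs map_cat flatten_cat. Qed.

Lemma cle_refl s : cle s s. Proof. by move=> v r. Qed.

Lemma cle_trans s1 s2 s3 : cle s1 s2 -> cle s2 s3 -> cle s1 s3.
Proof. by move=> h1 h2 v r; exact: le_trans (h2 v r) (h1 v r). Qed.

Lemma cle_cat s1 s1' s2 s2' : cle s1 s1' -> cle s2 s2' -> cle (s1 ++ s2) (s1' ++ s2').
Proof.
move=> h1 h2 v r; rewrite !real_pairs_cat -!catA.
apply: le_trans (h1 _ _); apply: le_gI_cat => {}v; exact: h2.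
Qed.

Lemma cle_perm s s' : perm_eq s s' -> cle s s'.
Proof.
move=> ss' v r; rewrite le_eqVlt; apply/orP; left; apply/eqP; apply: gI_perm.
by rewrite perm_cat2r /real_pairs perm_flatten// perm_map// perm_sym.
Qed.

Lemma cle_nil1 : cle [::] [:: 0].
Proof. by move=> v r; rewrite /real_pairs /= scaler0 !gI_zero. Qed.

Lemma cle_drop x : cle [:: x] [::].
Proof. by move=> v r; apply: le_trans (gI_drop _ _ _) (gI_drop _ _ _). Qed.

Lemma cle_shrink (t : R) x : (0 <= t <= 1) -> cle [:: x] [:: (t%:C *: x)].
Proof.
move=> t01 v r; rewrite /real_pairs/= scalerA mulrC -scalerA.
apply: le_trans (gI_shrink _ _ _ t01) _.
by apply: le_gI_cons => w; exact: gI_shrink.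
Qed.

Lemma cle_opp x : cle [:: x] [:: (- x)].
Proof.
move=> v r; rewrite /real_pairs/= scalerN gI_opp.
by apply: le_gI_cons => w; rewrite gI_opp.
Qed.

(** Multiplication by z = a + ib rotates the real pair (x, ix), since z x = a x + b (ix) and i z x =
    -b x + a (ix). The value z = -1 is the half turn, done by a sign change. *)
Lemma cle_phase (z : R[i]) x : cabs z = 1 -> cle [:: x] [:: (z *: x)].
Proof.
move=> z1; have [zN1|zN1] := eqVneq (complex.Re z) (-1).
  suff -> : z = -1 by rewrite scaleN1r; exact: cle_opp.
  move: z1 zN1; case: z => a b; rewrite /cabs normc_def/= => h aE.
  move: h; rewrite aE sqrrN expr1n => /(congr1 (fun u => u ^+ 2)).
  rewrite sqr_sqrtr ?addr_ge0 ?sqr_ge0// expr1n => /eqP.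
  rewrite -subr_eq0 addrAC subrr add0r sqrf_eq0 => /eqP ->.
  by apply/eqP; rewrite eq_complex /= oppr0 !eqxx.
move=> v r; rewrite /real_pairs/=.
have := @gI_rot R X sg sg0 (complex.Re z) (complex.Im z) v x ('i%C *: x) r _ zN1.
move=> /(_ _)/wrap[].
  move: z1; case: z {zN1} => a b; rewrite /cabs normc_def/=.
  move=> /(congr1 (fun u => u ^+ 2)); rewrite sqr_sqrtr ?addr_ge0 ?sqr_ge0//.
  by rewrite expr1n.
rewrite !scalerA -!scalerDl.
have -> : (complex.Re z)%:C + (complex.Im z)%:C * 'i%C = z by rewrite [RHS]complexE mulrC.
have -> : - (complex.Im z)%:C + (complex.Re z)%:C * 'i%C = 'i%C * z.
  by case: z {z1 zN1} => a b; apply/eqP; rewrite eq_complex/=; apply/andP; split; apply/eqP; ring.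
by move=> ->.
Qed.

Lemma cle_scale (z : R[i]) x : (cabs z <= 1) -> cle [:: x] [:: (z *: x)].
Proof.
move=> z1; have [->|z0] := eqVneq z 0.
  by rewrite scale0r; apply: cle_trans (cle_drop x) cle_nil1.
have n0 : cabs z != 0 by rewrite cabs_eq0.
have -> : z = ((cabs z)%:C * (z / (cabs z)%:C)).
  by rewrite mulrCA divff ?mulr1// -cabsE normr_eq0.
rewrite -scalerA; apply: (cle_trans (s2 := [:: (z / (cabs z)%:C *: x)])).
  apply: cle_phase; rewrite cabsM cabsV cabs_real ger0_norm ?cabs_ge0//.
  by rewrite divff.
by apply: cle_shrink; rewrite cabs_ge0.
Qed.

(** A rotation by pi / 4 followed by one sign change, performed on (x, y) and on (ix, iy). *)
Lemma cle_butterfly x y : cle [:: x; y]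
  [:: ((Num.sqrt 2)^-1%:C *: (x + y)); ((Num.sqrt 2)^-1%:C *: (x - y))].
Proof.
have c1 : (sg ^+ 2 + sg ^+ 2 = 1).
  by rewrite exprVn sqr_sqrtr//; lra.
have cN1 : sg != (-1) by rewrite gt_eqF// (lt_trans (ltrN10 _))// invr_gt0 sqrtr_gt0.
have rot w u1 u2 r : J w [:: sg%:C *: (u1 + u2), sg%:C *: (u1 - u2) & r] =
    J w [:: u1, u2 & r].
  rewrite -(@gI_rot R X sg sg0 sg sg w u1 u2 r c1 cN1) -scalerDr; apply: eq_gI_cons => {}w.
  by rewrite -gI_opp scalerBr opprB addrC scaleNr.
have iZ (u : X) : 'i%C *: (sg%:C *: u) = sg%:C *: ('i%C *: u) by rewrite !scalerA mulrC.
move=> v r; rewrite /real_pairs/= !iZ ['i%C *: (x + y)]scalerDr ['i%C *: (x - y)]scalerBr.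
apply: (@le_trans _ _ (J v [:: x, y, 'i%C *: x, 'i%C *: y & r])); last first.
  rewrite (gI_perm (s' := [:: x, 'i%C *: x, y, 'i%C *: y & r]))//.
  by rewrite perm_cons (perm_catCA [:: y] [:: 'i%C *: x]).
rewrite -(rot v x y) [leLHS](@gI_perm _ [:: sg%:C *: (x + y), sg%:C *: (x - y),
  sg%:C *: ('i%C *: x + 'i%C *: y), sg%:C *: ('i%C *: x - 'i%C *: y) & r]).
  by apply: le_gI_cons => w; apply: le_gI_cons => {}w; rewrite rot.
by rewrite perm_cons (perm_catCA [:: _] [:: _]).
Qed.

End Domination.

(** * Type and cotype turned into an inequality between sequences *)

Section TypeCotype.
Context {R : realType} d (Omega : measurableType d) (P : probability Omega R).
Variable gamma : nat -> Omega -> R[i].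
Hypothesis gammaP : gaussian_sequence P gamma.
Context {X : normedModType R[i]}.
Implicit Types s : seq X.

Definition lp_seq (p : R) s : R := (\sum_(x <- s) rnorm x `^ p) `^ p^-1.

Lemma lp_seqE p s : lp_norm p (fun k : 'I_(size s) => s`_k) = lp_seq p s.
Proof. by rewrite /lp_norm /lp_seq (big_nth 0) big_mkord. Qed.

Let gaussian_normE s : gaussian_norm P gamma (fun k : 'I_(size s) => s`_k) =
  (gI (Num.sqrt 2)^-1 0%R (real_pairs s) `^ 2^-1)%E.
Proof. by rewrite /gaussian_norm (expectation_gaussian_sum gammaP). Qed.

(** Type bounds the Gaussian sum of [s] above, cotype bounds that of [s'] below, and [cle] compares
    the two. The absolute values in the constant are there because the given constants carry no
    sign. *)
Lemma cle_type_cotype (p q : R) : has_type P gamma X p -> has_cotype P gamma X q ->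
  exists2 C : R, 0 <= C & forall s s', cle s s' -> lp_seq q s' <= C * lp_seq p s.
Proof.
move=> [_ [Cp hp]] [_ [Cq hq]]; exists (`|Cq| * `|Cp|); first by rewrite mulr_ge0.
move=> s s' ss'.
have lp0 : 0 <= lp_seq p s by exact: powR_ge0.
have := hq _ (fun k : 'I_(size s') => s'`_k); rewrite lp_seqE.
have := hp _ (fun k : 'I_(size s) => s`_k); rewrite lp_seqE !gaussian_normE.
set a := (gI _ _ (real_pairs s) `^ _)%E; set b := (gI _ _ (real_pairs s') `^ _)%E.
move=> ha hb.
have ab : (b <= a)%E.
  apply: gt0_ler_poweR; rewrite ?in_itv/= ?gI_ge0 ?leey ?invr_ge0//.
  by have := ss' 0 [::]; rewrite !cats0.
rewrite -lee_fin; apply: (le_trans hb).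
apply: (@le_trans _ _ ((`|Cq|)%:E * a)%E).
  apply: (@le_trans _ _ ((`|Cq|)%:E * b)%E).
    by apply: lee_wpmul2r; rewrite ?poweR_ge0// lee_fin ler_norm.
  by apply: lee_wpmul2l => //; rewrite lee_fin.
apply: (@le_trans _ _ ((`|Cq|)%:E * (Cp * lp_seq p s)%:E)%E).
  by apply: lee_wpmul2l => //; rewrite lee_fin.
by rewrite -EFinM lee_fin -mulrA ler_wpM2l// ler_wpM2r// ler_norm.
Qed.

End TypeCotype.

(** * Spreading, block sums and the fast Fourier transform *)

Section Circulant.
Context {R : realType} {X : normedModType R[i]}.
Local Notation c2 := ((Num.sqrt (2 : R))^-1%:C).
Implicit Types (x y : X) (s : seq X) (f g : nat -> X).

Let c2E : c2 * c2 * 2 = 1.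
Proof.
rewrite -rmorphM -expr2 exprVn sqr_sqrtr//=.
by rewrite -(rmorph_nat (real_complex R) 2) -rmorphM/= mulVf.
Qed.

Lemma mkseqS f n : mkseq f n.+1 = mkseq f n ++ [:: f n].
Proof. by rewrite /mkseq -[n.+1]addn1 iotaD map_cat add0n. Qed.

Lemma mkseqD f n m : mkseq f (n + m) = mkseq f n ++ mkseq (fun k => f (n + k)%N) m.
Proof. by rewrite /mkseq iotaD map_cat add0n -[in iota n m](addn0 n) iotaDl -map_comp. Qed.

Lemma cle_mkseq f g n : (forall k, (k < n)%N -> cle [:: f k] [:: g k]) ->
  cle (mkseq f n) (mkseq g n).
Proof.
elim: n => [|n ih] fg; first exact: cle_refl.
rewrite !mkseqS; apply: cle_cat; last exact: fg.
by apply: ih => k kn; apply: fg; exact: ltnW.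
Qed.

Lemma cle_catl s s' : cle (s ++ s') s'.
Proof.
elim: s => [|x s ih]; first exact: cle_refl.
by apply: cle_trans ih; rewrite -cat1s; apply: (cle_cat (cle_drop x) (cle_refl _)).
Qed.

Lemma cle_catr s s' : cle (s ++ s') s.
Proof.
apply: (cle_trans (s2 := s' ++ s)); last exact: cle_catl.
by apply: cle_perm; rewrite perm_catC.
Qed.

(** A butterfly on (x, 0) yields two copies of [c2 *: x]; iterating it [m] times gives [2 ^ m]
    copies. *)
Lemma cle_spread1 m x : cle [:: x] (nseq (2 ^ m) (c2 ^+ m *: x)).
Proof.
elim: m x => [|m ih] x; first by rewrite scale1r; exact: cle_refl.
rewrite expnS mul2n -addnn nseqD.
apply: (cle_trans (s2 := [:: c2 *: x; c2 *: x])).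
  apply: (cle_trans (s2 := [:: x; 0])).
    exact: (cle_cat (cle_refl [:: x]) (@cle_nil1 R X)).
  by have := @cle_butterfly R X x 0; rewrite addr0 subr0.
rewrite exprSr -scalerA; exact: (cle_cat (ih _) (ih _)).
Qed.

(** This is adjoint to spreading: in a binary tree of butterflies only the normalised sums are
    kept. *)
Lemma cle_block1 m s : size s = (2 ^ m)%N -> cle s [:: c2 ^+ m *: \sum_(x <- s) x].
Proof.
elim: m s => [|m ih] s.
  by case: s => [|x [|]]// _; rewrite big_seq1 scale1r; exact: cle_refl.
rewrite expnS mul2n -addnn => sz.
rewrite -[s](cat_take_drop (2 ^ m)) big_cat/=.
have s1 : size (take (2 ^ m) s) = (2 ^ m)%N.
  by rewrite size_take sz -{1}[(2 ^ m)%N]addn0 ltn_add2l expn_gt0.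
have s2 : size (drop (2 ^ m) s) = (2 ^ m)%N by rewrite size_drop sz addKn.
apply: cle_trans (cle_cat (ih _ s1) (ih _ s2)) _.
apply: cle_trans (cle_butterfly _ _) _.
rewrite -scalerDr scalerA -exprS.
exact: (cle_cat (cle_refl [:: _]) (cle_drop _)).
Qed.

Lemma cle_spread m f n : cle (mkseq f n)
  (mkseq (fun j => c2 ^+ m *: f (j %/ 2 ^ m)%N) (n * 2 ^ m)).
Proof.
elim: n => [|n ih]; first exact: cle_refl.
rewrite mkseqS mulSnr mkseqD; apply: cle_cat ih _.
apply: cle_trans (cle_spread1 m (f n)) _.
suff -> : mkseq (fun k => c2 ^+ m *: f ((n * 2 ^ m + k) %/ 2 ^ m)%N) (2 ^ m) =
  nseq (2 ^ m) (c2 ^+ m *: f n) by exact: cle_refl.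
apply: (@eq_from_nth _ 0); first by rewrite size_mkseq size_nseq.
move=> k; rewrite size_mkseq => km.
by rewrite nth_mkseq// nth_nseq km divnMDl ?expn_gt0// divn_small// addn0.
Qed.

Lemma cle_block m f n : cle (mkseq f (n * 2 ^ m))
  (mkseq (fun j => c2 ^+ m *: \sum_(u < 2 ^ m) f (j * 2 ^ m + u)%N) n).
Proof.
elim: n => [|n ih]; first exact: cle_refl.
rewrite mkseqS mulSnr mkseqD; apply: cle_cat ih _.
apply: cle_trans (@cle_block1 m _ _) _; first by rewrite size_mkseq.
rewrite big_map -{1}[(2 ^ m)%N]subn0 -/(index_iota 0 (2 ^ m)) big_mkord.
exact: cle_refl.
Qed.

Lemma cle_butterflies f g n : cle (mkseq f n ++ mkseq g n)
  (mkseq (fun k => c2 *: (f k + g k)) n ++ mkseq (fun k => c2 *: (f k - g k)) n).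
Proof.
have perm4 s1 s2 x y : cle (s1 ++ [:: x] ++ s2 ++ [:: y]) ((s1 ++ s2) ++ [:: x; y]).
  apply: cle_perm; rewrite -catA perm_cat2l -[[:: x; y]]cat1s !catA.
  by rewrite perm_cat2r perm_catC.
have perm4' s1 s2 x y : cle ((s1 ++ s2) ++ [:: x; y]) (s1 ++ [:: x] ++ s2 ++ [:: y]).
  apply: cle_perm; rewrite -catA perm_cat2l -[[:: x; y]]cat1s !catA.
  by rewrite perm_cat2r perm_catC.
elim: n => [|n ih]; first exact: cle_refl.
rewrite !mkseqS -!catA; apply: cle_trans (perm4 _ _ _ _) _.
apply: cle_trans _ (perm4' _ _ _ _).
exact: cle_cat ih (cle_butterfly _ _).
Qed.

(** This is [a] evaluated at the left shift and applied to [f]; on an orbit the left shift acts as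
    the semigroup operator. *)
Definition correlate (a : {poly R[i]}) f k := \sum_(b < size a) a`_b *: f (k + b)%N.

Lemma correlate_lin (a : {poly R[i]}) (al be : R[i]) f g h :
  (forall k, h k = al *: f k + be *: g k) ->
  forall k, correlate a h k = al *: correlate a f k + be *: correlate a g k.
Proof.
move=> hE k; rewrite /correlate !scaler_sumr -big_split/=; apply: eq_bigr => b _.
by rewrite hE scalerDr !scalerA ![a`_b * _]mulrC.
Qed.

(* Splitting a theta-twisted sequence of period 2n into the (+-sigma)-twisted
   sequences of period n, sigma^2 = theta, commutes with the shift and is a
   product of butterflies and phases: this is the fast Fourier transform. *)
Lemma cle_correlate (a : {poly R[i]}) : (forall z, cabs z = 1 -> cabs a.[z] <= 1) ->
  forall m th f, cabs th = 1 -> (forall k, f (k + 2 ^ m)%N = th *: f k) ->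
  cle (mkseq f (2 ^ m)) (mkseq (correlate a f) (2 ^ m)).
Proof.
move=> a1; elim=> [|m ih] th f th1 fth.
  have fE b : f b = th ^+ b *: f 0%N.
    elim: b => [|b ihb]; first by rewrite scale1r.
    by have := fth b; rewrite expn0 addn1 => ->; rewrite ihb scalerA exprS.
  rewrite expn0 /mkseq/=.
  (* At period 1 the sequence is geometric with ratio [th], an eigenvector of the shift, so [a] acts
     as the scalar [a.[th]]. The bound on the unit circle enters here. *)
  suff -> : correlate a f 0 = a.[th] *: f 0%N by apply: cle_scale; exact: a1.
  rewrite /correlate horner_coef scaler_suml; apply: eq_bigr => b _.
  by rewrite add0n fE scalerA.
set n := (2 ^ m)%N in ih; rewrite expnS mul2n -addnn -/n in fth *.
set sg := sqrtc th; have sg2 : sg ^+ 2 = th by rewrite sqr_sqrtc.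
have sg1 : cabs sg = 1.
  apply/eqP; rewrite -(@pexpr_eq1 _ _ 2) ?cabs_ge0//.
  by rewrite -cabsX sg2 th1.
have sg0 : sg != 0 by rewrite -cabs_eq0 sg1 oner_eq0.
have sgV1 : cabs sg^-1 = 1 by rewrite cabsV sg1 invr1.
pose f' k := sg^-1 *: f (n + k)%N.
pose fp k := c2 *: (f k + f' k); pose fm k := c2 *: (f k - f' k).
have shiftp k : fp (k + n)%N = sg *: fp k.
  rewrite /fp /f' scalerA mulrC -scalerA; congr (_ *: _).
  rewrite scalerDr scalerA divff// scale1r addrC; congr (_ + _); last by rewrite addnC.
  by rewrite addnCA fth scalerA -sg2 expr2 mulrA mulVf// mul1r.
have shiftm k : fm (k + n)%N = (- sg) *: fm k.
  rewrite /fm /f' scalerA mulrC -scalerA; congr (_ *: _).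
  rewrite scalerBr !scaleNr opprK scalerA divff// scale1r addrC.
  congr (_ + _); last by rewrite addnC.
  by rewrite addnCA fth scalerA -sg2 expr2 mulrA mulVf// mul1r.
rewrite !mkseqD.
apply: (cle_trans (s2 := mkseq f n ++ mkseq f' n)).
  apply: cle_cat (cle_refl _) _; apply: cle_mkseq => k _; apply: cle_scale.
  by rewrite sgV1.
apply: cle_trans (cle_butterflies _ _ _) _.
apply: cle_trans (cle_cat (ih _ _ sg1 shiftp) (ih _ _ _ shiftm)) _.
  by rewrite cabsN.
(* A butterfly is its own inverse, so a second round undoes the splitting; the phase [sg] then
   undoes the phase in [f']. *)
apply: cle_trans (cle_butterflies _ _ _) _.
have f'n k : correlate a f (n + k)%N = sg *: correlate a f' k.
  rewrite /correlate scaler_sumr; apply: eq_bigr => b _.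
  by rewrite /f' !scalerA addnA mulrAC divff// mul1r.
have pE k : correlate a fp k = c2 *: correlate a f k + c2 *: correlate a f' k.
  by apply: correlate_lin => j; rewrite /fp scalerDr.
have mE k : correlate a fm k = c2 *: correlate a f k + (- c2) *: correlate a f' k.
  by apply: correlate_lin => j; rewrite /fm scalerBr scaleNr.
have cc x : c2 *: (c2 *: x + c2 *: x) = x.
  by rewrite -scalerDl scalerA -[RHS]scale1r -c2E; congr (_ *: _); ring.
apply: cle_cat.
  suff -> : (fun k => c2 *: (correlate a fp k + correlate a fm k)) = correlate a f.
    exact: cle_refl.
  apply/funext => k; rewrite pE mE scaleNr addrACA subrr addr0; exact: cc.
apply: cle_mkseq => k _; rewrite pE mE scaleNr opprD opprK addrACA subrr add0r cc f'n.
by apply: cle_scale; rewrite sg1.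
Qed.

End Circulant.

(** * Bounds for finite l^p norms *)

Section LpSeq.
Context {R : realType} {X : normedModType R[i]}.
Implicit Types (f : nat -> X) (p q m r S : R).

Lemma lp_seq_mkseq p f n :
  lp_seq p (mkseq f n) = (\sum_(k < n) rnorm (f k) `^ p) `^ p^-1.
Proof. by rewrite /lp_seq big_map -{1}[n]subn0 -/(index_iota 0 n) big_mkord. Qed.

Lemma lp_seq_ge q b f n : 0 < q -> 0 <= b -> (forall k, (k < n)%N -> b <= rnorm (f k)) ->
  n%:R `^ q^-1 * b <= lp_seq q (mkseq f n).
Proof.
move=> q0 b0 bf; rewrite lp_seq_mkseq.
have -> : b = (b `^ q) `^ q^-1 by rewrite -powRrM mulfV ?gt_eqF// powRr1.
rewrite -powRM ?powR_ge0//; apply: ge0_ler_powR; rewrite ?invr_ge0 ?nnegrE ?(ltW q0)//.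
- by rewrite mulr_ge0// powR_ge0.
- by rewrite sumr_ge0// => k _; exact: powR_ge0.
rewrite mulr_natl -{1}[n]card_ord -sumr_const; apply: ler_sum => k _.
by apply: ge0_ler_powR; rewrite ?nnegrE ?rnorm_ge0 ?(ltW q0)//; exact: bf.
Qed.

(** Since [r ^+ k <= 1] and [1 <= p], the p-th power of [r ^+ k] is at most [r ^+ k], so one
    geometric sum serves all exponents. *)
Lemma lp_seq_le p m r S f n : 1 <= p -> 0 <= m -> 0 <= r <= 1 ->
  (forall k, rnorm (f k) <= m * r ^+ k) -> \sum_(k < n) r ^+ k <= S ->
  lp_seq p (mkseq f n) <= m * S `^ p^-1.
Proof.
move=> p1 m0 /andP[r0 r1] fm rS; rewrite lp_seq_mkseq.
have p0 : 0 < p by exact: lt_le_trans p1.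
have S0 : 0 <= S by apply: le_trans rS; rewrite sumr_ge0// => k _; exact: exprn_ge0.
have mE : m = (m `^ p) `^ p^-1 by rewrite -powRrM mulfV ?gt_eqF// powRr1.
rewrite [X in X * _]mE -powRM ?powR_ge0//.
apply: ge0_ler_powR; rewrite ?invr_ge0 ?nnegrE ?(ltW p0)//.
- by rewrite sumr_ge0// => k _; exact: powR_ge0.
- by rewrite mulr_ge0// powR_ge0.
apply: (@le_trans _ _ (m `^ p * \sum_(k < n) r ^+ k)); last by rewrite ler_wpM2l// powR_ge0.
rewrite mulr_sumr; apply: ler_sum => k _.
apply: (@le_trans _ _ ((m * r ^+ k) `^ p)).
  by apply: ge0_ler_powR; rewrite ?nnegrE ?rnorm_ge0 ?mulr_ge0 ?exprn_ge0 ?(ltW p0).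
rewrite powRM ?exprn_ge0// ler_wpM2l ?powR_ge0//.
have rk0 : 0 <= r ^+ k by exact: exprn_ge0.
have rk1 : r ^+ k <= 1 by exact: exprn_ile1.
move: rk0; rewrite le_eqVlt => /predU1P[<-|rk0].
  by rewrite powR0 ?gt_eqF.
by rewrite -[leRHS]powRr1 ?(ltW rk0)//; apply: ger_powR => //; rewrite rk0.
Qed.

End LpSeq.

(* The indices t, ..., t + K - 1 run once through the residues modulo K. *)
Lemma sum_residues (V : zmodType) (F : nat -> V) K t : (0 < K)%N ->
  \sum_(v < K) F (t + v)%N = \sum_(e < K) F (K.-1 - e + K * ((t + e) %/ K))%N.
Proof.
move=> K0; elim: t F => [|t ih] F.
  rewrite (reindex_inj rev_ord_inj)/=; apply: eq_bigr => e _.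
  by rewrite !add0n divn_small ?ltn_ord// muln0 addn0 subnS predn_sub.
under eq_bigr do rewrite addSn.
rewrite (ih (fun n => F n.+1)).
case: K K0 {ih} => // K _; rewrite big_ord_recl [RHS]big_ord_recr/= addrC.
congr (_ + _).
  congr F; rewrite subn0 addn0 subnn add0n addSnnS divnDr// divnn/= mulnDr muln1; lia.
apply: eq_bigr => e _; congr F; rewrite /bump/= add1n addSnnS -addSn -subSn ?subSS//.
Qed.

(** * Transference to Gaussian sums *)

Section Transference.
Context {R : realType} {X : normedModType R[i]}.
Variables (p q C : R) (p1 : 1 <= p) (q0 : 0 < q) (C0 : 0 <= C).
Hypothesis clepq : forall s s' : seq X, cle s s' -> lp_seq q s' <= C * lp_seq p s.
Variable U : nat -> {linear X -> X}.
Hypothesis UD : forall j k x, U (j + k)%N x = U j (U k x).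

Definition pol (a : {poly R[i]}) x := \sum_(k < size a) a`_k *: U k x.

Definition avg K x := (K%:R^-1)%:C *: \sum_(v < K) U v x.

Lemma polZ a c x : pol a (c *: x) = c *: pol a x.
Proof. by rewrite /pol scaler_sumr; apply: eq_bigr => k _; rewrite linearZ !scalerA mulrC. Qed.

Variables (kap l : nat) (M r B : R).
Let K := (2 ^ kap)%N.
Let N := (2 ^ l)%N.
Hypotheses (M0 : 0 <= M) (r0 : 0 <= r) (r1 : r <= 1).
Hypothesis leU : forall k x, rnorm (U k x) <= M * rnorm x.
Hypothesis leV : forall c x, rnorm (U (K * c)%N x) <= M * r ^+ c * rnorm x.
Hypothesis sum_r : forall n, \sum_(k < n) r ^+ k <= B * N%:R.

Variable a : {poly R[i]}.
Hypothesis a1 : forall z, cabs z = 1 -> cabs a.[z] <= 1.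

Let K_gt0 : (0 < K)%N. Proof. by rewrite expn_gt0. Qed.
Let N_gt0 : (0 < N)%N. Proof. by rewrite expn_gt0. Qed.

Definition coarse e x :=
  \sum_(k < size a) \sum_(u < K) a`_k *: U (K * ((k + u + e) %/ K))%N x.

(** Summing over [v] runs through all residues modulo [K], so exponents k + u + v may be replaced by
    multiples of [K] plus a rest K - 1 - e that depends on neither [k] nor [u]. The rest factors
    out, and what remains involves the coarse orbit alone. *)
Lemma pol_coarse x : pol a (\sum_(u < K) U u (\sum_(v < K) U v x)) =
  \sum_(e < K) U (K.-1 - e)%N (coarse e x).
Proof.
transitivity (\sum_(k < size a) \sum_(u < K) \sum_(e < K)
    a`_k *: U (K.-1 - e + K * ((k + u + e) %/ K))%N x).
  apply: eq_bigr => k _; rewrite linear_sum scaler_sumr; apply: eq_bigr => u _.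
  rewrite -scaler_sumr; congr (_ *: _); rewrite !linear_sum.
  under eq_bigr do rewrite -!UD.
  exact: (sum_residues (fun n => U n x)).
under eq_bigr do rewrite exchange_big.
rewrite exchange_big; apply: eq_bigr => e _.
rewrite /coarse linear_sum; apply: eq_bigr => k _; rewrite linear_sum.
by apply: eq_bigr => u _; rewrite linearZ UD.
Qed.

Let c2 : R[i] := (Num.sqrt (2 : R))^-1%:C.

Let c2K : cabs (c2 ^+ kap * c2 ^+ kap) = K%:R^-1.
Proof.
rewrite -exprMn cabsX cabsM cabs_real ger0_norm ?invr_ge0 ?sqrtr_ge0//.
by rewrite -expr2 exprVn sqr_sqrtr// natrX exprVn.
Qed.

(* [coarse e] correlates the orbit sampled at step K with a sequence that is
   a compression of the correlation by [a]: the samples are spread over blocks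
   of length K, and the result is averaged over blocks shifted by e. *)
Lemma cle_coarse e y : (e < K)%N -> exists n,
  cle (mkseq (fun c => U (K * c)%N y) n)
      (mkseq (fun j => (c2 ^+ kap * c2 ^+ kap) *: U (K * j)%N (coarse e y)) N).
Proof.
(* The period must exceed every index j + (k + u + e) %/ K with j < N, so that no output block sees
   the periodic extension wrap around. *)
move=> eK; pose m := (size a + N + 2)%N; exists (2 ^ m)%N; set Nc := (2 ^ m)%N.
have Ncm : (m < Nc)%N by exact: ltn_expl.
pose z c := U (K * (c %% Nc))%N y.
pose Z s := c2 ^+ kap *: z (s %/ K)%N.
have KNc : (Nc * K = 2 ^ (m + kap))%N by rewrite expnD.
have Zper s : Z (s + 2 ^ (m + kap))%N = 1 *: Z s.
  by rewrite scale1r /Z /z -KNc addnC divnMDl// modnDl.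
have -> : mkseq (fun c => U (K * c)%N y) Nc = mkseq z Nc.
  apply: (@eq_from_nth _ 0); rewrite ?size_mkseq// => c cN.
  by rewrite !nth_mkseq// /z modn_small.
apply: cle_trans (cle_spread kap _ _) _; rewrite -/K KNc.
apply: cle_trans (cle_correlate a1 _ Zper) _; first exact: cabs1.
have eN : (e + N * K <= 2 ^ (m + kap))%N.
  rewrite -KNc (@leq_trans (N.+1 * K))// ?mulSn ?leq_add2r ?(ltnW eK)//.
  rewrite -mulSn leq_mul2r (leq_trans _ (ltnW Ncm)) ?orbT// /m.
  by rewrite addn2 !ltnS (leq_trans (leq_addl _ _) (leqnSn _)).
rewrite -(subnKC eN) -addnA mkseqD; apply: cle_trans (cle_catl _ _) _.
rewrite mkseqD; apply: cle_trans (cle_catr _ _) _.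
apply: cle_trans (cle_block kap _ _) _; apply: cle_mkseq => j jN.
rewrite -scalerA; suff -> : \sum_(u < 2 ^ kap) correlate a Z (e + (j * 2 ^ kap + u))%N =
  c2 ^+ kap *: U (K * j)%N (coarse e y) by exact: cle_refl.
rewrite /correlate /coarse exchange_big/= linear_sum scaler_sumr; apply: eq_bigr => k _.
rewrite linear_sum scaler_sumr; apply: eq_bigr => u _.
rewrite [U (K * j)%N _]linearZ/= /Z !scalerA mulrC; congr (_ *: _).
rewrite /z -UD -mulnDr -/K.
have -> : (e + (j * K + u) + k = j * K + (k + u + e))%N by lia.
rewrite divnMDl// modn_small// (leq_trans _ Ncm)// ltnS /m.
have : ((k + u + e) %/ K < size a + 2)%N.
  rewrite ltn_divLR// mulnDl.
  have h1 := ltn_ord k; have h2 := ltn_ord u; rewrite -/K in h2.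
  have gen (k' u' e' K' sK sa : nat) : (k' < sa -> u' < K' -> e' < K' -> sa <= sK ->
    k' + u' + e' < sK + 2 * K')%N by lia.
  by apply: gen h1 h2 eK _; exact: leq_pmulr.
by lia.
Qed.

(** The vector on the left is the image under U (K (N - j)) of the j-th output sample for every j <
    N, so each sample has norm at least a fixed multiple of it, and the l^q norm gains N^(1/q). The
    input decays geometrically and its [p]-sum is of order N, whatever its length, which costs
    N^(1/p). *)
Lemma rnorm_coarse e y : (e < K)%N ->
  rnorm (coarse e (U (K * N)%N y)) <=
  M ^+ 2 * C * B `^ p^-1 * (K%:R * N%:R `^ (p^-1 - q^-1)) * rnorm y.
Proof.
move=> eK; have [n /clepq] := cle_coarse y eK.
set v := coarse e (U (K * N)%N y); have y0 := rnorm_ge0 y.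
have N0 : 0 < N%:R :> R by rewrite ltr0n.
have K0 : 0 < K%:R :> R by rewrite ltr0n.
have NB0 : 0 <= B * N%:R by have := sum_r 0; rewrite big_ord0.
have B0 : 0 <= B by rewrite -(pmulr_lge0 _ N0).
have up : lp_seq p (mkseq (fun c => U (K * c)%N y) n) <= M * rnorm y * (B * N%:R) `^ p^-1.
  apply: (@lp_seq_le _ _ p _ r) => //; rewrite ?mulr_ge0 ?r0//.
  by move=> k; rewrite mulrAC; exact: leV.
have vE j : (j < N)%N -> v = U (K * (N - j))%N (U (K * j)%N (coarse e y)).
  move=> jN; rewrite -UD -mulnDr subnK ?(ltnW jN)// /v /coarse.
  rewrite !linear_sum; apply: eq_bigr => k _; rewrite !linear_sum; apply: eq_bigr => u _.
  by rewrite linearZ -!UD addnC.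
have [M_eq0|Mn0] := eqVneq M 0.
  have -> : rnorm v = 0.
    apply/eqP; rewrite eq_le rnorm_ge0 andbT (vE 0%N N_gt0) (le_trans (leU _ _))//.
    by rewrite M_eq0 mul0r.
  by rewrite M_eq0 expr0n/= !mul0r.
have Mp : 0 < M by rewrite lt_neqAle eq_sym Mn0.
have low : N%:R `^ q^-1 * (K%:R^-1 * (M^-1 * rnorm v)) <=
    lp_seq q (mkseq (fun j => (c2 ^+ kap * c2 ^+ kap) *: U (K * j)%N (coarse e y)) N).
  apply: lp_seq_ge => //; first by rewrite !mulr_ge0 ?invr_ge0 ?rnorm_ge0 ?(ltW Mp).
  move=> j jN; rewrite rnormZ c2K ler_wpM2l ?invr_ge0//.
  by rewrite ler_pdivrMl// (vE j jN).
move=> h; have := le_trans low (le_trans h (ler_wpM2l C0 up)).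
rewrite powRM// => {}h.
have Nn0 : N%:R != 0 :> R by rewrite gt_eqF.
have Nq0 : 0 < N%:R `^ q^-1 by rewrite powR_gt0.
have -> : N%:R `^ (p^-1 - q^-1) = N%:R `^ p^-1 / N%:R `^ q^-1.
  by rewrite powRD ?powRN// Nn0 implybT.
move: h; rewrite -ler_pdivlMl// -ler_pdivlMl ?invr_gt0// -ler_pdivlMl ?invr_gt0//.
rewrite !invrK => /le_trans; apply.
rewrite le_eqVlt; apply/orP; left; apply/eqP; ring.
Qed.

(** The [K] values of [e] and the factor [K] from [rnorm_coarse] cancel the normalisation K^-2 of
    the two averages. *)
Lemma rnorm_transference y :
  rnorm (pol a (avg K (avg K (U (K * N)%N y)))) <=
  M ^+ 3 * C * B `^ p^-1 * N%:R `^ (p^-1 - q^-1) * rnorm y.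
Proof.
have K0 : 0 < K%:R :> R by rewrite ltr0n.
set w := U (K * N)%N y.
have -> : avg K (avg K w) =
    ((K%:R^-1)%:C * (K%:R^-1)%:C) *: \sum_(u < K) U u (\sum_(v < K) U v w).
  rewrite /avg -scalerA; congr (_ *: _); rewrite [RHS]scaler_sumr.
  by apply: eq_bigr => u _; rewrite linearZ.
rewrite polZ pol_coarse rnormZ -rmorphM cabs_real ger0_norm ?mulr_ge0 ?invr_ge0//.
rewrite -invfM ler_pdivrMl ?mulr_gt0//.
apply: le_trans (rnorm_sum _ _ _) _.
apply: (@le_trans _ _ (\sum_(e < K) M * (M ^+ 2 * C * B `^ p^-1 *
    (K%:R * N%:R `^ (p^-1 - q^-1)) * rnorm y))).
  apply: ler_sum => e _; apply: le_trans (leU _ _) _.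
  by rewrite ler_wpM2l//; exact: rnorm_coarse.
rewrite sumr_const card_ord -mulr_natl le_eqVlt; apply/orP; left; apply/eqP; ring.
Qed.

End Transference.

(** * Difference quotients and the generator of a semigroup *)

Section RightLimits.
Context {R : realType}.

Lemma near_right0P (P : R -> Prop) :
  (\forall h \near (0 : R)^'+, P h) <->
  exists2 e : R, 0 < e & forall h, 0 < h -> h < e -> P h.
Proof.
split.
  move=> /nbhs_ballP[e /= e0 he]; exists e => // h h0 hlt; apply: he => //.
  by rewrite /ball/= sub0r normrN gtr0_norm.
move=> [e e0 he]; apply/nbhs_ballP; exists e => //= h.
rewrite /ball/= sub0r normrN => hlt h0; apply: he => //.
by rewrite -(gtr0_norm h0).
Qed.

Lemma le_cvgn (u : nat -> R) c l : (forall n, c <= u n) -> u @ \oo --> l -> c <= l.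
Proof.
move=> cu ul; rewrite -(cvg_lim _ ul)//; apply: limr_ge; first exact: cvgP ul.
exact: nearW.
Qed.

Context {X : normedModType R[i]}.

Lemma cvg_right0P (f : R -> X) l : f h @[h --> (0 : R)^'+] --> l <->
  forall eps : R, 0 < eps -> exists2 e : R, 0 < e &
    forall h, 0 < h -> h < e -> rnorm (f h - l) <= eps.
Proof.
rewrite cvg_rnorm; split.
  move=> /cvgrPdist_le h eps /h /near_right0P [e e0 he]; exists e => // t t0 te.
  by have := he t t0 te; rewrite sub0r normrN ger0_norm// rnorm_ge0.
move=> h; apply/cvgrPdist_le => eps /h [e e0 he]; apply/near_right0P; exists e => // t t0 te.
by rewrite sub0r normrN ger0_norm ?rnorm_ge0//; exact: he.
Qed.

End RightLimits.

Lemma telescope5 (V : zmodType) (p q c b a y d : V) :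
  b - y - d = (p - q - c) + ((b - a) + (- (p - a) + (q - y) - (d - c))).
Proof.
rewrite !opprB !addrA subrK (addrAC _ b (- p)) (addrAC _ (- c) (- p)).
rewrite (addrAC _ (- q) (- p)) subrr add0r (addrAC _ b q) (addrAC _ (- c) q) addNr add0r.
by rewrite (addrAC _ (- y) c) (addrAC _ b c) addNr add0r.
Qed.

Section Semigroup.
Context {R : realType} {X : normedModType R[i]}.
Variables (T : R -> {linear X -> X}) (M : R).
Hypothesis TC0 : C0_semigroup T.
Hypothesis M0 : 0 <= M.
Hypothesis leT : forall t x, 0 <= t -> rnorm (T t x) <= M * rnorm x.
Implicit Types (b w x y : X) (s t h : R).

Definition gen b w := (h^-1)%:C *: (T h b - b) @[h --> (0 : R)^'+] --> w.

Lemma semigroup0 x : T 0 x = x. Proof. by have [] := TC0. Qed.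

Lemma semigroupD s t x : 0 <= s -> 0 <= t -> T (s + t) x = T s (T t x).
Proof. by have [_ _ h _] := TC0; exact: h. Qed.

Lemma semigroup_comm s t x : 0 <= s -> 0 <= t -> T s (T t x) = T t (T s x).
Proof. by move=> s0 t0; rewrite -!semigroupD// addrC. Qed.

Lemma T_small x eps : 0 < eps ->
  exists2 e : R, 0 < e & forall s, 0 <= s -> s < e -> rnorm (T s x - x) <= eps.
Proof.
have [_ _ _ /(_ x)/cvg_right0P h] := TC0.
move=> e0; have [e e1 he] := h _ e0; exists e => // s.
rewrite le_eqVlt => /predU1P[<- _|s0 se]; last exact: he.
by rewrite semigroup0 subrr rnorm0 ltW.
Qed.

Lemma gen_small b w eps : gen b w -> 0 < eps ->
  exists2 e : R, 0 < e & forall h, 0 <= h -> h < e ->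
    rnorm (T h b - b - h%:C *: w) <= eps * h.
Proof.
move=> /cvg_right0P g e0; have [e e1 he] := g _ e0; exists e => // h.
rewrite le_eqVlt => /predU1P[<- _|h0 hlt].
  by rewrite semigroup0 subrr scale0r subrr rnorm0 mulr0.
have -> : T h b - b - h%:C *: w = h%:C *: ((h^-1)%:C *: (T h b - b) - w).
  by rewrite scalerBr scalerA -rmorphM/= divff ?gt_eqF// scale1r.
rewrite rnormZr gtr0_norm// mulrC ler_wpM2r ?(ltW h0)//; exact: he.
Qed.

Lemma gen_lin c b w b' w' : gen b w -> gen b' w' -> gen (c *: b + b') (c *: w + w').
Proof.
move=> h1 h2; rewrite /gen.
under eq_fun do rewrite linearP opprD addrACA -scalerBr scalerDr scalerA mulrC -scalerA.
by apply: cvgD => //; apply: cvgZr.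
Qed.

Lemma gen_T t b w : 0 <= t -> gen b w -> gen (T t b) (T t w).
Proof.
move=> t0 /cvg_right0P g; apply/cvg_right0P => eps eps0.
have M1 : 0 < M + 1 by rewrite ltr_wpDl.
have [e e0 he] := g (eps / (M + 1)) (divr_gt0 eps0 M1).
exists e => // h h0 hlt; rewrite semigroup_comm ?(ltW h0)// -linearB -linearZ -linearB/=.
apply: le_trans (leT _ t0) _; apply: (@le_trans _ _ (M * (eps / (M + 1)))).
  by rewrite ler_wpM2l// he.
by rewrite mulrCA ler_piMr ?(ltW eps0)// ler_pdivrMr// mul1r lerDl.
Qed.

Lemma T_telescope h n x : 0 <= h ->
  T (n%:R * h) x - x = \sum_(i < n) T (i%:R * h) (T h x - x).
Proof.
move=> h0; elim: n => [|n ih]; first by rewrite big_ord0 mul0r semigroup0 subrr.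
rewrite big_ord_recr/= -ih -natr1 mulrDl mul1r semigroupD ?mulr_ge0// linearB/=.
by rewrite [RHS]addrC addrA subrK.
Qed.

(** The formula T(h) b - b = int_0^h T(s) w ds is replaced by a Riemann sum: [h] is cut into [n]
    steps short enough for [gen_small], whose errors add up to at most [eps]. The proof of [gen_lip]
    is of the same kind. *)
Lemma gen_le h kap b w : 0 <= h -> gen b w ->
  (forall s, 0 <= s -> s <= h -> rnorm (T s w - w) <= kap) ->
  rnorm (T h b - b - h%:C *: w) <= h * kap.
Proof.
move=> h0 g hk; apply/ler_addgt0Pr => eps eps0.
move: h0; rewrite le_eqVlt => /predU1P[h0|h0].
  by rewrite -h0 semigroup0 subrr scale0r subrr rnorm0 mul0r add0r ltW.
have M1 : 0 < M + 1 by rewrite ltr_wpDl.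
have [e e0 he] := gen_small g (divr_gt0 (divr_gt0 eps0 h0) M1).
pose n := (Num.truncn (h / e)).+1; pose u := h / n%:R.
have n0 : 0 < n%:R :> R by rewrite ltr0n.
have u0 : 0 < u by rewrite divr_gt0.
have nu : n%:R * u = h by rewrite mulrC divfK// gt_eqF.
have ue : u < e.
  rewrite ltr_pdivrMr// mulrC -ltr_pdivrMr//; apply: truncnS_gt.
have -> : T h b - b - h%:C *: w = \sum_(i < n) (T (i%:R * u) (T u b - b - u%:C *: w) +
   u%:C *: (T (i%:R * u) w - w)).
  have hw : h%:C *: w = \sum_(i < n) u%:C *: w.
    by rewrite sumr_const card_ord -nu rmorphM rmorph_nat -scalerA scaler_nat.
  rewrite hw -{1}nu T_telescope ?(ltW u0)// -sumrB; apply: eq_bigr => i _.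
  by rewrite [T _ (_ - u%:C *: w)]linearB/= [T _ (_ *: w)]linearZ/= scalerBr addrA subrK.
apply: le_trans (rnorm_sum _ _ _) _.
apply: (@le_trans _ _ (\sum_(i < n) (M * (eps / h / (M + 1) * u) + u * kap))).
  apply: ler_sum => i _; apply: le_trans (rnormD _ _) _; apply: lerD.
    apply: le_trans (leT _ _) _; first by rewrite mulr_ge0 ?(ltW u0).
    by rewrite ler_wpM2l// he ?(ltW u0).
  rewrite rnormZr gtr0_norm// ler_wpM2l ?(ltW u0)//; apply: hk.
    by rewrite mulr_ge0 ?(ltW u0).
  by rewrite -nu ler_wpM2r ?(ltW u0)// ler_nat ltnW.
rewrite sumr_const card_ord -mulr_natl mulrDr addrC mulrA nu lerD2l.
have -> : n%:R * (M * (eps / h / (M + 1) * u)) = M / (M + 1) * (eps * (n%:R * u / h)) by ring.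
rewrite nu divff ?gt_eqF// mulr1 ler_piMl ?(ltW eps0)// ler_pdivrMr// mul1r lerDl//.
Qed.

Lemma gen_lip h b w : 0 <= h -> gen b w -> rnorm (T h b - b) <= h * (M * rnorm w).
Proof.
move=> h0 g; apply/ler_addgt0Pr => eps eps0.
move: h0; rewrite le_eqVlt => /predU1P[h0|h0].
  by rewrite -h0 semigroup0 subrr rnorm0 mul0r add0r ltW.
have M1 : 0 < M + 1 by rewrite ltr_wpDl.
have [e e0 he] := gen_small g (divr_gt0 (divr_gt0 eps0 h0) M1).
pose n := (Num.truncn (h / e)).+1; pose u := h / n%:R.
have n0 : 0 < n%:R :> R by rewrite ltr0n.
have u0 : 0 < u by rewrite divr_gt0.
have nu : n%:R * u = h by rewrite mulrC divfK// gt_eqF.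
have ue : u < e.
  rewrite ltr_pdivrMr// mulrC -ltr_pdivrMr//; apply: truncnS_gt.
rewrite -{1}nu T_telescope ?(ltW u0)//; apply: le_trans (rnorm_sum _ _ _) _.
apply: (@le_trans _ _ (\sum_(i < n) (M * (eps / h / (M + 1) * u + u * rnorm w)))).
  apply: ler_sum => i _; apply: le_trans (leT _ _) _; first by rewrite mulr_ge0 ?(ltW u0).
  rewrite ler_wpM2l//.
  have -> : T u b - b = (T u b - b - u%:C *: w) + u%:C *: w by rewrite subrK.
  apply: le_trans (rnormD _ _) _; rewrite rnormZr gtr0_norm// lerD2r.
  by rewrite he ?(ltW u0).
rewrite sumr_const card_ord -mulr_natl.
have -> : n%:R * (M * (eps / h / (M + 1) * u + u * rnorm w)) =
  M / (M + 1) * (eps * (n%:R * u / h)) + n%:R * u * (M * rnorm w) by ring.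
rewrite nu divff ?gt_eqF// mulr1 addrC lerD2l.
by rewrite ler_piMl ?(ltW eps0)// ler_pdivrMr// mul1r lerDl.
Qed.

(** Closedness of the generator, with difference quotients of step [e n] in place of generator
    values. The approximate resolvents satisfy such a relation, although they need not map into the
    domain. *)
Lemma gen_closed (e : nat -> R) (y_ : nat -> X) y w :
  (forall n, 0 < e n) -> e @ \oo --> (0 : R) -> y_ @ \oo --> y ->
  (fun n => (e n)^-1%:C *: (T (e n) (y_ n) - y_ n)) @ \oo --> w -> gen y w.
Proof.
move=> e0 e_cvg y_cvg w_cvg; apply/cvg_right0P => eps eps0.
have [s0 s00 hs] := T_small w eps0.
exists s0 => // h h0 hs0.
have -> : (h^-1)%:C *: (T h y - y) - w = (h^-1)%:C *: (T h y - y - h%:C *: w).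
  by rewrite [RHS]scalerBr scalerA -rmorphM/= mulVf ?gt_eqF// scale1r.
rewrite rnormZr ger0_norm ?invr_ge0 ?(ltW h0)// ler_pdivrMl//.
pose z n := (e n)^-1%:C *: (T (e n) (y_ n) - y_ n).
(* Whole steps of length [e n] reach [h] up to a remainder below [e n]; strong continuity disposes
   of the remainder. *)
pose k n := Num.truncn (h / e n).
have ke n : (k n)%:R * e n <= h.
  by rewrite -ler_pdivlMr// truncn_le// divr_ge0 ?(ltW h0) ?(ltW (e0 n)).
have hk n : h < (k n)%:R * e n + e n.
  by rewrite -{2}[e n]mul1r -mulrDl natr1 -ltr_pdivrMr//; exact: truncnS_gt.
have ke0 n : 0 <= (k n)%:R * e n by rewrite mulr_ge0 ?(ltW (e0 n)).
have bound n : rnorm (T h y - y - h%:C *: w) <=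
    h * eps + (h * (M * rnorm (z n - w)) + (M * rnorm (T (h - (k n)%:R * e n) y - y) +
      (M * rnorm (y_ n - y) + rnorm (y_ n - y)) + (h - (k n)%:R * e n) * rnorm w)).
  have En : T ((k n)%:R * e n) (y_ n) - y_ n - ((k n)%:R * e n)%:C *: w =
      \sum_(i < k n) (e n)%:C *: (T (i%:R * e n) (z n - w) + (T (i%:R * e n) w - w)).
    have kw : ((k n)%:R * e n)%:C *: w = \sum_(i < k n) (e n)%:C *: w.
      by rewrite sumr_const card_ord rmorphM rmorph_nat -scalerA scaler_nat.
    rewrite kw T_telescope ?(ltW (e0 n))// -sumrB; apply: eq_bigr => i _.
    rewrite [T _ (z n - w)]linearB/= addrA subrK scalerBr -linearZ/=; congr (T _ _ - _).
    by rewrite /z scalerA -rmorphM/= divff ?gt_eqF// scale1r.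
  have -> : T h y - y - h%:C *: w =
     (T ((k n)%:R * e n) (y_ n) - y_ n - ((k n)%:R * e n)%:C *: w) +
     (T ((k n)%:R * e n) (T (h - (k n)%:R * e n) y - y) +
     ((- T ((k n)%:R * e n) (y_ n - y) + (y_ n - y)) - (h - (k n)%:R * e n)%:C *: w)).
    have -> : T ((k n)%:R * e n) (T (h - (k n)%:R * e n) y - y) = T h y - T ((k n)%:R * e n) y.
      by rewrite linearB/= -semigroupD ?subr_ge0// [_ + (h - _)]addrC subrK.
    by rewrite [T _ (y_ n - y)]linearB/= rmorphB scalerBl; exact: telescope5.
  apply: le_trans (rnormD _ _) _.
  apply: (@le_trans _ _ ((h * eps + h * (M * rnorm (z n - w))) + _)).
    apply: lerD; last exact: lexx.
    rewrite En; apply: le_trans (rnorm_sum _ _ _) _.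
    apply: (@le_trans _ _ (\sum_(i < k n) e n * (M * rnorm (z n - w) + eps))).
      apply: ler_sum => i _; rewrite rnormZr gtr0_norm// ler_wpM2l ?(ltW (e0 n))//.
      have ie : i%:R * e n <= h.
        by apply: le_trans (ke n); rewrite ler_wpM2r ?(ltW (e0 n))// ler_nat ltnW.
      apply: le_trans (rnormD _ _) _; apply: lerD.
        by apply: leT; rewrite mulr_ge0 ?(ltW (e0 n)).
      by apply: hs; rewrite ?mulr_ge0 ?(ltW (e0 n))// (le_lt_trans ie).
    rewrite sumr_const card_ord -mulr_natl mulrA -mulrDr addrC ler_wpM2r//.
    by rewrite addr_ge0 ?(ltW eps0)// mulr_ge0 ?rnorm_ge0.
  rewrite -addrA lerD2l lerD2l.
  rewrite -[leRHS]addrA; apply: le_trans (rnormD _ _) _; apply: lerD; first exact: leT.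
  apply: le_trans (rnormB _ _) _; apply: lerD.
    by apply: le_trans (rnormD _ _) _; rewrite rnormN lerD2r; exact: leT.
  by rewrite rnormZr ger0_norm// subr_ge0.
have c1 : rnorm (z n - w) @[n --> \oo] --> (0 : R) by apply/cvg_rnorm.
have c2 : rnorm (y_ n - y) @[n --> \oo] --> (0 : R) by apply/cvg_rnorm.
have c3 : h - (k n)%:R * e n @[n --> \oo] --> (0 : R).
  apply: (squeeze_cvgr _ (cvg_cst 0) e_cvg); apply: nearW => n.
  by rewrite subr_ge0 ke/= lerBlDl ltW.
have c4 : rnorm (T (h - (k n)%:R * e n) y - y) @[n --> \oo] --> (0 : R).
  apply/cvgrPdist_le => d d0; have [t t0 ht] := T_small y d0.
  move/cvgrPdist_lt : c3 => /(_ _ t0); apply: filterS => n.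
  rewrite !sub0r !normrN !ger0_norm ?rnorm_ge0 ?subr_ge0// => hlt.
  by apply: ht => //; rewrite subr_ge0.
have lim : h * eps + (h * (M * rnorm (z n - w)) + (M * rnorm (T (h - (k n)%:R * e n) y - y) +
      (M * rnorm (y_ n - y) + rnorm (y_ n - y)) + (h - (k n)%:R * e n) * rnorm w))
      @[n --> \oo] --> h * eps + (h * (M * 0) + (M * 0 + (M * 0 + 0) + 0 * rnorm w)).
  apply: cvgD; first exact: cvg_cst.
  apply: cvgD; first by apply: cvgMr; apply: cvgMr.
  apply: cvgD; last by apply: cvgMl.
  apply: cvgD; first by apply: cvgMr.
  by apply: cvgD => //; apply: cvgMr.
rewrite !mulr0 mul0r !addr0 in lim.
exact: le_cvgn bound lim.
Qed.

End Semigroup.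

(** * Averages over dyadic blocks and their telescoping *)

Section Averages.
Context {R : realType} {X : normedModType R[i]}.
Variable U : nat -> {linear X -> X}.
Hypothesis U0 : forall x, U 0%N x = x.
Hypothesis UD : forall j k x, U (j + k)%N x = U j (U k x).
Implicit Types (x y : X).

Lemma polD a x y : pol U a (x + y) = pol U a x + pol U a y.
Proof. by rewrite /pol -big_split; apply: eq_bigr => k _; rewrite linearD scalerDr. Qed.

Lemma pol_sum a n (f : nat -> X) :
  pol U a (\sum_(m < n) f m) = \sum_(m < n) pol U a (f m).
Proof.
elim: n => [|n ih]; last by rewrite !big_ord_recr/= polD ih.
by rewrite !big_ord0 /pol big1// => k _; rewrite linear0 scaler0.
Qed.

Lemma avgD K x y : avg U K (x + y) = avg U K x + avg U K y.
Proof.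
rewrite /avg -scalerDr -big_split; congr (_ *: _).
by apply: eq_bigr => k _; rewrite linearD.
Qed.

Lemma avgZ K c x : avg U K (c *: x) = c *: avg U K x.
Proof.
rewrite /avg scalerA mulrC -scalerA; congr (_ *: _).
by rewrite scaler_sumr; apply: eq_bigr => k _; rewrite linearZ.
Qed.

Lemma avgB K x y : avg U K (x - y) = avg U K x - avg U K y.
Proof. by rewrite -scaleN1r avgD avgZ scaleN1r. Qed.

Lemma avgU K j x : avg U K (U j x) = U j (avg U K x).
Proof.
rewrite /avg [RHS]linearZ/=; congr (_ *: _); rewrite linear_sum.
by apply: eq_bigr => k _; rewrite -!UD addnC.
Qed.

Lemma avg1 x : avg U 1 x = x.
Proof. by rewrite /avg big_ord1 U0 invr1 scale1r. Qed.

Lemma avg_double K x : avg U (K + K) x = (2^-1)%:C *: (avg U K x + U K (avg U K x)).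
Proof.
rewrite /avg linearZ/= -scalerDr scalerA -rmorphM/= -invfM -natrM mul2n addnn.
congr (_ *: _); rewrite -addnn big_split_ord/= linear_sum; congr (_ + _).
by apply: eq_bigr => k _; rewrite UD.
Qed.

Definition avg2 m x := avg U (2 ^ m) (avg U (2 ^ m) x).

(* With V = U (2 ^ m) and D_K the average of the first K iterates of U,
   D_K ^ 2 - D_2K ^ 2 = D_K ^ 2 (1 - V) (3 + V) / 4 for K = 2 ^ m. *)
Definition detail m x := let z := x - U (2 ^ m)%N x in
  (4^-1)%:C *: (3%:R *: z + U (2 ^ m)%N z).

Lemma avg2_detail m x : avg2 m x = avg2 m.+1 x + avg2 m (detail m x).
Proof.
rewrite /avg2 /detail; set V := U (2 ^ m)%N; set K := (2 ^ m)%N.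
have -> : (2 ^ m.+1 = K + K)%N by rewrite expnS mul2n -addnn.
rewrite !avg_double -/V.
move: (avgD K) (avgZ K) (avgB K) (avgU K); move: (avg U K) => D DD DZ DB DU.
rewrite !(DZ, DB, DD, DU) -/V; set w := D (D x).
rewrite [V (_ *: _)]linearZ [V (w - _)]linearB [V (w + _)]linearD/=.
rewrite -scalerDr scalerA -rmorphM/=.
have -> : (2^-1 * 2^-1 : R) = 4^-1 by rewrite -invfM -natrM.
rewrite -scalerDr; set v := V w; set u := V v.
have -> : w + v + (v + u) + (3 *: (w - v) + (v - u)) = 4%:R *: w.
  rewrite scalerBr !scaler_nat addrACA [v + u + _]addrACA subrr addr0.
  by rewrite [w + v + _]addrACA -addrA [v - _ + _]addrAC -mulr2n -!mulrS subrr addr0.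
by rewrite scalerA -(rmorph_nat (real_complex R) 4) -rmorphM/= mulVf// scale1r.
Qed.

Lemma avg2_sum L x : x = avg2 L x + \sum_(m < L) avg2 m (detail m x).
Proof.
elim: L => [|L ih]; first by rewrite big_ord0 addr0 /avg2 expn0 !avg1.
by rewrite big_ord_recr/= addrCA addrC -avg2_detail addrC [RHS]addrC -ih.
Qed.

End Averages.

(** * The K-functional and the stability bound on dyadic grids *)

Section KFunctional.
Context {R : realType} {X : normedModType R[i]}.
Variable A : operator X.
Implicit Types (x a b : X) (u c : R).

Lemma K_functional_ge c u x : (exists a b, dom A b /\ a + b = x) ->
  (forall a b, dom A b -> a + b = x -> c <= rnorm a + u * graph_norm A b) ->
  c <= K_functional A u x.
Proof.
move=> [a [b [Ab abx]]] h; apply: lb_le_inf.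
  by exists (rnorm a + u * graph_norm A b); exists a, b.
by move=> _ [a' [b' [Ab' abx' ->]]]; exact: h.
Qed.

Lemma graph_norm_ge0 b : 0 <= graph_norm A b.
Proof. by rewrite addr_ge0 ?rnorm_ge0. Qed.

Lemma K_functional_le u a b : 0 <= u -> dom A b ->
  K_functional A u (a + b) <= rnorm a + u * graph_norm A b.
Proof.
move=> u0 Ab; apply: ge_inf; last by exists a, b.
exists 0 => _ [a' [b' [_ _ ->]]].
by rewrite addr_ge0 ?rnorm_ge0// mulr_ge0// graph_norm_ge0.
Qed.

End KFunctional.

Section DyadicStability.
Context {R : realType} {X : normedModType R[i]}.
Variables (p q C : R) (p1 : 1 <= p) (q0 : 0 < q) (C0 : 0 <= C).
Hypothesis clepq : forall s s' : seq X, cle s s' -> lp_seq q s' <= C * lp_seq p s.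
Variables (A : operator X) (T : R -> {linear X -> X}) (M omega : R).
Hypothesis TC0 : C0_semigroup T.
Hypothesis M0 : 0 <= M.
Hypothesis omega0 : 0 < omega.
Hypothesis leTe : forall t x, 0 <= t -> rnorm (T t x) <= M * expR (- omega * t) * rnorm x.
Hypothesis genA : forall b, dom A b -> gen T b (- A b).
Hypothesis dom0 : dom A 0.
Variables (S : X -> X) (CS : R).
Hypothesis CS0 : 0 <= CS.
Hypothesis T1S : forall x, T 1 (S x) = x.
Hypothesis leS : forall x, rnorm (S x) <= CS * rnorm x.
Implicit Types (x y a b : X).

Lemma leT_exp t x : 0 <= t -> rnorm (T t x) <= M * rnorm x.
Proof.
move=> t0; apply: le_trans (leTe _ t0) _; rewrite ler_wpM2r ?rnorm_ge0//.
by rewrite ler_piMr// -expR0 ler_expR mulNr oppr_le0 mulr_ge0 ?(ltW omega0).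
Qed.

Definition dyadic L k := T (k%:R / (2 ^ L)%:R).

Let two_gt0 L : 0 < (2 ^ L)%:R :> R.
Proof. by rewrite ltr0n expn_gt0. Qed.

Lemma dyadic0 L x : dyadic L 0 x = x.
Proof. by rewrite /dyadic mul0r (semigroup0 TC0). Qed.

Lemma dyadicD L j k x : dyadic L (j + k) x = dyadic L j (dyadic L k x).
Proof. by rewrite /dyadic natrD mulrDl (semigroupD TC0)// divr_ge0// ltW. Qed.

(** For y = a + b, boundedness of [T h] handles a and the Lipschitz bound [gen_lip] handles b in the
    domain; the infimum over splittings gives the K-functional. *)
Lemma diff_le_K h y : 0 <= h -> rnorm (y - T h y) <= (1 + M) * K_functional A h y.
Proof.
move=> h0; have M1 : 0 < 1 + M by rewrite ltr_pwDl.
rewrite -ler_pdivrMl//; apply: K_functional_ge.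
  by exists y, 0; rewrite addr0.
move=> a b Ab <-; rewrite ler_pdivrMl// linearD opprD addrACA.
apply: le_trans (rnormD _ _) _; rewrite mulrDr; apply: lerD.
  by apply: le_trans (rnormB _ _) _; rewrite mulrDl mul1r lerD2l; exact: leT_exp.
rewrite rdistC; apply: le_trans (gen_lip TC0 M0 leT_exp h0 (genA Ab)) _.
rewrite rnormN mulrCA; apply: ler_pM => //; rewrite ?mulr_ge0 ?rnorm_ge0//.
  by rewrite lerDr.
by rewrite ler_wpM2l// lerDr rnorm_ge0.
Qed.

Lemma rnorm_le_K y : rnorm y <= K_functional A 1 y.
Proof.
apply: K_functional_ge; first by exists y, 0; rewrite addr0.
move=> a b Ab <-; apply: le_trans (rnormD _ _) _.
by rewrite mul1r lerD2l lerDl rnorm_ge0.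
Qed.

Let B := (1 - expR (- omega))^-1.

Let expN_lt1 : expR (- omega) < 1.
Proof. by rewrite -expR0 ltr_expR oppr_lt0. Qed.

Let B0 : 0 <= B. Proof. by rewrite invr_ge0 subr_ge0 ltW. Qed.

Let sum_r l n : \sum_(k < n) expR (- omega / (2 ^ l)%:R) ^+ k <= B * (2 ^ l)%:R.
Proof.
set N := (2 ^ l)%N; set r := expR _.
have r1 : r < 1 by rewrite -expR0 ltr_expR mulNr oppr_lt0 divr_gt0 ?two_gt0.
have r0 : 0 <= r by exact: expR_ge0.
have d0 : 0 < 1 - r by rewrite subr_gt0.
have geo j : (1 - r) * \sum_(k < j) r ^+ k = 1 - r ^+ j by rewrite -opprB mulNr -subrX1 opprB.
(* With N = 2 ^ l, the quotient (1 - r^N) / (1 - r) is a sum of N terms at most 1, and r^N =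
   exp(-omega) does not depend on [l]. *)
apply: (@le_trans _ _ (1 - r)^-1).
  by rewrite -(ler_pM2l d0) geo divff ?gt_eqF// gerBl exprn_ge0.
have rN : r ^+ N = expR (- omega) by rewrite -expRM_natl mulrC divfK// gt_eqF ?two_gt0.
rewrite /B -rN mulrC ler_pdivlMr ?rN ?subr_gt0// -rN -geo mulKf ?gt_eqF//.
apply: (@le_trans _ _ (\sum_(k < N) (1 : R))); last by rewrite sumr_const card_ord.
by apply: ler_sum => k _; rewrite exprn_ile1// ltW.
Qed.

Lemma dyadic_avg2 (a : {poly R[i]}) L m w : (m <= L)%N ->
  (forall z, cabs z = 1 -> cabs a.[z] <= 1) ->
  rnorm (pol (dyadic L) a (avg2 (dyadic L) m w)) <=
  M ^+ 3 * C * B `^ p^-1 * CS * ((2 ^ (L - m))%:R `^ (p^-1 - q^-1)) * rnorm w.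
Proof.
move=> mL a1.
have LE : (2 ^ L = 2 ^ m * 2 ^ (L - m))%N by rewrite -expnD subnKC.
(* The inverse of [T 1] puts [w] at time 1 of an orbit, which is K * N grid steps with K = 2 ^ m and
   N = 2 ^ (L - m). *)
have wE : w = dyadic L (2 ^ m * 2 ^ (L - m))%N (S w).
  by rewrite -LE /dyadic divff ?gt_eqF// T1S.
rewrite [w in avg2 _ _ w]wE /avg2.
have := @rnorm_transference R X p q C p1 q0 C0 clepq (dyadic L) (@dyadicD L) m (L - m)
  M (expR (- omega / (2 ^ (L - m))%:R)) B M0 (expR_ge0 _) _ _ _ (sum_r _) a a1 (S w).
move=> /(_ _ _ _)/wrap[].
- by rewrite -expR0 ler_expR mulNr oppr_le0 divr_ge0 ?ltW.
- by move=> k x; apply: leT_exp; rewrite divr_ge0// ltW.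
- move=> c x; apply: le_trans (leTe _ _) _; first by rewrite divr_ge0// ltW.
  rewrite -expRM_natl le_eqVlt; apply/orP; left; apply/eqP; congr (_ * expR _ * _).
  rewrite LE natrM natrM mulrA [(- omega) * _]mulrC; field.
  by rewrite !gt_eqF.
move=> /le_trans; apply.
rewrite -!mulrA; do ?[apply: ler_wpM2l; rewrite ?exprn_ge0 ?powR_ge0//].
by rewrite mulrCA ler_wpM2l ?powR_ge0.
Qed.

(** Short averages cost the large factor (2 ^ (L - m))^theta, but [detail m] contains the difference
    1 - T(2^-(L - m)), which the K-functional controls at exactly this scale. *)
Lemma dyadic_stability : exists2 C' : R, 0 <= C' &
  forall L (a : {poly R[i]}) y, (forall z, cabs z = 1 -> cabs a.[z] <= 1) ->
  rnorm (pol (dyadic L) a y) <=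
    C' * \sum_(l < L.+1) (2 ^ l)%:R `^ (p^-1 - q^-1) * K_functional A (2 ^ l)%:R^-1 y.
Proof.
pose D := M ^+ 3 * C * B `^ p^-1 * CS.
have D0 : 0 <= D by rewrite !mulr_ge0 ?exprn_ge0 ?powR_ge0.
(* The factor (3 + M) / 4 bounds (3 + V) / 4 in [detail], and 1 + M comes from [diff_le_K]. *)
have E0 : 0 <= (3 + M) / 4 * (1 + M) by rewrite mulr_ge0 ?divr_ge0 ?addr_ge0.
have F1 : 1 <= 1 + (3 + M) / 4 * (1 + M) by rewrite lerDl.
have F0 : 0 <= 1 + (3 + M) / 4 * (1 + M) by exact: le_trans F1.
exists (D * (1 + (3 + M) / 4 * (1 + M))); first by rewrite mulr_ge0.
move=> L a y a1.
have -> : pol (dyadic L) a y = pol (dyadic L) a (avg2 (dyadic L) L y) +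
    \sum_(m < L) pol (dyadic L) a (avg2 (dyadic L) m (detail (dyadic L) m y)).
  by rewrite -(@pol_sum _ _ (dyadic L) a L (fun m => avg2 (dyadic L) m (detail (dyadic L) m y)))
    -polD -(avg2_sum (@dyadic0 L) (@dyadicD L)).
apply: le_trans (rnormD _ _) _; rewrite -mulrA mulr_sumr mulr_sumr big_ord_recl/=.
apply: lerD.
  apply: le_trans (dyadic_avg2 _ (leqnn L) a1) _.
  rewrite subnn expn0 -/D -mulrA ler_wpM2l// powR1 !mul1r invr1.
  apply: le_trans (rnorm_le_K y) _; rewrite ler_peMl//.
  by apply: le_trans (rnorm_le_K y); exact: rnorm_ge0.
apply: le_trans (rnorm_sum _ _ _) _.
(* Reversal replaces m by L - l - 1, so the difference in [detail] is taken at time 2^-(l + 1). The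
   term at index 0 was spent on the longest average. *)
rewrite (reindex_inj rev_ord_inj)/=; apply: ler_sum => l _.
have lL := ltn_ord l; have kL : (L - l.+1 <= L)%N by exact: leq_subr.
apply: le_trans (dyadic_avg2 _ kL a1) _; rewrite subKn// -/D.
move: (D) D0 => D' D0'; rewrite -!mulrA ler_wpM2l// mulrCA ler_wpM2l ?powR_ge0//.
set h := ((2 ^ (bump 0 l))%:R^-1 : R).
have h0 : 0 <= h by rewrite invr_ge0.
have Vh : dyadic L (2 ^ (L - l.+1)) = T h.
  rewrite /dyadic /h /bump/= add1n; congr T.
  by rewrite -[in (2 ^ L)%N](subnK lL) expnD natrM invfM mulrA divff ?mul1r// gt_eqF.
rewrite /detail Vh rnormZr ger0_norm ?invr_ge0//.
have K0 : 0 <= K_functional A h y.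
  rewrite -(pmulr_rge0 _ (_ : 0 < 1 + M)) ?ltr_pwDl//.
  by apply: le_trans (diff_le_K y h0); exact: rnorm_ge0.
apply: (@le_trans _ _ (4^-1 * ((3 + M) * rnorm (y - T h y)))).
  rewrite ler_wpM2l ?invr_ge0//; apply: le_trans (rnormD _ _) _.
  rewrite mulrDl; apply: lerD; last exact: leT_exp.
  by rewrite rnormZ -(rmorph_nat (real_complex R) 3) cabs_real ger0_norm.
rewrite [leRHS]mulrDl mul1r; apply: ler_wpDl => //.
rewrite mulrCA -!mulrA ler_wpM2l ?addr_ge0// ler_wpM2l ?invr_ge0//.
exact: diff_le_K.
Qed.

End DyadicStability.

(** * Polynomials of a discrete semigroup *)

Section PolynomialCalculus.
Context {R : realType} {X : normedModType R[i]}.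
Variable U : nat -> {linear X -> X}.
Implicit Types (x y : X) (a b : {poly R[i]}).

Lemma pol_widen m a x : (size a <= m)%N -> pol U a x = \sum_(k < m) a`_k *: U k x.
Proof.
move=> am; rewrite /pol -(subnKC am) big_split_ord/= [X in _ + X]big1 ?addr0// => k _.
by rewrite nth_default ?scale0r// leq_addr.
Qed.

Lemma pol0 x : pol U 0 x = 0.
Proof. by rewrite /pol size_poly0 big_ord0. Qed.

Lemma polDl a b x : pol U (a + b) x = pol U a x + pol U b x.
Proof.
rewrite (pol_widen _ (size_polyD a b)).
rewrite (pol_widen _ (leq_maxl (size a) (size b))) (pol_widen _ (leq_maxr (size a) (size b))).
by rewrite -big_split/=; apply: eq_bigr => k _; rewrite coefD scalerDl.
Qed.

Lemma polZl c a x : pol U (c *: a) x = c *: pol U a x.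
Proof.
rewrite (pol_widen _ (size_scale_leq c a)) scaler_sumr.
by apply: eq_bigr => k _; rewrite coefZ scalerA.
Qed.

Lemma polBl a b x : pol U (a - b) x = pol U a x - pol U b x.
Proof. by rewrite polDl -scaleN1r polZl scaleN1r. Qed.

Lemma polXn k x : pol U 'X^k x = U k x.
Proof.
rewrite /pol size_polyXn big_ord_recr/= coefXn eqxx scale1r big1 ?add0r// => i _.
by rewrite coefXn/= ltn_eqF ?scale0r.
Qed.

Lemma pol_poly n (f : nat -> R[i]) x :
  pol U (\sum_(k < n) f k *: 'X^k) x = \sum_(k < n) f k *: U k x.
Proof.
elim: n => [|n ih]; first by rewrite !big_ord0 pol0.
by rewrite !big_ord_recr/= polDl ih polZl polXn.
Qed.

Hypothesis U0 : forall x, U 0%N x = x.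
Hypothesis UD : forall j k x, U (j + k)%N x = U j (U k x).

Lemma polC c x : pol U c%:P x = c *: x.
Proof. by rewrite -[c%:P]mulr1 mul_polyC -(expr0 'X) polZl polXn U0. Qed.

Lemma pol1 x : pol U 1 x = x.
Proof. by rewrite polC scale1r. Qed.

Lemma pol_mulX a x : pol U (a * 'X) x = pol U a (U 1%N x).
Proof.
have h : (size (a * 'X)%R <= (size a).+1)%N.
  by apply: leq_trans (size_polyMleq _ _) _; rewrite size_polyX addn2.
rewrite (pol_widen _ h) big_ord_recl coefMX/= scale0r add0r.
by apply: eq_bigr => k _; rewrite coefMX/= -UD addn1.
Qed.

Lemma pol_comm k a x : pol U a (U k x) = U k (pol U a x).
Proof.
rewrite /pol linear_sum; apply: eq_bigr => i _.
by rewrite linearZ/= -!UD addnC.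
Qed.

Lemma polM a b x : pol U (a * b) x = pol U a (pol U b x).
Proof.
elim/poly_ind: a x => [|a c ih] x; first by rewrite mul0r !pol0.
rewrite mulrDl mulrAC polDl pol_mulX ih -pol_mulX !polDl polC mul_polyC polZl.
by rewrite !pol_mulX pol_comm.
Qed.

End PolynomialCalculus.

Lemma pol_comp (R : realType) (X : normedModType R[i]) (U V : nat -> {linear X -> X}) K
  (a : {poly R[i]}) x : (forall x, U 0%N x = x) ->
  (forall j k x, U (j + k)%N x = U j (U k x)) -> (forall k x, V k x = U (K * k)%N x) ->
  pol V a x = pol U (a \Po 'X^K) x.
Proof.
move=> U0 UD VU.
have V0 y : V 0%N y = y by rewrite VU muln0.
have VD j k y : V (j + k)%N y = V j (V k y) by rewrite !VU mulnDr UD.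
elim/poly_ind: a x => [|a c ih] x; first by rewrite comp_poly0 !pol0.
rewrite comp_polyD comp_polyM comp_polyX comp_polyC !polDl !polC//.
by rewrite pol_mulX// ih (polM U0 UD) polXn VU muln1.
Qed.

(** * Truncated Neumann series as polynomials *)

Section ScalarResolvent.
Context {R : realType}.
Implicit Types (mu z : R[i]) (L n : nat).

Definition step L : R := (2 ^ L)%:R^-1.

Lemma step_gt0 L : 0 < step L.
Proof. by rewrite invr_gt0 ltr0n expn_gt0. Qed.

Lemma step_cvg0 : step L @[L --> \oo] --> (0 : R).
Proof.
have -> : step = fun L => (2^-1 : R) ^+ L.
  by apply/funext => L; rewrite /step natrX exprVn.
by apply: cvg_expr; rewrite ger0_norm// invf_lt1// ltr1n.
Qed.

(** With e = [step L], mu - (z - 1) / e = (e rho)^-1 (1 - rho z), so [rho] is the coefficient of z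
    in the ratio of the Neumann series. *)
Definition rho mu L := (1 + (step L)%:C * mu)^-1.

(* Truncated Neumann series of [(mu - (z - 1) / step L)^-1]. *)
Definition respoly mu L : {poly R[i]} :=
  \sum_(k < 4 ^ L) ((step L)%:C * rho mu L ^+ k.+1) *: 'X^k.

Definition restail mu L : {poly R[i]} := (rho mu L ^+ (4 ^ L)) *: 'X^(4 ^ L).

Variable mu : R[i].
Hypothesis mu0 : 0 < complex.Re mu.

Let den_ge L : 1 + step L * complex.Re mu <= cabs (1 + (step L)%:C * mu).
Proof. by apply: le_trans (Re_le_cabs _); rewrite ReD ReMr. Qed.

Let den_gt0 L : 0 < 1 + step L * complex.Re mu.
Proof. by rewrite ltr_pwDl// mulr_ge0// ltW// step_gt0. Qed.

Let den_neq0 L : 1 + (step L)%:C * mu != 0.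
Proof. by rewrite -cabs_eq0 gt_eqF// (lt_le_trans (den_gt0 L)). Qed.

Lemma cabs_rho L : cabs (rho mu L) <= (1 + step L * complex.Re mu)^-1.
Proof. by rewrite cabsV lef_pV2 ?posrE// (lt_le_trans (den_gt0 L)). Qed.

Lemma cabs_rho_le1 L : cabs (rho mu L) <= 1.
Proof.
apply: le_trans (cabs_rho L) _; rewrite invf_le1// lerDl mulr_ge0// ltW//.
exact: step_gt0.
Qed.

(** The l^1 norm of the coefficients, uniform in [L], bounds the polynomial on the closed disc and
    also at the operator [W], where every power has norm at most [M]. *)
Lemma sum_rho L n :
  \sum_(k < n) cabs ((step L)%:C * rho mu L ^+ k.+1) <= (complex.Re mu)^-1.
Proof.
have := cabs_rho L; set r := cabs _ => rle.
have r0 : 0 <= r by exact: cabs_ge0.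
have r1 : r <= 1 by exact: cabs_rho_le1.
have -> : \sum_(k < n) cabs ((step L)%:C * rho mu L ^+ k.+1) =
    step L * r * \sum_(k < n) r ^+ k.
  rewrite mulr_sumr; apply: eq_bigr => k _.
  by rewrite cabsM cabsX cabs_real gtr0_norm ?step_gt0// exprS mulrA.
rewrite -[leRHS]mul1r ler_pdivlMr//.
have sr : step L * r * complex.Re mu <= 1 - r.
  move: rle; rewrite -div1r ler_pdivlMr// mulrDr mulr1 -lerBrDl.
  by rewrite mulrA [r * _]mulrC.
have S0 : 0 <= \sum_(k < n) r ^+ k by apply: sumr_ge0 => k _; exact: exprn_ge0.
rewrite mulrAC; apply: le_trans (ler_wpM2r S0 sr) _.
by rewrite -opprB mulNr -subrX1 opprB gerBl exprn_ge0.
Qed.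

Lemma respoly_id L :
  (mu%:P - ((step L)^-1)%:C *: ('X - 1)) * respoly mu L = 1 - restail mu L.
Proof.
have e0 : (step L)%:C != 0 :> R[i] by rewrite -cabs_eq0 cabs_real normr_eq0 gt_eqF ?step_gt0.
set e := (step L)%:C in e0 *; set r := rho mu L.
have rE : r^-1 = 1 + e * mu by rewrite invrK.
have r0 : r != 0 by rewrite invr_eq0 den_neq0.
have -> : (mu%:P - ((step L)^-1)%:C *: ('X - 1)) = (e * r)^-1 *: (1 - r *: 'X).
  have E1 : (e * r)^-1 = e^-1 + mu by rewrite invfM rE mulrDr mulr1 mulKf.
  rewrite fmorphV/= -/e [RHS]scalerBr scalerA {2}invfM mulfVK// E1 -!mul_polyC polyCD mulr1.
  by ring.
have -> : respoly mu L = (e * r) *: \sum_(k < 4 ^ L) (r *: 'X) ^+ k.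
  rewrite scaler_sumr; apply: eq_bigr => k _.
  by rewrite exprZn scalerA exprS mulrA.
rewrite -scalerAl -scalerAr scalerA mulVf ?mulf_neq0// scale1r.
by rewrite -[_ - _ in LHS]opprB mulNr -subrX1 opprB exprZn.
Qed.

(** By Bernoulli, (1 + e Re mu)^(4^L) is at least 4^L e Re mu = 2^L Re mu. This fixes the truncation
    length: with 2^L terms the bound on the tail would tend to exp(-Re mu) instead of 0. *)
Lemma cabs_restail L : cabs (rho mu L ^+ (4 ^ L)) <= (complex.Re mu)^-1 * step L.
Proof.
have := cabs_rho L; rewrite cabsX; set r := cabs _ => rle.
have r0 : 0 <= r by exact: cabs_ge0.
apply: le_trans (lerXn2r (4 ^ L) _ _ rle) _; rewrite ?nnegrE ?invr_ge0 ?(ltW (den_gt0 _))//.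
rewrite exprVn /step -invfM lef_pV2 ?posrE ?exprn_gt0// ?mulr_gt0 ?ltr0n ?expn_gt0//.
have bern n (x : R) : 0 <= x -> n%:R * x <= (1 + x) ^+ n.
  move=> x0; suff : 1 + n%:R * x <= (1 + x) ^+ n by apply: le_trans; rewrite lerDr.
  elim: n => [|n ih]; first by rewrite mul0r addr0 expr0.
  rewrite exprS; apply: le_trans (ler_wpM2l _ ih); last by rewrite addr_ge0.
  have -> : (1 + x) * (1 + n%:R * x) = 1 + n.+1%:R * x + n%:R * x ^+ 2.
    by rewrite -natr1; ring.
  by rewrite lerDl mulr_ge0// exprn_ge0.
apply: le_trans (bern _ _ _); last by rewrite mulr_ge0// ?ltW// step_gt0.
by rewrite /step (_ : 4 = 2 * 2)%N// expnMn natrM mulrA mulfK ?gt_eqF ?ltr0n ?expn_gt0// mulrC.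
exact: den_gt0.
Qed.

Lemma cabs_respoly L z : cabs z <= 1 -> cabs (respoly mu L).[z] <= (complex.Re mu)^-1.
Proof.
move=> z1; rewrite /respoly horner_sum; apply: le_trans (cabs_sum _ _ _) _.
apply: le_trans (sum_rho L (4 ^ L)); apply: ler_sum => k _.
by rewrite hornerZ hornerXn [leLHS]cabsM ler_piMr ?cabs_ge0// cabsX exprn_ile1 ?cabs_ge0.
Qed.

End ScalarResolvent.

(** * Resolvents of the generator as limits *)

Section Resolvent.
Context {R : realType} {X : completeNormedModType R[i]}.
Variables (T : R -> {linear X -> X}) (M : R).
Hypothesis TC0 : C0_semigroup T.
Hypothesis M0 : 0 <= M.
Hypothesis leT : forall t x, 0 <= t -> rnorm (T t x) <= M * rnorm x.
Implicit Types (x y b w : X) (mu : R[i]) (L : nat).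

Let W L := dyadic T L.
Let W0 L := dyadic0 TC0 L.
Let WD L := dyadicD TC0 L.

Let le_W L k x : rnorm (W L k x) <= M * rnorm x.
Proof. by apply: leT; rewrite divr_ge0. Qed.

Lemma cauchy_rnorm (u : nat -> X) : (forall e : R, 0 < e ->
  exists n, forall m, (n <= m)%N -> rnorm (u n - u m) <= e) -> cvgn u.
Proof.
move=> h; apply: cauchy_cvg; apply: cauchy_exP => e e0.
have eE : e = (complex.Re e)%:C by rewrite RRe_real// gtr0_real.
have d0 : 0 < complex.Re e by rewrite -ltcR -eE.
have [n hn] := h (complex.Re e / 2) ltac:(by rewrite divr_gt0).
exists (u n); exists n => // m nm; rewrite -ball_normE/= rnormE eE ltcR.
by apply: le_lt_trans (hn m nm) _; rewrite ltr_pdivrMr// mulr_natr mulr2n ltrDl.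
Qed.

Lemma squeeze_rnorm (u : nat -> X) l (v : nat -> R) :
  (forall n, rnorm (u n - l) <= v n) -> v @ \oo --> (0 : R) -> u @ \oo --> l.
Proof.
move=> uv v0; apply/cvg_rnorm; apply: (squeeze_cvgr _ (cvg_cst 0) v0).
by apply: nearW => n; rewrite rnorm_ge0 uv.
Qed.

Lemma rnorm_lim_le (u : nat -> X) l (v : nat -> R) c : (forall n, rnorm (u n) <= v n) ->
  u @ \oo --> l -> v @ \oo --> c -> rnorm l <= c.
Proof.
move=> uv ul vc; have h : v n + rnorm (u n - l) @[n --> \oo] --> c + 0.
  by apply: cvgD => //; apply/cvg_rnorm.
rewrite -[c]addr0; apply: le_cvgn h => n; rewrite rdistC.
by rewrite -[in leLHS](subrK (u n) l) addrC; apply: le_trans (rnormD _ _) _; rewrite lerD2r.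
Qed.

Definition res_approx mu L x := pol (W L) (respoly mu L) x.

Lemma rnorm_res_approx mu L x : 0 < complex.Re mu ->
  rnorm (res_approx mu L x) <= M / complex.Re mu * rnorm x.
Proof.
move=> mu0; rewrite /res_approx /respoly.
rewrite (pol_poly _ _ (fun k => (step L)%:C * rho mu L ^+ k.+1)).
apply: le_trans (rnorm_sum _ _ _) _.
apply: (@le_trans _ _ (\sum_(k < 4 ^ L)
    cabs ((step L)%:C * rho mu L ^+ k.+1) * (M * rnorm x))).
  by apply: ler_sum => k _; rewrite rnormZ ler_wpM2l ?cabs_ge0.
rewrite -mulr_suml mulrA ler_wpM2r ?rnorm_ge0// mulrC ler_wpM2l//.
exact: sum_rho.
Qed.

Lemma rnorm_restail mu L x : 0 < complex.Re mu ->
  rnorm (pol (W L) (restail mu L) x) <= M / complex.Re mu * step L * rnorm x.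
Proof.
move=> mu0; rewrite polZl polXn rnormZ.
apply: le_trans (ler_pM _ _ (cabs_restail mu0 L) (le_W L (4 ^ L) x)) _.
- exact: cabs_ge0.
- exact: rnorm_ge0.
rewrite le_eqVlt; apply/orP; left; apply/eqP; ring.
Qed.

Let solve_sub (V : zmodType) (a g b t : V) : a - g = b - t -> g = a - b + t.
Proof.
move=> h; rewrite -(subrK g a) h [b - t]addrC -!addrA [b + _]addrCA.
by rewrite [b + _]addrA subrr add0r addrCA addNr addr0.
Qed.

Lemma pol_dyadicX L x : pol (W L) 'X x = T (step L) x.
Proof. by rewrite -['X]expr1 polXn /W /dyadic div1r. Qed.

Lemma res_approx_id mu L x : 0 < complex.Re mu ->
  ((step L)^-1)%:C *: (T (step L) (res_approx mu L x) - res_approx mu L x) =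
  mu *: res_approx mu L x - x + pol (W L) (restail mu L) x.
Proof.
move=> mu0; have := congr1 (fun a => pol (W L) a x) (respoly_id mu0 L).
rewrite (polM (W0 L) (WD L)) !polBl polZl polBl (polC (W0 L)) !(pol1 (W0 L)) -/(res_approx mu L x).
rewrite pol_dyadicX => h; exact: solve_sub h.
Qed.

(** The bracket equals g s', written so that the difference quotient g, whose available bounds grow
    with the refinement, does not appear on its own. *)
Let resolvent_diff (V : comNzRingType) (m g D s s' : V) :
  s - s' = s * (1 - (m - g) * s') - s' * (1 - (m - g * D) * s) +
    s * ((m * s' - 1 + (1 - (m - g) * s')) * (D - 1)).
Proof. by ring. Qed.

(** A resolvent identity between two grids. The coarse difference quotient is the fine one times the
    average [D] of the first 2^(L' - L) powers, so the difference consists of the two tails and a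
    term with D - 1, which is small on [x] by strong continuity. *)
Lemma rnorm_res_approxB mu L L' x eta : 0 < complex.Re mu -> (L <= L')%N ->
  (forall s, 0 <= s -> s <= step L -> rnorm (T s x - x) <= eta) ->
  rnorm (res_approx mu L x - res_approx mu L' x) <=
    (M / complex.Re mu) ^+ 2 * (step L + step L') * rnorm x +
    M / complex.Re mu * (cabs mu * (M / complex.Re mu) + 1 + M / complex.Re mu) * eta.
Proof.
move=> mu0 LL' eta_le; set a := M / complex.Re mu.
have a0 : 0 <= a by rewrite divr_ge0// ltW.
set K := (2 ^ (L' - L))%N.
have K0 : 0 < K%:R :> R by rewrite ltr0n expn_gt0.
have LE : (2 ^ L' = K * 2 ^ L)%N by rewrite -expnD subnK.
have WK k y : W L k y = W L' (K * k)%N y.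
  rewrite /W /dyadic; congr (T _ y).
  by rewrite LE !natrM -mulf_div divff ?mul1r// gt_eqF.
have compE (c : {poly R[i]}) y : pol (W L) c y = pol (W L') (c \Po 'X^K) y.
  by apply: pol_comp; [exact: W0|exact: WD|exact: WK].
set s1 := respoly mu L \Po 'X^K; set t1 := restail mu L \Po 'X^K.
set s2 := respoly mu L'; set t2 := restail mu L'.
pose D : {poly R[i]} := \sum_(i < K) (K%:R^-1)%:C *: 'X^i.
pose g : {poly R[i]} := ((step L')^-1)%:C *: ('X - 1).
have id2 : t2 = 1 - (mu%:P - g) * s2 by rewrite respoly_id// opprB addrCA subrr addr0.
have id1 : t1 = 1 - (mu%:P - g * D) * s1.
  have := congr1 (fun a => a \Po 'X^K) (respoly_id mu0 L).
  rewrite comp_polyM comp_polyB comp_polyC comp_polyZ !comp_polyB comp_polyX -!polyC1 !comp_polyC.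
  rewrite -/s1 -/t1 => h; apply/eqP; rewrite eq_sym subr_eq addrC -subr_eq -h; apply/eqP.
  congr ((_ - _) * _); rewrite /D -scaler_sumr -scalerAr /g -scalerAl scalerA -subrX1 -rmorphM/=.
  by congr (_%:C *: _); rewrite /step LE natrM !invrK mulKf ?gt_eqF.
have E : s1 - s2 = s1 * t2 - s2 * t1 + s1 * ((mu *: s2 - 1 + t2) * (D - 1)).
  by rewrite id1 id2 -mul_polyC; exact: resolvent_diff.
rewrite /res_approx compE -polBl -/s1 -/s2 E polDl polBl !(polM (W0 L') (WD L')).
have s1_le y : rnorm (pol (W L') s1 y) <= a * rnorm y.
  by rewrite -compE; exact: rnorm_res_approx.
have t1_le y : rnorm (pol (W L') t1 y) <= a * step L * rnorm y.
  by rewrite -compE; exact: rnorm_restail.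
have s2_le y : rnorm (pol (W L') s2 y) <= a * rnorm y by exact: rnorm_res_approx.
have t2_le y : rnorm (pol (W L') t2 y) <= a * step L' * rnorm y by exact: rnorm_restail.
apply: le_trans (rnormD _ _) _; apply: lerD.
  apply: le_trans (rnormB _ _) _; rewrite mulrDr mulrDl addrC; apply: lerD.
    have -> : a ^+ 2 * step L * rnorm x = a * (a * step L * rnorm x) by ring.
    by apply: le_trans (s2_le _) _; rewrite ler_wpM2l.
  have -> : a ^+ 2 * step L' * rnorm x = a * (a * step L' * rnorm x) by ring.
  by apply: le_trans (s1_le _) _; rewrite ler_wpM2l.
apply: le_trans (s1_le _) _; rewrite -mulrA ler_wpM2l//.
set z := pol _ (D - 1) x.
have z_le : rnorm z <= eta.
  have -> : z = (K%:R^-1)%:C *: \sum_(i < K) (W L' i x - x).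
    rewrite /z polBl (pol1 (W0 L')) (pol_poly _ _ (fun=> (K%:R^-1)%:C)) -scaler_sumr.
    have -> : \sum_(i < K) (W L' i x - x) = \sum_(i < K) W L' i x - K%:R%:C *: x.
      by rewrite sumrB sumr_const card_ord rmorph_nat scaler_nat.
    by rewrite scalerBr scalerA -rmorphM/= mulVf ?gt_eqF// scale1r.
  rewrite rnormZr ger0_norm ?invr_ge0// ler_pdivrMl//; apply: le_trans (rnorm_sum _ _ _) _.
  rewrite -[K in leRHS]card_ord mulr_natl -sumr_const; apply: ler_sum => i _.
  apply: eta_le; first by rewrite divr_ge0.
  rewrite /step LE natrM invfM mulrA ler_piMl ?invr_ge0// ler_pdivrMr// mul1r ler_nat.
  exact: ltnW.
rewrite polDl polBl polZl (pol1 (W0 L')).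
have step1 : step L' <= 1 :> R by rewrite /step invf_le1 ?ltr0n ?expn_gt0// ler1n expn_gt0.
apply: (@le_trans _ _ ((cabs mu * a + 1 + a) * rnorm z)); last first.
  by rewrite ler_wpM2l// !addr_ge0// mulr_ge0// cabs_ge0.
apply: le_trans (rnormD _ _) _; rewrite mulrDl; apply: lerD; last first.
  by apply: le_trans (t2_le _) _; rewrite ler_wpM2r ?rnorm_ge0// ler_piMr.
apply: le_trans (rnormB _ _) _; rewrite mulrDl mul1r lerD2r rnormZ -mulrA.
by rewrite ler_wpM2l ?cabs_ge0.
Qed.

Lemma step_le L L' : (L <= L')%N -> step L' <= step L :> R.
Proof. by move=> h; rewrite lef_pV2 ?posrE ?ltr0n ?expn_gt0// ler_nat leq_exp2l. Qed.

Lemma step_small (e : R) : 0 < e -> exists L, step L < e.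
Proof.
move=> e0; have /cvgrPdist_lt/(_ _ e0)[L _ /(_ L (leqnn L))] := @step_cvg0 R.
by rewrite /= sub0r normrN gtr0_norm ?step_gt0//; exists L.
Qed.

Lemma res_approx_is_cvg mu x : 0 < complex.Re mu -> cvgn (fun L => res_approx mu L x).
Proof.
move=> mu0; apply: cauchy_rnorm => e e0.
set a := M / complex.Re mu; have a0 : 0 <= a by rewrite divr_ge0// ltW.
set k2 := a * (cabs mu * a + 1 + a).
have k20 : 0 <= k2 by rewrite mulr_ge0// !addr_ge0// mulr_ge0// cabs_ge0.
set k1 := a ^+ 2 * 2 * rnorm x.
have k10 : 0 <= k1 by rewrite mulr_ge0 ?rnorm_ge0// mulr_ge0// sqr_ge0.
have pos k : 0 <= k -> 0 < k + 1 by move=> ?; rewrite ltr_wpDl.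
have small k : 0 <= k -> k * (e / 2 / (k + 1)) <= e / 2.
  move=> k0; rewrite mulrCA ler_piMr ?divr_ge0 ?(ltW e0)//.
  by rewrite ler_pdivrMr ?pos// mul1r lerDl.
have e2 k : 0 <= k -> 0 < e / 2 / (k + 1) by move=> k0; rewrite !divr_gt0// pos.
have [d d0 hd] := T_small TC0 x (e2 _ k20).
have [L1 hL1] := step_small d0; have [L2 hL2] := step_small (e2 _ k10).
exists (maxn L1 L2) => m Lm.
have hs : step (maxn L1 L2) < d := le_lt_trans (step_le (leq_maxl L1 L2)) hL1.
have hs' : step (maxn L1 L2) < e / 2 / (k1 + 1) := le_lt_trans (step_le (leq_maxr L1 L2)) hL2.
apply: le_trans (rnorm_res_approxB mu0 Lm (fun s s0 sL => hd s s0 (le_lt_trans sL hs))) _.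
apply: (@le_trans _ _ (e / 2 + e / 2)); last by lra.
rewrite -/a -/k2; apply: lerD; last exact: small.
apply: le_trans (small _ k10); move: hs'; set v := (X in _ < X) => hs'.
have -> : k1 * v = a ^+ 2 * rnorm x * (v + v) by rewrite /k1; ring.
rewrite mulrAC; apply: ler_wpM2l; first by rewrite mulr_ge0 ?rnorm_ge0 ?sqr_ge0.
apply: lerD; first exact: ltW.
by apply: le_trans (step_le Lm) _; exact: ltW.
Qed.

Definition resolvent mu x := lim (res_approx mu L x @[L --> \oo]).

Lemma cvg_res_approx mu x : 0 < complex.Re mu ->
  res_approx mu L x @[L --> \oo] --> resolvent mu x.
Proof. exact: res_approx_is_cvg. Qed.

Lemma resolvent_lim mu x l : 0 < complex.Re mu ->
  res_approx mu L x @[L --> \oo] --> l -> resolvent mu x = l.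
Proof. by move=> mu0; exact: cvg_unique (cvg_res_approx mu0). Qed.

Lemma rnorm_resolvent mu x : 0 < complex.Re mu ->
  rnorm (resolvent mu x) <= M / complex.Re mu * rnorm x.
Proof.
by move=> mu0; apply: rnorm_lim_le (cvg_res_approx mu0) (cvg_cst _) => L; exact: rnorm_res_approx.
Qed.

Lemma cvg_restail mu x : 0 < complex.Re mu ->
  pol (W L) (restail mu L) x @[L --> \oo] --> 0.
Proof.
move=> mu0; apply: (@squeeze_rnorm _ _ (fun L => M / complex.Re mu * step L * rnorm x)).
  by move=> L; rewrite subr0; exact: rnorm_restail.
have -> : 0 = M / complex.Re mu * 0 * rnorm x by rewrite mulr0 mul0r.
by apply: cvgMl; apply: cvgMr; exact: step_cvg0.
Qed.

Lemma gen_resolvent mu x : 0 < complex.Re mu ->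
  gen T (resolvent mu x) (mu *: resolvent mu x - x).
Proof.
move=> mu0.
apply: (gen_closed TC0 M0 leT (@step_gt0 R) (@step_cvg0 R) (cvg_res_approx (x := x) mu0)).
under eq_fun do rewrite res_approx_id//.
rewrite -[mu *: resolvent mu x - x]addr0; apply: cvgD; last exact: cvg_restail.
apply: cvgB; last exact: cvg_cst.
by apply: cvgZr; exact: cvg_res_approx.
Qed.

Lemma resolventP c mu x y : 0 < complex.Re mu ->
  resolvent mu (c *: x + y) = c *: resolvent mu x + resolvent mu y.
Proof.
move=> mu0; apply: resolvent_lim => //.
under eq_fun do rewrite /res_approx polD polZ.
by apply: cvgD; [apply: cvgZr|]; exact: cvg_res_approx.
Qed.

Lemma resolvent_gen mu b w : 0 < complex.Re mu -> gen T b w ->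
  resolvent mu (mu *: b - w) = b.
Proof.
move=> mu0 bw; apply: resolvent_lim => //.
have E L : res_approx mu L (mu *: b - w) = b - pol (W L) (restail mu L) b +
    res_approx mu L (((step L)^-1)%:C *: (T (step L) b - b) - w).
  have h := respoly_id mu0 L; rewrite mulrC in h.
  have := congr1 (fun a => pol (W L) a b) h.
  rewrite (polM (W0 L) (WD L)) !polBl polZl polBl (polC (W0 L)) !(pol1 (W0 L)).
  rewrite pol_dyadicX => <-.
  by rewrite /res_approx -polD addrA subrK.
under eq_fun do rewrite E.
have h : b - pol (W L) (restail mu L) b +
    res_approx mu L (((step L)^-1)%:C *: (T (step L) b - b) - w)
    @[L --> \oo] --> b - 0 + 0.
  apply: cvgD; first by apply: cvgB; [exact: cvg_cst|exact: cvg_restail].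
  apply: (@squeeze_rnorm _ _ (fun L => M / complex.Re mu *
     rnorm (((step L)^-1)%:C *: (T (step L) b - b) - w))).
    by move=> L; rewrite subr0; exact: rnorm_res_approx.
  rewrite -[0](mulr0 (M / complex.Re mu)); apply: cvgMr; apply/cvgrPdist_le => e e0.
  have [d d0 hd] := (cvg_right0P _ _).1 bw _ e0.
  have [L hL] := step_small d0; exists L => // L' /= LL'.
  rewrite sub0r normrN ger0_norm ?rnorm_ge0//; apply: hd; first exact: step_gt0.
  exact: le_lt_trans (step_le LL') hL.
by rewrite subr0 addr0 in h.
Qed.

Lemma resolvent_T mu t x : 0 < complex.Re mu -> 0 <= t ->
  resolvent mu (T t x) = T t (resolvent mu x).
Proof.
move=> mu0 t0; apply: resolvent_lim => //.
apply: (@squeeze_rnorm _ _ (fun L => M * rnorm (res_approx mu L x - resolvent mu x))).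
  move=> L; have -> : res_approx mu L (T t x) = T t (res_approx mu L x).
    rewrite /res_approx /pol linear_sum; apply: eq_bigr => k _; rewrite linearZ/=.
    by rewrite /W /dyadic (semigroup_comm TC0)// divr_ge0.
  by rewrite -linearB; exact: leT.
by rewrite -[0](mulr0 M); apply: cvgMr; apply/cvg_rnorm; exact: cvg_res_approx.
Qed.

End Resolvent.

(** * A-stable rational functions in Horner form *)

Section HornerFractions.
Context {R : realType}.
Implicit Types (p q : {poly R[i]}) (z l c : R[i]) (s : seq (R[i] * R[i])).

Lemma horner_ray p z : exists2 C : R, 0 <= C &
  forall t : R, 0 <= t -> t <= 1 -> cabs (p.[z - t%:C] - p.[z]) <= C * t.
Proof.
elim/poly_ind: p => [|p c [C C0 hC]].
  by exists 0 => // t _ _; rewrite !horner0 subrr cabs0 mul0r.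
exists (C * (cabs z + 1) + cabs p.[z]).
  by rewrite addr_ge0 ?cabs_ge0// mulr_ge0// addr_ge0 ?cabs_ge0.
move=> t t0 t1; rewrite !hornerMXaddC.
have -> : p.[z - t%:C] * (z - t%:C) + c - (p.[z] * z + c) =
  (p.[z - t%:C] - p.[z]) * (z - t%:C) - p.[z] * t%:C by ring.
apply: le_trans (cabsD _ _) _; rewrite cabsN [leRHS]mulrDl; apply: lerD; last first.
  by rewrite cabsM cabs_real ger0_norm.
rewrite cabsM mulrAC; apply: ler_pM; rewrite ?cabs_ge0//; first exact: hC.
by apply: le_trans (cabsD _ _) _; rewrite cabsN cabs_real ger0_norm// lerD2l.
Qed.

Lemma nonroot_ray q z (d : R) : q != 0 -> 0 < d ->
  exists2 t : R, 0 < t <= d & ~~ root q (z - t%:C).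
Proof.
move=> q0 d0; pose f j : R[i] := z - (d / j.+1%:R)%:C.
have fI : injective f.
  move=> i j /addrI/oppr_inj/complexI e; have /GRing.Theory.invr_inj/eqP := mulfI (lt0r_neq0 d0) e.
  by rewrite eqr_nat eqSS => /eqP.
have : ~~ all (root q) [seq f j | j <- iota 0 (size q)].
  apply/negP => h; have := max_poly_roots q0 h.
  by rewrite map_inj_uniq// iota_uniq size_map size_iota ltnn => /(_ isT).
move=> /allPn[_ /mapP[j _ ->] fj]; exists (d / j.+1%:R) => //.
by rewrite divr_gt0//= ler_pdivrMr// ler_peMr ?(ltW d0)// ler1n.
Qed.

(** The bound is taken at points z - t that are not roots of the denominator, where [ratfun_eval]
    would return its default value, and t tends to 0 along the ray. Comparing numerator with
    denominator avoids a division at a possible pole on the imaginary axis. *)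
Lemma A_stable_le (r : ratfun R) z : A_stable r -> complex.Re z <= 0 ->
  cabs (Defs.num r).[z] <= cabs (Defs.den r).[z].
Proof.
move=> [_ r1] z0; apply/ler_addgt0Pr => e e0.
have [C C0 hC] := horner_ray (Defs.num r) z; have [D D0 hD] := horner_ray (Defs.den r) z.
have CD1 : 0 < C + D + 1 by rewrite ltr_wpDl// addr_ge0.
have d0 : 0 < Num.min 1 (e / (C + D + 1)) by rewrite lt_min ltr01 divr_gt0.
have [t /andP[t0 td] rt] := nonroot_ray z (den_neq0 r) d0.
move: td; rewrite le_min => /andP[t1 te].
have Rt : left_half_plane (z - t%:C).
  by rewrite /left_half_plane/= ReD/= subr_lt0 (le_lt_trans z0).
have := r1 _ Rt; rewrite /ratfun_eval cabsE -[1]/(1%:C) lecR cabsM cabsV.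
rewrite ler_pdivrMr ?mul1r => [h|]; last by rewrite lt_neqAle cabs_ge0 eq_sym cabs_eq0 andbT.
rewrite -[(Defs.num r).[z]](subrK (Defs.num r).[z - t%:C]).
apply: le_trans (cabsD _ _) _; rewrite -cabsN opprB.
apply: le_trans (lerD (hC t (ltW t0) t1) h) _.
rewrite -[(Defs.den r).[z - _]](subrK (Defs.den r).[z]).
apply: le_trans (lerD (lexx _) (cabsD _ _)) _.
apply: le_trans (lerD (lexx _) (lerD (hD t (ltW t0) t1) (lexx _))) _.
rewrite addrA addrC lerD2l -mulrDl.
move: te; rewrite ler_pdivlMr// mulrC => /(le_trans _); apply.
by rewrite ler_wpM2r ?(ltW t0)// lerDl.
Qed.

(** At a root of the denominator in the closed left half-plane the numerator would vanish as well,
    against coprimality. *)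
Lemma A_stable_root (r : ratfun R) l : A_stable r -> root (Defs.den r) l -> 0 < complex.Re l.
Proof.
move=> rA rl; rewrite ltNge; apply/negP => l0.
have := A_stable_le rA l0; rewrite (rootP rl) cabs0 => nl.
have rn : root (Defs.num r) l.
  by apply/rootP/eqP; rewrite -cabs_eq0 eq_le nl cabs_ge0.
have := num_den_coprime r => /coprimep_root/(_ rn).
by rewrite (rootP rl) eqxx.
Qed.

Lemma A_stable_size (r : ratfun R) : A_stable r -> (size (Defs.num r) <= size (Defs.den r))%N.
Proof.
move=> rA; rewrite leqNgt; apply/negP => sdn.
have n0 : Defs.num r != 0 by rewrite -size_poly_gt0 (leq_ltn_trans _ sdn).
set a := cabs (lead_coef (Defs.num r)).
have a0 : 0 < a by rewrite lt_neqAle cabs_ge0 eq_sym cabs_eq0 lead_coef_eq0 n0.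
have [m sn] : exists m, size (Defs.num r) = m.+1 
  by exists (size (Defs.num r)).-1; rewrite prednK// size_poly_gt0.
rewrite sn ltnS in sdn.
set C := \sum_(i < m) cabs (Defs.num r)`_i + \sum_(i < m) cabs (Defs.den r)`_i.
have C0 : 0 <= C by rewrite addr_ge0// sumr_ge0// => i _; rewrite cabs_ge0.
(* At -t with t >= 1, the terms other than the leading one of the numerator add up to at most C t^(m
   - 1), so the bound forces a t <= C; but a t = C + a. *)
pose t := C / a + 1.
have t1 : 1 <= t by rewrite lerDr divr_ge0// ltW.
have t0 : 0 < t by exact: lt_le_trans t1.
have := A_stable_le (z := - t%:C) rA; rewrite /= oppr_le0 => /(_ (ltW t0)).
have le_pow (b : {poly R[i]}) : cabs (\sum_(i < m) b`_i * (- t%:C) ^+ i) * t <=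
    (\sum_(i < m) cabs b`_i) * t ^+ m.
  rewrite mulr_suml; apply: le_trans (ler_wpM2r (ltW t0) (cabs_sum _ _ _)) _.
  rewrite mulr_suml; apply: ler_sum => i _; rewrite cabsM cabsX cabsN cabs_real gtr0_norm//.
  rewrite -mulrA ler_wpM2l ?cabs_ge0// -exprSr ler_weXn2l//.
rewrite horner_coef sn big_ord_recr/= (horner_coef_wide _ sdn) => h.
have am : a * t ^+ m <= cabs (\sum_(i < m) (Defs.num r)`_i * (- t%:C) ^+ i) +
    cabs (\sum_(i < m) (Defs.den r)`_i * (- t%:C) ^+ i).
  rewrite addrC; apply: le_trans (lerD h (lexx _)).
  rewrite -[cabs (\sum_(i < m) (Defs.num r)`_i * _)]cabsN; apply: le_trans (cabsD _ _).
  rewrite addrAC subrr add0r cabsM cabsX cabsN cabs_real gtr0_norm//.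
  by rewrite /a lead_coefE sn.
have : a * t ^+ m * t <= C * t ^+ m.
  apply: le_trans (ler_wpM2r (ltW t0) am) _; rewrite /C !mulrDl.
  by apply: lerD; exact: le_pow.
rewrite mulrAC ler_pM2r ?exprn_gt0// /t mulrDr mulr1 mulrC divfK ?gt_eqF//.
by rewrite gerDl leNgt a0.
Qed.

(* The Horner form c_1 + (l_1 - z)^-1 (c_2 + (l_2 - z)^-1 (... + c)) of a rational
   function needs no partial fractions; with resolvents for (l - z)^-1 it becomes
   [hop] below. *)
Definition hfrac c s z := foldr (fun cl v => cl.1 + (cl.2 - z)^-1 * v) c s.

Definition hden s : {poly R[i]} := \prod_(cl <- s) (cl.2%:P - 'X).

Fixpoint hnum c s : {poly R[i]} :=
  if s is cl :: s' then cl.1 *: hden s + hnum c s' else c%:P.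

Lemma size_hden s : size (hden s) = (size s).+1.
Proof.
elim: s => [|cl s ih]; first by rewrite /hden big_nil size_poly1.
rewrite /hden big_cons -opprB mulNr size_polyN size_mul ?polyXsubC_eq0//.
  by rewrite size_XsubC ih.
by rewrite -size_poly_gt0 ih.
Qed.

(** A multiple of the full denominator removes the top coefficient of [p], and the remainder is
    expanded with one pole fewer. [hden] reads the poles alone, so dummy coefficients suffice in
    [s1]. *)
Lemma hnum_exists (ls : seq R[i]) p : (size p <= (size ls).+1)%N ->
  exists c s, map snd s = ls /\ hnum c s = p.
Proof.
elim: ls p => [|l ls ih] p sp.
  by exists p`_0, [::]; split => //=; rewrite -size1_polyC.
have [s1 s1E] : exists s1, map snd s1 = l :: ls.
  by exists [seq (0, l') | l' <- l :: ls]; rewrite -map_comp map_id_in.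
set g := hden s1.
have sg : size g = (size ls).+2 by rewrite size_hden -(size_map snd) s1E.
have g0 : lead_coef g != 0 by rewrite lead_coef_eq0 -size_poly_gt0 sg.
set c1 := p`_(size ls).+1 / lead_coef g.
have [|c [s [sE nE]]] := ih (p - c1 *: g).
  apply/leq_sizeP => j; rewrite leq_eqVlt => /predU1P[<-|hj].
    rewrite coefB coefZ /c1 lead_coefE sg/= divfK ?subrr//.
    by move: g0; rewrite lead_coefE sg.
  by rewrite coefB coefZ !nth_default ?mulr0 ?subrr ?sg// (leq_trans sp).
exists c, ((c1, l) :: s); split; first by rewrite /= sE.
have -> : hnum c ((c1, l) :: s) = c1 *: g + hnum c s.
  rewrite /=; congr (_ *: _ + _).
  by rewrite /g /hden -!(big_map snd xpredT (fun x => x%:P - 'X)) s1E /= sE.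
by rewrite nE addrC subrK.
Qed.

Lemma hfracE c s z : (hden s).[z] != 0 -> (hnum c s).[z] / (hden s).[z] = hfrac c s z.
Proof.
elim: s => [|[c1 l] s ih]; first by rewrite /hden/= big_nil hornerC hornerE divr1.
rewrite /= -/(hden _) => h; have : (hden s).[z] != 0 /\ l - z != 0.
  by move: h; rewrite /hden big_cons hornerM mulf_eq0 negb_or/= !hornerE => /andP[].
move=> [hs hl]; rewrite hornerD hornerZ mulrDl mulfK// -ih//; congr (_ + _).
by rewrite {1}/hden big_cons -/(hden s) hornerM/= hornerD hornerN hornerC hornerX invfM mulrCA.
Qed.

Lemma ratfun_hfrac (r : ratfun R) : A_stable r -> exists a c s,
  [/\ a != 0, Defs.den r = a *: hden s, Defs.num r = a *: hnum c s &
      forall cl, cl \in s -> 0 < complex.Re cl.2].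
Proof.
move=> rA; have [ls dE] := closed_field_poly_normal (Defs.den r).
have d0 := den_neq0 r.
have l0 : lead_coef (Defs.den r) != 0 by rewrite lead_coef_eq0.
set a := lead_coef (Defs.den r) * (-1) ^+ size ls.
have a0 : a != 0 by rewrite mulf_neq0// expf_neq0// oppr_eq0 oner_neq0.
have sd : size (Defs.den r) = (size ls).+1.
  by rewrite dE size_scale// size_prod_XsubC.
have [|c [s [sE nE]]] := @hnum_exists ls (a^-1 *: Defs.num r).
  by rewrite size_scale ?invr_eq0// -sd A_stable_size.
exists a, c, s; split => //.
- rewrite {1}dE /hden -(big_map snd xpredT (fun x => x%:P - 'X)) sE /a -scalerA; congr (_ *: _).
  elim: (ls) => [|l ls' ih]; first by rewrite !big_nil scale1r.
  by rewrite !big_cons ih/= exprS mulN1r -scalerAr scaleNr -scalerN -mulNr opprB.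
- by rewrite nE scalerA divff// scale1r.
- move=> cl cls; apply: (A_stable_root rA); rewrite dE rootZ//.
  by rewrite root_prod_XsubC -sE map_f.
Qed.

End HornerFractions.

Definition hop (R : realType) (X : normedModType R[i]) (Rs : R[i] -> X -> X) c
  (s : seq (R[i] * R[i])) : X -> X :=
  foldr (fun cl f x => cl.1 *: x + Rs cl.2 (f x)) (fun x => c *: x) s.

(** * Polynomial approximation of the scalar Horner form *)

Section ScalarApproximation.
Context {R : realType}.
Implicit Types (mu z w l c : R[i]) (s : seq (R[i] * R[i])) (h : R) (L : nat).

(** Taken from (l - h B)^-1 = h^-1 (l / h - B)^-1. *)
Definition rescale h l : R[i] := (h^-1)%:C * l.

Lemma Re_rescale h l : 0 < h -> 0 < complex.Re l -> 0 < complex.Re (rescale h l).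
Proof. by move=> h0 l0; rewrite ReMr mulr_gt0// invr_gt0. Qed.

Definition hpoly h c s L : {poly R[i]} := foldr
  (fun cl v => cl.1%:P + (h^-1)%:C *: (respoly (rescale h cl.2) L * v)) c%:P s.

Lemma Re_le_sub l z : complex.Re z <= 0 -> complex.Re l <= cabs (l - z).
Proof.
move=> z0; apply: le_trans (Re_le_cabs _); rewrite ReD lerDl.
by case: z z0 => zr zi /=; rewrite oppr_ge0.
Qed.

Lemma cabs_inv_le l z : 0 < complex.Re l -> complex.Re z <= 0 ->
  cabs (l - z)^-1 <= (complex.Re l)^-1.
Proof.
move=> l0 z0; have lz := Re_le_sub l z0.
by rewrite cabsV lef_pV2 ?posrE// (lt_le_trans l0).
Qed.

Lemma respoly_horner mu L w : 0 < complex.Re mu -> cabs w <= 1 ->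
  cabs ((respoly mu L).[w] - (mu - (step L)^-1%:C * (w - 1))^-1) <=
    (complex.Re mu)^-1 * ((complex.Re mu)^-1 * step L).
Proof.
move=> mu0 w1; set z := _ * (w - 1).
have z0 : complex.Re z <= 0.
  rewrite ReMr mulr_ge0_le0 ?invr_ge0 ?(ltW (step_gt0 _))// ReD/= subr_le0.
  exact: le_trans (Re_le_cabs _) w1.
have := congr1 (horner^~ w) (respoly_id mu0 L).
rewrite hornerM !hornerD !hornerN hornerZ !hornerD !hornerN !hornerC hornerX hornerZ hornerXn -/z.
have mz : mu - z != 0 by rewrite -cabs_eq0 gt_eqF// (lt_le_trans mu0)// Re_le_sub.
move=> /(canRL (mulKf mz)) ->.
rewrite mulrBr mulr1 addrAC subrr sub0r cabsN cabsM; apply: ler_pM; rewrite ?cabs_ge0//.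
  exact: cabs_inv_le.
rewrite cabsM; apply: le_trans (cabs_restail mu0 L); rewrite ler_piMr ?cabs_ge0//.
by rewrite cabsX exprn_ile1 ?cabs_ge0.
Qed.

(** For |w| <= 1 the point (h / step L) (w - 1) lies in the closed left half-plane, where
    A-stability will bound the Horner form. The error is uniform in [w], and the bound [K] is what
    carries it through the recursion. *)
Lemma hpoly_hfrac h c s : 0 < h -> (forall cl, cl \in s -> 0 < complex.Re cl.2) ->
  exists K (eta : nat -> R), [/\ 0 <= K, eta @ \oo --> (0 : R),
    forall z, complex.Re z <= 0 -> cabs (hfrac c s z) <= K &
    forall L w, cabs w <= 1 ->
      cabs ((hpoly h c s L).[w] - hfrac c s ((h / step L)%:C * (w - 1))) <= eta L].
Proof.
move=> h0; elim: s => [|[c1 l] s ih] /= sP.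
  exists (cabs c), (fun=> 0); split=> //; rewrite ?cabs_ge0//; first exact: cvg_cst.
  by move=> L w _; rewrite hornerC subrr cabs0.
have [|K [eta [K0 eta0 leK le_eta]]] := ih.
  by move=> cl cls; apply: sP; rewrite inE cls orbT.
have l0 : 0 < complex.Re l by apply: (sP (c1, l)); rewrite inE eqxx.
set mu := rescale h l; have mu0 : 0 < complex.Re mu by exact: Re_rescale.
exists (cabs c1 + (complex.Re l)^-1 * K), (fun L => h^-1 * ((complex.Re mu)^-1 * eta L +
  (complex.Re mu)^-1 * ((complex.Re mu)^-1 * step L) * K)); split.
- by rewrite addr_ge0 ?cabs_ge0// mulr_ge0// invr_ge0 ltW.
- have e : h^-1 * ((complex.Re mu)^-1 * 0 + (complex.Re mu)^-1 * ((complex.Re mu)^-1 * 0) * K) = 0.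
    by rewrite !mulr0 mul0r addr0 mulr0.
  rewrite -[0]e; apply: cvgMr; apply: cvgD; first exact: cvgMr.
  by apply: cvgMl; apply: cvgMr; apply: cvgMr; exact: step_cvg0.
- move=> z z0; apply: le_trans (cabsD _ _) _; rewrite lerD2l cabsM.
  by apply: ler_pM; rewrite ?cabs_ge0 ?leK// cabs_inv_le.
- move=> L w w1; rewrite hornerD hornerC hornerZ hornerM [_ + _ - _]addrC opprD addrACA addNr add0r.
  set z := _ * (w - 1); set F := hfrac c s z; set f := (hpoly h c s L).[w].
  have z0 : complex.Re z <= 0.
    rewrite ReMr mulr_ge0_le0 ?divr_ge0 ?(ltW h0) ?(ltW (step_gt0 _))// ReD/= subr_le0.
    exact: le_trans (Re_le_cabs _) w1.
  set r := (respoly mu L).[w]; set g := (mu - (step L)^-1%:C * (w - 1))^-1.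
  have gE : (l - z)^-1 = (h^-1)%:C * g.
    rewrite /g fmorphV/= -invfM; congr _^-1; rewrite mulrBr /mu /rescale !mulrA -!rmorphM/=.
    by rewrite divff ?mul1r// gt_eqF.
  have -> : - ((l - z)^-1 * F) + (h^-1)%:C * (r * f) = (h^-1)%:C * (r * (f - F) + (r - g) * F).
    by rewrite gE; ring.
  rewrite cabsM cabs_real gtr0_norm ?invr_gt0// ler_wpM2l ?invr_ge0 ?(ltW h0)//.
  apply: le_trans (cabsD _ _) _; rewrite !cabsM; apply: lerD; apply: ler_pM; rewrite ?cabs_ge0//.
  - exact: cabs_respoly.
  - exact: le_eta.
  - exact: respoly_horner.
  - exact: leK.
Qed.

End ScalarApproximation.

(** * Passage to operators and stability of the iterates *)

Section OperatorApproximation.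
Context {R : realType} {X : completeNormedModType R[i]}.
Variables (T : R -> {linear X -> X}) (M : R).
Hypothesis TC0 : C0_semigroup T.
Hypothesis M0 : 0 <= M.
Hypothesis leT : forall t x, 0 <= t -> rnorm (T t x) <= M * rnorm x.
Implicit Types (x y b w : X) (mu l c : R[i]) (s : seq (R[i] * R[i])) (h : R) (L n : nat).

Let W L := dyadic T L.

Lemma cvg_pol (a : nat -> {poly R[i]}) K (Q : X -> X) (u : nat -> X) y : 0 <= K ->
  (forall L x, rnorm (pol (W L) (a L) x) <= K * rnorm x) ->
  (forall x, pol (W L) (a L) x @[L --> \oo] --> Q x) ->
  u @ \oo --> y -> pol (W L) (a L) (u L) @[L --> \oo] --> Q y.
Proof.
move=> K0 aK aQ uy.
apply: (@squeeze_rnorm _ _ _ _ (fun L => K * rnorm (u L - y) + rnorm (pol (W L) (a L) y - Q y))).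
  move=> L; apply: le_trans (rdist_triangle (pol (W L) (a L) y) _ _) _.
  by rewrite lerD2r -[- pol _ _ _]scaleN1r -polZ -polD scaleN1r.
have -> : 0 = K * 0 + 0 :> R by rewrite mulr0 addr0.
by apply: cvgD; [apply: cvgMr|]; apply/cvg_rnorm.
Qed.

Definition hres h l x := (h^-1)%:C *: resolvent T (rescale h l) x.

Lemma hpoly_hop h c s : 0 < h -> (forall cl, cl \in s -> 0 < complex.Re cl.2) ->
  exists K, [/\ 0 <= K, forall L x, rnorm (pol (W L) (hpoly h c s L) x) <= K * rnorm x &
    forall x, pol (W L) (hpoly h c s L) x @[L --> \oo] --> hop (hres h) c s x].
Proof.
move=> h0; elim: s => [|[c1 l] s ih] /= sP.
  exists (cabs c); split=> [|L x|x]; first exact: cabs_ge0.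
    by rewrite (polC (dyadic0 TC0 L)) rnormZ.
  by under eq_fun do rewrite (polC (dyadic0 TC0 _)); exact: cvg_cst.
have [|K [K0 leK cvgK]] := ih.
  by move=> cl cls; apply: sP; rewrite inE cls orbT.
have l0 : 0 < complex.Re l by apply: (sP (c1, l)); rewrite inE eqxx.
set mu := rescale h l; have mu0 : 0 < complex.Re mu by exact: Re_rescale.
have E L x : pol (W L) (c1%:P + (h^-1)%:C *: (respoly mu L * hpoly h c s L)) x =
    c1 *: x + (h^-1)%:C *: pol (W L) (respoly mu L) (pol (W L) (hpoly h c s L) x).
  by rewrite polDl (polC (dyadic0 TC0 L)) polZl (polM (dyadic0 TC0 L) (dyadicD TC0 L)).
have a0 : 0 <= M / complex.Re mu by rewrite divr_ge0// ltW.
exists (cabs c1 + h^-1 * (M / complex.Re mu * K)); split.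
- by rewrite addr_ge0 ?cabs_ge0// mulr_ge0 ?invr_ge0 ?(ltW h0)// mulr_ge0.
- move=> L x; rewrite E; apply: le_trans (rnormD _ _) _.
  rewrite [leRHS]mulrDl; apply: lerD; first by rewrite rnormZ.
  rewrite rnormZr gtr0_norm ?invr_gt0//.
  rewrite -[leRHS]mulrA ler_wpM2l ?invr_ge0 ?(ltW h0)//.
  have := rnorm_res_approx M0 leT L (pol (W L) (hpoly h c s L) x) mu0.
  move=> /le_trans; apply; rewrite -[leRHS]mulrA.
  by rewrite ler_wpM2l.
- move=> x; under eq_fun do rewrite E.
  apply: cvgD; first exact: cvg_cst.
  apply: cvgZr; apply: (cvg_pol (Q := resolvent T mu) a0) (cvgK x) => [L y|y].
    exact: (rnorm_res_approx M0 leT).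
  exact: (cvg_res_approx TC0 M0 leT (x := y) mu0).
Qed.

Lemma iter_hpoly_hop h c s n x : 0 < h -> (forall cl, cl \in s -> 0 < complex.Re cl.2) ->
  pol (W L) (hpoly h c s L ^+ n) x @[L --> \oo] --> iter n (hop (hres h) c s) x.
Proof.
move=> h0 sP; have [K [K0 leK cvgK]] := hpoly_hop c h0 sP.
elim: n => [|n ih].
  by under eq_fun do rewrite expr0 (pol1 (dyadic0 TC0 _)); exact: cvg_cst.
under eq_fun do rewrite exprS (polM (dyadic0 TC0 _) (dyadicD TC0 _)).
exact: (cvg_pol K0 leK cvgK ih).
Qed.

Variables (A : operator X) (theta C : R).
Hypothesis C0 : 0 <= C.
Hypothesis stable : forall L (a : {poly R[i]}) y,
  (forall z, cabs z = 1 -> cabs a.[z] <= 1) -> rnorm (pol (W L) a y) <=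
    C * \sum_(l < L.+1) (2 ^ l)%:R `^ theta * K_functional A (2 ^ l)%:R^-1 y.

Lemma hop_stability h c s n x S : 0 < h -> (forall cl, cl \in s -> 0 < complex.Re cl.2) ->
  (forall z, complex.Re z <= 0 -> cabs (hfrac c s z) <= 1) ->
  (forall L, \sum_(l < L) (2 ^ l)%:R `^ theta * K_functional A (2 ^ l)%:R^-1 x <= S) ->
  rnorm (iter n (hop (hres h) c s) x) <= C * S.
Proof.
move=> h0 sP F1 xS; have [_ [eta [_ eta0 _ le_eta]]] := hpoly_hfrac c h0 sP.
have e0 L : 0 <= eta L by apply: le_trans (cabs_ge0 _) (le_eta L 0 _); rewrite cabs0.
have lim : (1 + eta L) ^+ n * (C * S) @[L --> \oo] --> (1 + 0) ^+ n * (C * S).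
  apply: cvgMl; elim: (n) => [|m ih]; first by under eq_fun do rewrite expr0; exact: cvg_cst.
  under eq_fun do rewrite exprS; rewrite exprS; apply: cvgM => //.
  by apply: cvgD => //; exact: cvg_cst.
rewrite addr0 expr1n mul1r in lim.
apply: rnorm_lim_le (iter_hpoly_hop (c := c) (n := n) (x := x) h0 sP) lim => L.
have p0 : 0 < 1 + eta L by rewrite ltr_pwDl.
rewrite -ler_pdivrMl ?exprn_gt0//.
(* Division by (1 + eta L)^n brings the polynomial below 1 on the unit circle. As n is fixed while L
   grows, the factor tends to 1 and leaves a bound uniform in [h] and [n]. *)
set d := ((1 + eta L) ^+ n)^-1; have d0 : 0 < d by rewrite invr_gt0 exprn_gt0.
have -> : d * rnorm (pol (W L) (hpoly h c s L ^+ n) x) =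
    rnorm (pol (W L) (d%:C *: hpoly h c s L ^+ n) x) by rewrite polZl rnormZr gtr0_norm.
apply: (@le_trans _ _ _ _ _ (@stable L _ x _)); last by rewrite ler_wpM2l.
move=> z z1; rewrite hornerZ horner_exp cabsM cabs_real gtr0_norm// cabsX.
rewrite mulrC ler_pdivrMr ?exprn_gt0// mul1r lerXn2r ?nnegrE ?cabs_ge0 ?(ltW p0)//.
have zl : cabs z <= 1 by rewrite z1.
rewrite -[(hpoly _ _ _ _).[z]](subrK (hfrac c s ((h / step L)%:C * (z - 1)))) [leRHS]addrC.
apply: le_trans (cabsD _ _) _; apply: lerD; first exact: le_eta.
apply: F1; rewrite ReMr mulr_ge0_le0 ?divr_ge0 ?(ltW h0) ?(ltW (step_gt0 _))// ReD/= subr_le0.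
exact: le_trans (Re_le_cabs _) zl.
Qed.

End OperatorApproximation.

(** * Rational functions of an unbounded operator *)

Section RationalOperators.
Context {R : realType} {X : normedModType R[i]}.
Variables (B : operator X) (Rs : R[i] -> X -> X).
Hypothesis B_lin : forall a u v, dom B u -> dom B v ->
  dom B (a *: u - v) /\ B (a *: u - v) = a *: B u - B v.
Implicit Types (x u v y : X) (l c a : R[i]) (s : seq (R[i] * R[i])) (p : {poly R[i]}).

Let D m u := forall i, (i < m)%N -> dom B (iter i B u).

Let DS m u : D m.+1 u -> dom B u /\ D m (B u).
Proof.
by move=> h; split=> [|i im]; [exact: (h 0%N)|rewrite -iterSr; exact: h].
Qed.

Let iter_lin m a u v : D m u -> D m v -> D m (a *: u - v) /\
  forall i, (i <= m)%N -> iter i B (a *: u - v) = a *: iter i B u - iter i B v.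
Proof.
move=> Du Dv; suff h i : (i <= m)%N -> iter i B (a *: u - v) = a *: iter i B u - iter i B v.
  split=> // i im; rewrite h ?(ltnW im)//.
  by have [] := B_lin a (Du i im) (Dv i im).
elim: i => [//|i ih] im; rewrite !iterS ih ?(ltnW im)//.
by have [] := B_lin a (Du i im) (Dv i im).
Qed.

Lemma poly_op_widen m p u : (size p <= m)%N ->
  poly_op p B u = \sum_(i < m) p`_i *: iter i B u.
Proof.
move=> pm; rewrite -(subnKC pm) big_split_ord/= [X in _ + X]big1 ?addr0// => k _.
by rewrite nth_default ?scale0r// leq_addr.
Qed.

Lemma poly_opD p p' u : poly_op (p + p') B u = poly_op p B u + poly_op p' B u.
Proof.
rewrite (poly_op_widen _ (size_polyD p p')).
rewrite (poly_op_widen _ (leq_maxl (size p) (size p'))).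
rewrite (poly_op_widen _ (leq_maxr (size p) (size p'))).
by rewrite -big_split/=; apply: eq_bigr => k _; rewrite coefD scalerDl.
Qed.

Lemma poly_opZ a p u : poly_op (a *: p) B u = a *: poly_op p B u.
Proof.
rewrite (poly_op_widen _ (size_scale_leq a p)) scaler_sumr.
by apply: eq_bigr => k _; rewrite coefZ scalerA.
Qed.

Let poly_op_factor l p m u : (size p <= m.+1)%N -> D m.+1 u ->
  poly_op ((l%:P - 'X) * p) B u = poly_op p B (l *: u - B u).
Proof.
move=> pm Du; rewrite mulrBl mul_polyC mulrC -scaleN1r poly_opD !poly_opZ.
have sX : (size (p * 'X)%R <= m.+2)%N.
  by apply: leq_trans (size_polyMleq _ _) _; rewrite size_polyX addn2 ltnS.
have -> : poly_op (p * 'X) B u = \sum_(i < m.+1) p`_i *: iter i.+1 B u.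
  rewrite (poly_op_widen u sX) big_ord_recl coefMX eqxx scale0r add0r.
  by apply: eq_bigr => i _; rewrite coefMX.
rewrite !(poly_op_widen _ pm) scaleN1r scaler_sumr -sumrB; apply: eq_bigr => i _.
have [_ DBu] := DS Du; have Dmu : D m u by move=> j jm; apply: Du; exact: ltnW.
have [_ ->] := iter_lin l Dmu DBu; last by rewrite -ltnS.
by rewrite scalerBr !scalerA mulrC -iterSr.
Qed.

Hypothesis RsP : forall l a x y, 0 < complex.Re l -> Rs l (a *: x - y) = a *: Rs l x - Rs l y.
Hypothesis dom_Rs : forall l x, 0 < complex.Re l -> dom B (Rs l x).
Hypothesis B_Rs : forall l x, 0 < complex.Re l -> B (Rs l x) = l *: Rs l x - x.
Hypothesis Rs_B : forall l u, 0 < complex.Re l -> dom B u -> Rs l (l *: u - B u) = u.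

Let Rs_lin l a x y : 0 < complex.Re l -> Rs l (a *: x + y) = a *: Rs l x + Rs l y.
Proof.
by move=> l0; rewrite -{1}[y]opprK RsP// -[- y]add0r -(scale0r 0) RsP// scale0r sub0r opprK.
Qed.

Let Rs0 l : 0 < complex.Re l -> Rs l 0 = 0.
Proof. by move=> l0; rewrite -[X in Rs l X](subrr 0) -{1}(scale1r 0) RsP// scale1r subrr. Qed.

Lemma Rs_comm l v : 0 < complex.Re l -> dom B v -> B (Rs l v) = Rs l (B v).
Proof.
by move=> l0 Bv; rewrite B_Rs// -{2}(Rs_B l0 Bv) RsP// opprB addrCA subrr addr0.
Qed.

Let iter_Rs m l v : 0 < complex.Re l -> D m v ->
  forall i, (i <= m)%N -> iter i B (Rs l v) = Rs l (iter i B v).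
Proof.
move=> l0 Dv; elim=> [//|i ih] im.
by rewrite !iterS ih ?(ltnW im)// Rs_comm//; exact: Dv.
Qed.

Let D_Rs m l v : 0 < complex.Re l -> D m v -> D m.+1 (Rs l v).
Proof. by move=> l0 Dv i im; rewrite (iter_Rs l0 Dv)//; exact: dom_Rs. Qed.

Let poly_op_Rs m l p v : 0 < complex.Re l -> (size p <= m.+1)%N -> D m v ->
  poly_op p B (Rs l v) = Rs l (poly_op p B v).
Proof.
move=> l0 pm Dv; rewrite !(poly_op_widen _ pm).
have RsS n (f : nat -> R[i]) (g : nat -> X) :
    Rs l (\sum_(i < n) f i *: g i) = \sum_(i < n) f i *: Rs l (g i).
  elim: n => [|n ih]; first by rewrite !big_ord0 Rs0.
  by rewrite !big_ord_recr/= addrC Rs_lin// ih addrC.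
rewrite (RsS _ (fun i => p`_i) (fun i => iter i B v)); apply: eq_bigr => i _.
by rewrite (iter_Rs l0 Dv)// -ltnS.
Qed.

Let Q s x := foldr (fun cl y => Rs cl.2 y) x s.

Let Q_cons cl s x : Q (cl :: s) x = Rs cl.2 (Q s x). Proof. by []. Qed.

Let right s := forall cl, cl \in s -> 0 < complex.Re cl.2.

Let rightS cl s : right (cl :: s) -> 0 < complex.Re cl.2 /\ right s.
Proof.
move=> h; split=> [|cl' cls]; first by apply: h; rewrite inE eqxx.
by apply: h; rewrite inE cls orbT.
Qed.

Let D_Q s x : right s -> D (size s) (Q s x).
Proof.
elim: s => [|cl s ih] h; first by move=> i; rewrite ltn0.
by have [l0 hs] := rightS h; apply: D_Rs => //; exact: ih.
Qed.

Let hden_cons cl s : hden (cl :: s) = (cl.2%:P - 'X) * hden s.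
Proof. by rewrite /hden big_cons. Qed.

Let poly_op1 u : poly_op 1 B u = u.
Proof. by rewrite (@poly_op_widen 1) ?size_poly1// big_ord1 coef1 scale1r. Qed.

Let hden_Q s x : right s -> poly_op (hden s) B (Q s x) = x.
Proof.
elim: s => [|cl s ih] h; first by rewrite /hden big_nil poly_op1.
have [l0 hs] := rightS h; rewrite hden_cons (@poly_op_factor _ _ (size s)) ?size_hden//.
  by rewrite Q_cons B_Rs// opprB addrCA subrr addr0 ih.
exact: (D_Q _ h).
Qed.

Let Q_hden s u : right s -> D (size s) u -> Q s (poly_op (hden s) B u) = u.
Proof.
elim: s u => [|cl s ih] u h Du; first by rewrite /hden big_nil poly_op1.
have [l0 hs] := rightS h; rewrite hden_cons (@poly_op_factor _ _ (size s)) ?size_hden//.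
have [Bu DBu] := DS Du.
have Du' : D (size s) u by move=> i im; apply: Du; exact: ltnW.
have [DB _] := iter_lin cl.2 Du' DBu.
by rewrite /= ih// Rs_B.
Qed.

Let size_hnum c s : (size (hnum c s) <= (size s).+1)%N.
Proof.
elim: s => [|cl s ih] /=; first exact: size_polyC_leq1.
apply: leq_trans (size_polyD _ _) _; rewrite geq_max.
rewrite (leq_trans (size_scale_leq _ _)) ?size_hden//=.
exact: leq_trans ih _.
Qed.

Let hnum_Q c s x : right s -> poly_op (hnum c s) B (Q s x) = hop Rs c s x.
Proof.
elim: s => [|cl s ih] h.
  by rewrite (poly_op_widen _ (size_polyC_leq1 c)) big_ord1 coefC.
have [l0 hs] := rightS h.
have -> : hnum c (cl :: s) = cl.1 *: hden (cl :: s) + hnum c s by [].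
rewrite poly_opD poly_opZ hden_Q// Q_cons (@poly_op_Rs (size s))//; last exact: D_Q.
by rewrite ih.
Qed.

Let hopZ a c s x : right s -> hop Rs c s (a *: x) = a *: hop Rs c s x.
Proof.
elim: s => [|cl s ih] h /=; first by rewrite scalerA mulrC -scalerA.
have [l0 hs] := rightS h; rewrite ih// -[X in Rs _ X]addr0 Rs_lin// Rs0// addr0.
by rewrite scalerDr !scalerA mulrC.
Qed.

(** The product [Q s] of resolvents is a two-sided inverse of [hden s] at [B] on the domain of the
    corresponding power, because [B] commutes with its resolvents. Hence the preimage used by
    [ratfun_op] exists and is unique. *)
Lemma ratfun_op_hop (r : ratfun R) a c s x : a != 0 ->
  Defs.den r = a *: hden s -> Defs.num r = a *: hnum c s ->
  (forall cl, cl \in s -> 0 < complex.Re cl.2) -> ratfun_op r B x = hop Rs c s x.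
Proof.
move=> a0 dE nE h; have sd : (size (Defs.den r)).-1 = size s.
  by rewrite dE size_scale// size_hden.
have sn : ((size (Defs.num r)).-1 <= size s)%N.
  by rewrite nE size_scale// -subn1 leq_subLR add1n size_hnum.
have DQ y : D (size s) (Q s y) by exact: D_Q.
have numE y : poly_op (Defs.num r) B (Q s (a^-1 *: y)) = hop Rs c s y.
  by rewrite nE poly_opZ hnum_Q// hopZ// scalerA divff// scale1r.
apply: xget_unique => [|y [u [Du <- _ <-]]].
  exists (Q s (a^-1 *: x)); split.
  - by move=> i; rewrite sd; exact: DQ.
  - by rewrite dE poly_opZ hden_Q// scalerA divff// scale1r.
  - by move=> i im; apply: DQ; exact: leq_trans im sn.
  - exact: numE.
rewrite -numE dE poly_opZ scalerA mulVf// scale1r Q_hden//.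
by move=> i im; apply: Du; rewrite sd.
Qed.

End RationalOperators.

(** * Taylor expansion at 0 and consistency *)

(** The derivative of [hfrac c s] at 0, by the product rule in each Horner step; [hrem] collects a
    bound for the second-order remainder. *)
Fixpoint hder (R : realType) (c : R[i]) (s : seq (R[i] * R[i])) : R[i] :=
  if s is cl :: s' then cl.2^-1 * hder c s' + cl.2^-1 ^+ 2 * hfrac c s' 0 else 0.

Fixpoint hrem (R : realType) (M : R) (c : R[i]) (s : seq (R[i] * R[i])) : R :=
  if s is cl :: s' then
    (cabs (cl.2^-1 ^+ 2 * hfrac c s' 0 + cl.2^-1 * hder c s') + hrem M c s') *
    (M / complex.Re cl.2)
  else 0.

Lemma hrem_ge0 (R : realType) (M : R) c s : 0 <= M ->
  (forall cl, cl \in s -> 0 < complex.Re cl.2) -> 0 <= hrem M c s.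
Proof.
move=> M0; elim: s => [//|cl s ih] h /=.
rewrite mulr_ge0 ?addr_ge0 ?cabs_ge0 ?ih// => [cl' cls|].
  by apply: h; rewrite inE cls orbT.
by rewrite divr_ge0// ltW// h// inE eqxx.
Qed.

Lemma regroup (V : zmodType) (c e p q q' t t' : V) :
  c + (p + q + t + (q' + t' + e)) - (c + p + (q' + q)) = t + t' + e.
Proof.
apply/eqP; rewrite subr_eq !addrA; apply/eqP.
by rewrite [LHS](ACl (4*6*7*1*2*5*3)).
Qed.

(** The vectors [v1] and [v2] stand for hB v and (hB)^2 v. The abstract form covers resolvents of
    the generator, for the local error, and scalar multipliers, which identify [hder]. *)
Lemma hop_expansion (R : realType) (X : normedModType R[i]) (Rs : R[i] -> X -> X) (M : R)
    (v v1 v2 : X) c s : 0 <= M ->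
  (forall l a x y, 0 < complex.Re l -> Rs l (a *: x - y) = a *: Rs l x - Rs l y) ->
  (forall l x, 0 < complex.Re l -> rnorm (Rs l x) <= M / complex.Re l * rnorm x) ->
  (forall l, 0 < complex.Re l -> l *: Rs l v = v + Rs l v1) ->
  (forall l, 0 < complex.Re l -> l *: Rs l v1 = v1 + Rs l v2) ->
  (forall cl, cl \in s -> 0 < complex.Re cl.2) ->
  rnorm (hop Rs c s v - (hfrac c s 0 *: v + hder c s *: v1)) <= hrem M c s * rnorm v2.
Proof.
move=> M0 RsP leR Rv Rv1; elim: s => [|[c1 l] s ih] h.
  by rewrite /= scale0r addr0 subrr rnorm0 mul0r.
have l0 : 0 < complex.Re l by apply: (h (c1, l)); rewrite inE eqxx.
have ln0 : l != 0 by apply: contraTneq l0 => ->; rewrite /= ltxx.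
have hs cl : cl \in s -> 0 < complex.Re cl.2 by move=> cls; apply: h; rewrite inE cls orbT.
have Rv1E : Rs l v1 = l^-1 *: v1 + l^-1 *: Rs l v2.
  by rewrite -scalerDr -Rv1// scalerA mulVf// scale1r.
have RvE : Rs l v = l^-1 *: v + l^-1 ^+ 2 *: v1 + l^-1 ^+ 2 *: Rs l v2.
  have -> : Rs l v = l^-1 *: (v + Rs l v1) by rewrite -Rv// scalerA mulVf// scale1r.
  by rewrite Rv1E !scalerDr !scalerA -expr2 addrA.
have Rs0 : Rs l 0 = 0 by rewrite -[X in Rs l X](subrr 0) -{1}(scale1r 0) RsP// scale1r subrr.
have RsN y : Rs l (- y) = - Rs l y by rewrite -sub0r -(scale0r 0) RsP// scale0r sub0r.
have RsL a x y : Rs l (a *: x + y) = a *: Rs l x + Rs l y by rewrite -{1}[y]opprK RsP// RsN opprK.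
have Lip : rnorm (Rs l v2) <= M / complex.Re l * rnorm v2 by exact: leR.
have := ih hs; set E := (hop Rs c s v - _) => leE.
have FE : hop Rs c s v = hfrac c s 0 *: v + (hder c s *: v1 + E).
  by rewrite addrA /E addrC subrK.
have -> : hop Rs c ((c1, l) :: s) v - (hfrac c ((c1, l) :: s) 0 *: v + hder c ((c1, l) :: s) *: v1)
    = (l^-1 ^+ 2 * hfrac c s 0 + l^-1 * hder c s) *: Rs l v2 + Rs l E.
  rewrite /= FE !RsL RvE Rv1E subr0 !scalerDr !scalerA !scalerDl.
  rewrite ![hder c s * _]mulrC ![hfrac c s 0 * _]mulrC; exact: regroup.
apply: le_trans (rnormD _ _) _; rewrite rnormZ /= mulrDl mulrDl; apply: lerD.
  by rewrite -mulrA ler_wpM2l ?cabs_ge0.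
apply: le_trans (leR _ _ l0) _; rewrite -[leRHS]mulrA [leRHS]mulrCA.
by rewrite ler_wpM2l// divr_ge0// ltW.
Qed.

(** On the negative real axis r(-t) is 1 - t [hder] and exp(-t) is 1 - t, both up to O(t^2);
    dividing their difference by t and letting t tend to 0 gives the derivative. *)
Lemma exp_approximation_hder (R : realType) (r : ratfun R) k a c s :
  A_stable r -> exp_approximation r k -> (0 < k)%N -> a != 0 ->
  Defs.den r = a *: hden s -> Defs.num r = a *: hnum c s ->
  (forall cl, cl \in s -> 0 < complex.Re cl.2) -> hfrac c s 0 = 1 /\ hder c s = 1.
Proof.
move=> rA [C [C0 rC]] k0 a0 dE nE h.
have F_r z : (Defs.den r).[z] != 0 -> r z = hfrac c s z.
  rewrite /ratfun_eval dE nE !hornerZ mulf_eq0 negb_or => /andP[_ hz].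
  by rewrite -hfracE// invfM mulrACA divff// mul1r.
have [e0 e00 he] : exists2 e : R, 0 < e & forall t : R, 0 <= t -> t < e ->
    cabs (r (- t%:C) - (expR (- t))%:C) <= C * t ^+ k.+1.
  move: rC => /nbhs_ballP[e /= e0 he].
  have eE : e = (complex.Re e)%:C by rewrite RRe_real// gtr0_real.
  exists (complex.Re e); first by rewrite -ltcR -eE.
  move=> t t0 te; have := he (- t%:C).
  rewrite -ball_normE/= sub0r opprK !cabsE cabsN cabs_real ger0_norm// {1}eE ltcR => /(_ te).
  rewrite -rmorphXn -rmorphM lecR.
  have -> : cexp (- t%:C) = (expR (- t))%:C by rewrite /cexp/= oppr0 cos0 sin0 mulr1.
  exact.
have d0 z : complex.Re z <= 0 -> (Defs.den r).[z] != 0.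
  by move=> z0; apply/negP => /(A_stable_root rA); rewrite ltNge z0.
have re t : 0 <= t -> t < e0 -> cabs (hfrac c s (- t%:C) - (expR (- t))%:C) <= C * t ^+ k.+1.
  move=> t0 te; rewrite -F_r; first exact: he.
  by apply: d0; rewrite /= oppr_le0.
have F0 : hfrac c s 0 = 1.
  have z0 : - (0 : R)%:C = 0 :> R[i] by rewrite rmorph0 oppr0.
  have := re 0 (lexx _) e00; rewrite z0 oppr0 expR0 expr0n/= mulr0 => h0.
  have : cabs (hfrac c s 0 - 1) == 0 by rewrite eq_le cabs_ge0 andbT.
  by rewrite cabs_eq0 subr_eq0 => /eqP.
split=> //; set b := hder c s; set K := hrem 1 c s.
have Kt t : 0 <= t -> cabs (hfrac c s (- t%:C) - (1 - t%:C * b)) <= K * t ^+ 2.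
  move=> t0; set z := - t%:C; have z0 : complex.Re z <= 0 by rewrite /= oppr_le0.
  (* With one-dimensional [X] and generator z, the operator expansion becomes the Taylor expansion
     of [hfrac c s]. *)
  pose Rs (l x : R[i]^o) : R[i]^o := (l - z)^-1 * x.
  have lz l : 0 < complex.Re l -> l - z != 0.
    by move=> l0; rewrite -cabs_eq0 gt_eqF// (lt_le_trans l0)// Re_le_sub.
  have hopE s' : hop Rs c s' 1 = hfrac c s' z.
    by elim: s' => [|cl s' ih] /=; rewrite ?ih -[_ *: 1]/(_ * 1) mulr1.
  have RsE l v : 0 < complex.Re l -> l *: Rs l v = v + Rs l (z * v).
    move=> l0; apply: (mulfI (lz l l0)).
    by rewrite /Rs mulrDr !mulVKf ?lz// -[l *: _]/(l * _) mulrCA mulVKf ?lz//; ring.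
  have rE (v : R[i]^o) : rnorm v = cabs v by [].
  have := @hop_expansion _ R[i]^o Rs 1 1 (z * 1) (z * (z * 1)) c s ler01.
  rewrite hopE F0 -/b -/K => /(_ _ _ _ _ h)/wrap[].
  - by move=> l a' x y _; rewrite /Rs mulrBr -[a' *: x]/(a' * x) mulrCA.
  - move=> l x l0; rewrite !rE /Rs cabsM div1r ler_wpM2r ?cabs_ge0//.
    exact: cabs_inv_le.
  - by move=> l; exact: RsE.
  - by move=> l; exact: RsE.
  rewrite !rE -[1 *: 1]/(1 * 1) -[b *: _]/(b * _) !mulr1 cabsM cabsN cabs_real ger0_norm//.
  rewrite -expr2 => /(le_trans _); apply; rewrite le_eqVlt; apply/orP; left; apply/eqP.
  by congr cabs; rewrite /z; ring.
apply/eqP; rewrite -subr_eq0 -cabs_eq0 eq_le cabs_ge0 andbT.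
apply/ler_addgt0Pr => e ep; rewrite add0r.
have D0 : 0 <= K + 1 + C by rewrite !addr_ge0// hrem_ge0.
(* The three bounds keep [t] within range of the order condition, give t^(k + 1) <= t^2 as 0 < k,
   and make the total error at most [e]. *)
pose t := Num.min (Num.min (e0 / 2) 1) (e / (K + 1 + C + 1)).
have t0 : 0 < t by rewrite !lt_min ltr01 !divr_gt0// ltr_wpDl.
have te0 : t < e0.
  apply: (@le_lt_trans _ _ (e0 / 2)); last by rewrite ltr_pdivrMr// mulr_natr mulr2n ltrDl.
  by rewrite /t ge_min ge_min lexx.
have t1 : t <= 1 by rewrite /t ge_min ge_min lexx orbT.
have te : t * (K + 1 + C) <= e.
  have : t <= e / (K + 1 + C + 1) by rewrite /t ge_min lexx orbT.
  rewrite ler_pdivlMr ?ltr_wpDl// => /(le_trans _); apply.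
  by rewrite ler_wpM2l ?(ltW t0)// lerDl.
apply: le_trans te.
rewrite -(ler_pM2l t0).
have -> : t * cabs (b - 1) = cabs ((1 - t%:C * b) - (1 - t%:C)).
  have -> : 1 - t%:C * b - (1 - t%:C) = - (t%:C * (b - 1)) by ring.
  by rewrite cabsN cabsM cabs_real gtr0_norm.
have ex : cabs ((expR (- t))%:C - (1 - t%:C)) <= t ^+ 2.
  have -> : (expR (- t))%:C - (1 - t%:C) = (expR (- t) - (1 - t))%:C by rewrite !rmorphB.
  rewrite cabs_real ger0_norm ?subr_ge0; last by have := expR_ge1Dx (- t).
  have e1 := expR_ge1Dx t; have e2 : 0 < 1 + t by rewrite addr_gt0.
  rewrite expRN lerBlDr; apply: (@le_trans _ _ (1 + t)^-1).
    by rewrite lef_pV2 ?posrE ?expR_gt0.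
  rewrite -div1r ler_pdivrMr//.
  have -> : (t ^+ 2 + (1 - t)) * (1 + t) = 1 + t ^+ 3 by ring.
  by rewrite lerDl exprn_ge0// ltW.
have -> : 1 - t%:C * b - (1 - t%:C) = - (hfrac c s (- t%:C) - (1 - t%:C * b)) +
    ((hfrac c s (- t%:C) - (expR (- t))%:C) + ((expR (- t))%:C - (1 - t%:C))) by ring.
apply: le_trans (cabsD _ _) _; rewrite cabsN.
apply: le_trans (lerD (Kt t (ltW t0)) (cabsD _ _)) _.
apply: le_trans (lerD (lexx _) (lerD (re t (ltW t0) te0) ex)) _.
have -> : t * (t * (K + 1 + C)) = K * t ^+ 2 + (C * t ^+ 2 + t ^+ 2) by ring.
by rewrite lerD2l lerD2r ler_wpM2l// ler_wiXn2l ?(ltW t0)// ltnS.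
Qed.

(** * Resolvents of the scaled generator *)

Section Resolvents.
Context {R : realType} {X : completeNormedModType R[i]}.
Variables (T : R -> {linear X -> X}) (M : R).
Hypothesis TC0 : C0_semigroup T.
Hypothesis M0 : 0 <= M.
Hypothesis leT : forall t x, 0 <= t -> rnorm (T t x) <= M * rnorm x.
Variables (h : R) (h0 : 0 < h).
Implicit Types (x y b w : X) (l c a : R[i]).

Let hVh : (h^-1)%:C * h%:C = 1 :> R[i].
Proof. by rewrite -rmorphM/= mulVf// gt_eqF. Qed.

Lemma gen_scale a b w : gen T b w -> gen T (a *: b) (a *: w).
Proof.
move=> bw; have g0 := gen_lin (c := -1) bw bw; rewrite !scaleN1r !addNr in g0.
by have := gen_lin (c := a) bw g0; rewrite !addr0.
Qed.

Lemma genB b w b' w' : gen T b w -> gen T b' w' -> gen T (b - b') (w - w').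
Proof.
move=> g g'; rewrite [b - b']addrC [w - w']addrC -[- b']scaleN1r -[- w']scaleN1r.
exact: gen_lin.
Qed.

Lemma hresP l a x y : 0 < complex.Re l ->
  hres T h l (a *: x - y) = a *: hres T h l x - hres T h l y.
Proof.
move=> /(Re_rescale h0) l0.
have R0 : resolvent T (rescale h l) 0 = 0.
  by have := resolventP TC0 M0 leT (-1) 0 0 l0; rewrite scaler0 addr0 scaleN1r addNr.
have -> : a *: x - y = -1 *: y + (a *: x + 0) by rewrite addr0 scaleN1r addrC.
rewrite /hres !(resolventP TC0 M0 leT)// R0 addr0 scaleN1r addrC scalerBr.
by rewrite scalerA mulrC -scalerA.
Qed.

Lemma hres0 l : 0 < complex.Re l -> hres T h l 0 = 0.
Proof.
by move=> l0; rewrite -[X in hres _ _ _ X](subrr 0) -{1}(scale1r 0) hresP// scale1r subrr.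
Qed.

Lemma hresZ l a x : 0 < complex.Re l -> hres T h l (a *: x) = a *: hres T h l x.
Proof. by move=> l0; rewrite -[X in hres _ _ _ X]subr0 hresP// hres0// subr0. Qed.

Lemma rnorm_hres l x : 0 < complex.Re l -> rnorm (hres T h l x) <= M / complex.Re l * rnorm x.
Proof.
move=> l0; rewrite /hres rnormZr gtr0_norm ?invr_gt0// ler_pdivrMl//.
apply: le_trans (rnorm_resolvent TC0 M0 leT x (Re_rescale h0 l0)) _.
rewrite ReMr invfM invrK le_eqVlt; apply/orP; left; apply/eqP; ring.
Qed.

Lemma gen_hres x l : 0 < complex.Re l ->
  gen T (hres T h l x) ((h^-1)%:C *: (l *: hres T h l x - x)).
Proof.
move=> l0; have := gen_resolvent TC0 M0 leT (x := x) (Re_rescale h0 l0).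
by move=> /(gen_scale (a := (h^-1)%:C)); rewrite [l *: hres _ _ _ _]scalerA mulrC.
Qed.

Lemma hres_gen l b w : 0 < complex.Re l -> gen T b w ->
  hres T h l (l *: b - h%:C *: w) = b.
Proof.
move=> l0 bw; have E := resolvent_gen TC0 M0 leT (Re_rescale h0 l0) bw.
have -> : l *: b - h%:C *: w = h%:C *: (rescale h l *: b - w).
  by rewrite scalerBr scalerA /rescale mulrA [_%:C * _%:C]mulrC hVh mul1r.
by rewrite hresZ// /hres E scalerA mulrC hVh scale1r.
Qed.

Lemma hres_T l t x : 0 < complex.Re l -> 0 <= t -> hres T h l (T t x) = T t (hres T h l x).
Proof.
by move=> l0 t0; rewrite /hres (resolvent_T TC0 M0 leT) ?Re_rescale// linearZ.
Qed.

Lemma gen_hres2 l b w : 0 < complex.Re l -> gen T b w ->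
  gen T (hres T h l b) (hres T h l w).
Proof.
move=> l0 bw; have := gen_hres (x := b) l0.
have : h%:C *: hres T h l w = l *: hres T h l b - b.
  by rewrite -{2}(hres_gen l0 bw) hresP// hresZ// opprB addrCA subrr addr0.
by move=> <-; rewrite scalerA hVh scale1r.
Qed.

End Resolvents.

Lemma sub_shift (V : zmodType) (a b z w : V) : a - b = a - (z + w) - (b - z - w).
Proof. by rewrite -(addrA b) -opprD opprB addrA subrK. Qed.

Lemma powR_pow2 (R : realType) (theta : R) l : (2 ^ l)%:R `^ theta = (2 `^ theta) ^+ l.
Proof. by rewrite natrX -powR_mulrn// -powRrM mulrC powRrM powR_mulrn// powR_ge0. Qed.

(** * Error estimate for smooth vectors *)

Section SmoothConvergence.
Context {R : realType} {X : completeNormedModType R[i]}.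
Variables (T : R -> {linear X -> X}) (M : R) (A : operator X).
Hypothesis TC0 : C0_semigroup T.
Hypothesis M0 : 0 <= M.
Hypothesis leT : forall t x, 0 <= t -> rnorm (T t x) <= M * rnorm x.
Hypothesis genA : forall b w, gen T b w <-> dom A b /\ - A b = w.
Variables (c : R[i]) (s : seq (R[i] * R[i])).
Hypothesis sP : forall cl, cl \in s -> 0 < complex.Re cl.2.
Implicit Types (x y b w z : X) (h t : R) (n : nat).

Let G h := hop (hres T h) c s.

Lemma hopB h a x y : 0 < h -> G h (a *: x - y) = a *: G h x - G h y.
Proof.
move=> h0; rewrite /G; elim: s sP => [|cl s' ih] h' /=.
  by rewrite scalerBr !scalerA mulrC.
have l0 : 0 < complex.Re cl.2 by apply: h'; rewrite inE eqxx.
rewrite ih => [|cl' cls]; last by apply: h'; rewrite inE cls orbT.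
rewrite (hresP TC0 M0 leT)// [cl.1 *: (a *: x - y)]scalerBr [a *: (cl.1 *: x + _)]scalerDr.
by rewrite scalerA mulrC -scalerA opprD addrACA.
Qed.

Lemma hop_T h t x : 0 < h -> 0 <= t -> G h (T t x) = T t (G h x).
Proof.
move=> h0 t0; rewrite /G; elim: s sP => [|cl s' ih] h' /=; first by rewrite linearZ.
have l0 : 0 < complex.Re cl.2 by apply: h'; rewrite inE eqxx.
rewrite ih => [|cl' cls]; last by apply: h'; rewrite inE cls orbT.
by rewrite (hres_T TC0 M0 leT)// [T t (_ + _)]linearD [T t (cl.1 *: _)]linearZ.
Qed.

Lemma gen_hop h b w : 0 < h -> gen T b w -> gen T (G h b) (G h w).
Proof.
move=> h0 bw; rewrite /G; elim: s sP => [|cl s' ih] h' /=; first exact: gen_scale.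
have l0 : 0 < complex.Re cl.2 by apply: h'; rewrite inE eqxx.
apply: gen_lin => //; apply: (gen_hres2 TC0 M0 leT) => //.
by apply: ih => cl' cls; apply: h'; rewrite inE cls orbT.
Qed.

Hypothesis F0 : hfrac c s 0 = 1.
Hypothesis F1 : hder c s = 1.

Lemma local_error h z z1 z2 : 0 < h -> gen T z z1 -> gen T z1 z2 ->
  rnorm (G h z - T h z) <= (hrem M c s + M) * h ^+ 2 * rnorm z2.
Proof.
move=> h0 g1 g2.
have step (l : R[i]) b w : 0 < complex.Re l -> gen T b w ->
    l *: hres T h l b = b + hres T h l (h%:C *: w).
  move=> l0 bw; rewrite -{2}(hres_gen TC0 M0 leT h0 l0 bw) (hresP TC0 M0 leT)//.
  by rewrite subrK.
have := @hop_expansion _ X (hres T h) M z (h%:C *: z1) (h%:C *: (h%:C *: z2)) c s M0.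
move=> /(_ _ _ _ _ sP)/wrap[].
- by move=> l a x y l0; exact: (hresP TC0 M0 leT).
- by move=> l x l0; exact: (rnorm_hres TC0 M0 leT).
- by move=> l l0; exact: step.
- by move=> l l0; apply: step => //; exact: gen_scale.
rewrite F0 F1 !scale1r !rnormZr gtr0_norm// mulrA -expr2 => E1.
have E2 : rnorm (T h z - z - h%:C *: z1) <= h * (h * (M * rnorm z2)).
  apply: (gen_le TC0 M0 leT (ltW h0) g1) => t t0 th.
  apply: le_trans (gen_lip TC0 M0 leT t0 g2) _.
  by rewrite ler_wpM2r// mulr_ge0// rnorm_ge0.
have -> : G h z - T h z = (G h z - (z + h%:C *: z1)) - (T h z - z - h%:C *: z1).
  exact: sub_shift.
apply: le_trans (rnormB _ _) _; apply: le_trans (lerD E1 E2) _.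
rewrite le_eqVlt; apply/orP; left; apply/eqP; ring.
Qed.

Lemma hop_telescope h n z : 0 < h ->
  iter n (G h) z - T (n%:R * h) z =
  \sum_(j < n) iter (n.-1 - j) (G h) (T (j%:R * h) (G h z - T h z)).
Proof.
move=> h0.
have GD x y : G h (x + y) = G h x + G h y.
  rewrite -[x in LHS]scale1r -[y in LHS]opprK hopB// scale1r -sub0r -(scale0r 0) hopB//.
  by rewrite scale0r sub0r opprK.
have GS m (f : nat -> X) : G h (\sum_(j < m) f j) = \sum_(j < m) G h (f j).
  elim: m => [|m ih]; last by rewrite !big_ord_recr/= GD ih.
  by rewrite !big_ord0; apply: (addrI (G h 0)); rewrite addr0 -GD addr0.
elim: n => [|n ih]; first by rewrite mul0r (semigroup0 TC0) subrr big_ord0.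
rewrite big_ord_recr/= subnn/=.
have -> : iter n (G h) z = T (n%:R * h) z +
    \sum_(j < n) iter (n.-1 - j) (G h) (T (j%:R * h) (G h z - T h z)).
  by rewrite -ih addrC subrK.
rewrite GD (GS n (fun j => iter (n.-1 - j) (G h) (T (j%:R * h) (G h z - T h z)))).
have nh : 0 <= n%:R * h by rewrite mulr_ge0// ltW.
rewrite hop_T// [T _ (_ - _)]linearB/= -natr1 mulrDl mul1r (semigroupD TC0)// ?(ltW h0)//.
rewrite addrAC addrC; congr (_ + _); apply: eq_bigr => j _.
have -> // : (n - j = (n.-1 - j).+1)%N by have := ltn_ord j; lia.
Qed.

Variables (theta C : R) (theta1 : theta < 1) (C0 : 0 <= C).
Hypothesis stab : forall h n x S, 0 < h ->
  (forall L, \sum_(l < L) (2 ^ l)%:R `^ theta * K_functional A (2 ^ l)%:R^-1 x <= S) ->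
  rnorm (iter n (G h) x) <= C * S.

Let D := (1 - 2 `^ theta / 2)^-1.

Let q1 : 2 `^ theta / 2 < 1 :> R.
Proof.
rewrite ltr_pdivrMr// mul1r -[X in _ < X]powRr1//.
by rewrite /powR pnatr_eq0/= ltr_expR ltr_pM2r// ln_gt0// ltr1n.
Qed.

Let D0 : 0 <= D. Proof. by rewrite invr_ge0 subr_ge0 (ltW q1). Qed.

(** The splitting 0 + b gives K(2^-l, b) at most 2^-l times the graph norm, so the dyadic sum is
    geometric with ratio 2^(theta - 1) < 1. *)
Lemma stable_gen h n b w : 0 < h -> gen T b w ->
  rnorm (iter n (G h) b) <= C * (D * (rnorm b + rnorm w)).
Proof.
move=> h0 bw; apply: stab => // L; have [Ab wE] := (genA b w).1 bw.
have q0 : 0 <= 2 `^ theta / 2 :> R by rewrite divr_ge0// powR_ge0.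
have N0 : 0 <= rnorm b + rnorm w by rewrite addr_ge0// rnorm_ge0.
apply: (@le_trans _ _ (\sum_(l < L) (2 `^ theta / 2) ^+ l * (rnorm b + rnorm w))).
  apply: ler_sum => l _; rewrite powR_pow2 exprMn exprVn -mulrA ler_wpM2l ?exprn_ge0 ?powR_ge0//.
  rewrite -natrX -[b in K_functional _ _ b]add0r.
  apply: le_trans (K_functional_le _ _ Ab) _; rewrite ?invr_ge0// rnorm0 add0r.
  by rewrite /graph_norm -wE rnormN.
rewrite -mulr_suml ler_wpM2r// /D -[leRHS]mul1r ler_pdivlMr ?subr_gt0 ?q1//.
by rewrite mulrC -opprB mulNr -subrX1 opprB gerBl exprn_ge0.
Qed.

(** Consistency uses two applications of the generator, and a third is needed because stability
    measures the local error in the graph norm. With n h bounded the total is O(1 / n). *)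
Lemma smooth_error h n z z1 z2 z3 : 0 < h -> gen T z z1 -> gen T z1 z2 -> gen T z2 z3 ->
  rnorm (iter n (G h) z - T (n%:R * h) z) <=
  n%:R * (C * (D * (M * ((hrem M c s + M) * h ^+ 2 * (rnorm z2 + rnorm z3))))).
Proof.
move=> h0 g1 g2 g3; rewrite hop_telescope//; apply: le_trans (rnorm_sum _ _ _) _.
rewrite -[n in leRHS]card_ord mulr_natl -sumr_const; apply: ler_sum => j _.
have jh : 0 <= j%:R * h by rewrite mulr_ge0// ltW.
have gy : gen T (T (j%:R * h) (G h z - T h z)) (T (j%:R * h) (G h z1 - T h z1)).
  apply: (gen_T TC0 M0 leT) => //; apply: genB; first exact: gen_hop.
  by apply: (gen_T TC0 M0 leT) => //; exact: ltW.
apply: le_trans (stable_gen _ h0 gy) _; rewrite ler_wpM2l// ler_wpM2l//.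
rewrite [_ * (rnorm z2 + _)]mulrDr [M * (_ + _)]mulrDr.
apply: lerD; apply: le_trans (leT _ jh) _; rewrite ler_wpM2l//.
  exact: (local_error h0 g1 g2).
exact: (local_error h0 g2 g3).
Qed.

End SmoothConvergence.

(** * From the interpolation integral to the dyadic sum *)

Section InterpolationSum.
Context {R : realType} {X : normedModType R[i]}.
Variables (A : operator X) (x : X).
Hypothesis dom0 : dom A 0.
Implicit Types (u v : R).

Let decomp : exists a b, dom A b /\ a + b = x.
Proof. by exists x, 0; rewrite addr0. Qed.

Lemma K_functional_ge0 u : 0 <= u -> 0 <= K_functional A u x.
Proof.
move=> u0; apply: K_functional_ge => // a b _ _.
by rewrite addr_ge0 ?rnorm_ge0// mulr_ge0// graph_norm_ge0.
Qed.

Lemma K_functional_mono u v : 0 <= u -> u <= v -> K_functional A u x <= K_functional A v x.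
Proof.
move=> u0 uv; apply: K_functional_ge => // a b Ab <-.
apply: le_trans (K_functional_le _ _ Ab) _ => //.
by rewrite lerD2l ler_wpM2r// graph_norm_ge0.
Qed.

Lemma measurable_K_functional : measurable_fun (`]0%R, +oo[%classic : set (measurableTypeR R))
  (fun u => K_functional A u x).
Proof.
(* Truncation at 0 extends the function to a monotone one on the whole line. *)
apply: (@eq_measurable_fun _ _ _ _ _ (fun u => K_functional A (Num.max 0 u) x)).
  by move=> u; rewrite inE/= in_itv/= andbT => u0; rewrite max_r// ltW.
apply: nondecreasing_measurable => // u v uv; apply: K_functional_mono.
  by rewrite le_max lexx.
by rewrite ge_max !le_max lexx uv orbT.
Qed.

Variable theta : R.
Hypothesis theta0 : 0 <= theta.

Let f u : R := (u `^ (- theta) * K_functional A u x) `^ 1 / u.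

Let f_ge0 u : 0 < u -> 0 <= f u.
Proof. by move=> u0; rewrite divr_ge0 ?powR_ge0// ltW. Qed.

Let measurable_f : measurable_fun (`]0%R, +oo[%classic : set (measurableTypeR R)) f.
Proof.
apply: (@eq_measurable_fun _ _ _ _ _
    (fun u => (u `^ (- theta) * K_functional A u x) * u `^ (-1))).
  move=> u; rewrite inE/= in_itv/= andbT => u0.
  by rewrite /f powRr1 ?mulr_ge0 ?powR_ge0 ?K_functional_ge0 ?(ltW u0)// powR_inv1// ltW.
apply: measurable_funM; last by apply: measurable_funTS; exact: measurable_powR.
apply: measurable_funM; last exact: measurable_K_functional.
by apply: measurable_funTS; exact: measurable_powR.
Qed.

Let e l : R := (2 ^ l)%:R^-1.

Let e0 l : 0 < e l. Proof. by rewrite invr_gt0 ltr0n expn_gt0. Qed.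

(** On a block (e, 2e] the weights are at least (2e)^-theta and 1 / (2e), and the length is e:
    together e^-theta times this constant. *)
Let cc := 2 `^ (- theta) / 2 : R.

Let cc0 : 0 < cc. Proof. by rewrite divr_gt0// powR_gt0. Qed.

Let le_block l :
  ((cc * ((2 ^ l)%:R `^ theta * K_functional A (e l) x))%:E <=
   \int[lebesgue_measure]_(u in `](e l)%R, (2 * e l)%R]) (f u)%:E)%E.
Proof.
set r := cc * _; have r0 : 0 <= r.
  by rewrite mulr_ge0 ?(ltW cc0)// mulr_ge0 ?powR_ge0 ?K_functional_ge0 ?(ltW (e0 l)).
have sub : `]e l, 2 * e l]%classic `<=` `]0%R, +oo[%classic.
  by move=> u /=; rewrite !in_itv/= andbT => /andP[h _]; exact: lt_trans h.
apply: (@le_trans _ _ (\int[lebesgue_measure]_(u in `](e l)%R, (2 * e l)%R]) (r / e l)%:E)%E).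
  rewrite integral_cst//= lebesgue_measure_itv/= lte_fin ltr_pMl// ltr1n/= -EFinD -EFinM lee_fin.
  by rewrite mulr_natl mulr2n addrK divfK// gt_eqF.
apply: ge0_le_integral => //=.
- by move=> u _; rewrite lee_fin divr_ge0// ltW.
- by apply/measurable_EFinP; apply: measurable_funS measurable_f.
move=> u; rewrite in_itv/= => /andP[eu u2]; rewrite lee_fin.
have u0 : 0 < u by exact: lt_trans eu.
have -> : r / e l = (2 * e l) `^ (- theta) * K_functional A (e l) x / (2 * e l).
  rewrite /r /cc powRM ?(ltW (e0 l))//.
  have -> : e l `^ (- theta) = (2 ^ l)%:R `^ theta.
    by rewrite /e -powR_inv1// -powRrM mulrNN mul1r.
  rewrite invfM; ring.
rewrite /f powRr1 ?mulr_ge0 ?powR_ge0 ?K_functional_ge0 ?(ltW u0)//.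
apply: ler_pM; rewrite ?invr_ge0 ?mulr_ge0 ?powR_ge0 ?K_functional_ge0 ?(ltW (e0 l))//.
  apply: ler_pM; rewrite ?powR_ge0 ?K_functional_ge0 ?(ltW (e0 l))//.
    rewrite !powRN lef_pV2 ?posrE ?powR_gt0 ?mulr_gt0//.
    by apply: ge0_ler_powR; rewrite ?nnegrE ?(ltW u0) ?mulr_ge0 ?(ltW (e0 l)).
  by apply: K_functional_mono; rewrite ?(ltW (e0 l))// ltW.
by rewrite lef_pV2 ?posrE ?mulr_gt0.
Qed.

Let le_blocks L :
  ((cc * \sum_(l < L) (2 ^ l)%:R `^ theta * K_functional A (e l) x)%:E <=
   \int[lebesgue_measure]_(u in `](2 * e L)%R, 2%R]) (f u)%:E)%E.
Proof.
have pos l u : u \in `]2 * e l, 2%R] -> 0 < u.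
  by rewrite in_itv/= => /andP[h _]; apply: lt_trans h; rewrite mulr_gt0.
elim: L => [|L ih].
  by rewrite big_ord0 mulr0; apply: integral_ge0 => u /= /pos u0; rewrite lee_fin f_ge0.
have eS : 2 * e L.+1 = e L by rewrite /e expnS natrM invfM mulrA divff ?mul1r.
have le1 : e L <= 1 by rewrite /e invf_le1 ?ltr0n ?expn_gt0// ler1n expn_gt0.
have split : `]e L, 2%R]%classic = `]e L, 2 * e L]%classic `|` `]2 * e L, 2%R]%classic.
  rewrite -itv_bndbnd_setU//; rewrite bnd_simp ?ler_peMl ?ler1n ?(ltW (e0 L))//.
  by rewrite -[leRHS]mulr1 ler_wpM2l.
rewrite eS split ge0_integral_setU//=.
- by rewrite big_ord_recr/= mulrDr EFinD addeC; apply: leeD => //; exact: le_block.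
- rewrite -split; apply/measurable_EFinP; apply: measurable_funS measurable_f => //.
  by move=> u /=; rewrite !in_itv/= andbT => /andP[h _]; exact: lt_trans h.
- move=> u [] /=; rewrite in_itv/= => /andP[h _]; rewrite lee_fin f_ge0//; apply: lt_trans h => //.
  by rewrite mulr_gt0.
- apply/disj_setPS => u /=; rewrite !in_itv/= => -[/andP[_ h1] /andP[h2 _]].
  by have := lt_le_trans h2 h1; rewrite ltxx.
Qed.

Lemma real_interpolation_sum : real_interpolation A theta 1 x -> exists S : R,
  forall L, \sum_(l < L) (2 ^ l)%:R `^ theta * K_functional A (2 ^ l)%:R^-1 x <= S.
Proof.
rewrite /real_interpolation/= -/f => fin.
set I := (\int[_]_(u in _) _)%E in fin.
have I0 : (0 <= I)%E.
  by apply: integral_ge0 => u /=; rewrite in_itv/= andbT => u0; rewrite lee_fin f_ge0.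
exists (cc^-1 * fine I) => L; rewrite ler_pdivlMl// -lee_fin fineK; last first.
  by rewrite ge0_fin_numE.
apply: le_trans (le_blocks L) _; apply: ge0_subset_integral => //=.
- by apply/measurable_EFinP; exact: measurable_f.
- by move=> u /=; rewrite in_itv/= andbT => u0; rewrite lee_fin f_ge0.
- move=> u /=; rewrite !in_itv/= andbT => /andP[h _]; apply: lt_trans h.
  by rewrite mulr_gt0.
Qed.

End InterpolationSum.

Lemma split_error (V : zmodType) (a b j k : V) : a - b = (a - j) + ((j - k) - (b - k)).
Proof. by rewrite opprB [j - k + _]addrA subrK addrA subrK. Qed.

(** * Regularisation and convergence on the interpolation space *)

Section Convergence.
Context {R : realType} {X : completeNormedModType R[i]}.
Variables (T : R -> {linear X -> X}) (M : R) (A : operator X).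
Hypothesis TC0 : C0_semigroup T.
Hypothesis M0 : 0 <= M.
Hypothesis leT : forall t x, 0 <= t -> rnorm (T t x) <= M * rnorm x.
Hypothesis genA : forall b w, gen T b w <-> dom A b /\ - A b = w.
Implicit Types (x y b w z : X) (h t u eps : R) (n : nat).

Let gen0 : gen T 0 0.
Proof. by rewrite /gen; under eq_fun do rewrite linear0 subrr scaler0; exact: cvg_cst. Qed.

Let dom0 : dom A 0. Proof. by have [] := (genA 0 0).1 gen0. Qed.

Let A0 : A 0 = 0.
Proof. by have [_ /eqP] := (genA 0 0).1 gen0; rewrite oppr_eq0 => /eqP. Qed.

(** This is (1 - hB)^-1, the operator a R(a) with a = 1 / h. *)
Let V h x := hres T h 1 x.

Let Re1 : 0 < complex.Re (1 : R[i]). Proof. exact: ltr01. Qed.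

Let V_le h x : 0 < h -> rnorm (V h x) <= M * rnorm x.
Proof.
by move=> h0; apply: le_trans (rnorm_hres TC0 M0 leT h0 x Re1) _; rewrite divr1.
Qed.

Let VB h x y : 0 < h -> V h (x - y) = V h x - V h y.
Proof. by move=> h0; rewrite /V -{1}[x]scale1r (hresP TC0 M0 leT)// scale1r. Qed.

Let VD h x y : 0 < h -> V h (x + y) = V h x + V h y.
Proof.
move=> h0; rewrite -[y in LHS]opprK VB// -[- y]sub0r VB// /V (hres0 TC0 M0 leT h0)//.
by rewrite sub0r opprK.
Qed.

Let gen_V h x : 0 < h -> gen T (V h x) ((h^-1)%:C *: (V h x - x)).
Proof.
by move=> h0; have := gen_hres TC0 M0 leT h0 (x := x) Re1; rewrite scale1r.
Qed.

Let V_gen h b w : 0 < h -> gen T b w -> gen T (V h b) (V h w).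
Proof. by move=> h0; exact: (gen_hres2 TC0 M0 leT h0 Re1). Qed.

Let V_diff h b w : 0 < h -> gen T b w -> V h b - b = h%:C *: V h w.
Proof.
move=> h0 bw; have := hres_gen TC0 M0 leT h0 Re1 bw; rewrite scale1r => E.
rewrite -{2}E -/(V h _) VB// opprB addrCA subrr addr0.
exact: (hresZ TC0 M0 leT h0).
Qed.

Let V_cvg x eps : (forall e : R, 0 < e -> exists b w, gen T b w /\ rnorm (x - b) <= e) ->
  0 < eps -> exists2 h, 0 < h & rnorm (V h x - x) <= eps.
Proof.
move=> dense eps0; have M1 : 0 < M + 1 by rewrite ltr_wpDl.
have [b [w [bw xb]]] := dense (eps / 2 / (M + 1)) ltac:(by rewrite !divr_gt0).
have k0 : 0 <= M * rnorm w by rewrite mulr_ge0// rnorm_ge0.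
have k1 : 0 < M * rnorm w + 1 by rewrite ltr_wpDl.
have h0 : 0 < eps / 2 / (M * rnorm w + 1) by rewrite !divr_gt0.
exists (eps / 2 / (M * rnorm w + 1)) => //; set h := _ / _ in h0 *.
have -> : V h x - x = (V h (x - b) - (x - b)) + (V h b - b).
  by rewrite VB// addrACA -opprD !subrK.
apply: (@le_trans _ _ (eps / 2 + eps / 2)); last by lra.
apply: le_trans (rnormD _ _) _; apply: lerD.
  apply: le_trans (rnormB _ _) _; apply: le_trans (lerD (V_le _ h0) (lexx _)) _.
  by rewrite -{2}[rnorm _]mul1r -mulrDl mulrC -ler_pdivlMr.
rewrite (V_diff h0 bw) rnormZr gtr0_norm//; apply: le_trans (ler_wpM2l (ltW h0) (V_le _ h0)) _.
by rewrite /h mulrAC ler_pdivrMr// ler_wpM2l ?divr_ge0 ?(ltW eps0)// lerDl.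
Qed.

(** Three factors, since [smooth_error] applies the generator three times. *)
Let J h x := V h (V h (V h x)).

Let J_diff h x : 0 < h -> rnorm (x - J h x) <= (M ^+ 2 + M + 1) * rnorm (V h x - x).
Proof.
move=> h0; rewrite rdistC /J.
have -> : V h (V h (V h x)) - x = V h (V h (V h x - x)) + V h (V h x - x) + (V h x - x).
  by rewrite !VB// !addrA !subrK.
apply: le_trans (rnormD _ _) _; rewrite mulrDl mul1r lerD2r.
apply: le_trans (rnormD _ _) _; rewrite mulrDl; apply: lerD; last exact: V_le.
by apply: le_trans (V_le _ h0) _; rewrite expr2 -mulrA ler_wpM2l// V_le.
Qed.

Let J_le h x : 0 < h -> rnorm (x - J h x) <= (1 + M ^+ 3) * rnorm x.
Proof.
move=> h0; apply: le_trans (rnormB _ _) _; rewrite mulrDl mul1r lerD2l.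
rewrite exprS expr2 -!mulrA; apply: le_trans (V_le _ h0) _; rewrite ler_wpM2l//.
by apply: le_trans (V_le _ h0) _; rewrite ler_wpM2l// V_le.
Qed.

Let J_smooth h x : 0 < h -> exists z1 z2 z3,
  [/\ gen T (J h x) z1, gen T z1 z2 & gen T z2 z3].
Proof.
move=> h0; set y := (h^-1)%:C *: (V h x - x).
set y' := (h^-1)%:C *: (V h y - y).
exists (V h (V h y)), (V h y'), ((h^-1)%:C *: (V h y' - y')); split; last exact: gen_V.
  by do 2!apply: V_gen => //; exact: gen_V.
by apply: V_gen => //; exact: gen_V.
Qed.

Let genBJ h b w : 0 < h -> gen T b w -> gen T (b - J h b) (w - J h w).
Proof.
by move=> h0 bw; apply: genB => //; do 3!apply: V_gen => //.
Qed.

(** 1 - J is bounded on X and commutes with A on the domain, so it is bounded for the graph norm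
    with the same constant and maps splittings of x to splittings. *)
Let K_J h u x : 0 < h -> 0 <= u ->
  K_functional A u (x - J h x) <= (1 + M ^+ 3) * K_functional A u x.
Proof.
move=> h0 u0; have c0 : 0 < 1 + M ^+ 3 by rewrite ltr_pwDl// exprn_ge0.
rewrite -ler_pdivrMl//; apply: K_functional_ge; first by exists x, 0; rewrite addr0.
move=> a b Ab <-; rewrite ler_pdivrMl//.
have gb : gen T b (- A b) by apply/genA.
have [Ab' Eb'] := (genA _ _).1 (genBJ h0 gb).
have -> : a + b - J h (a + b) = (a - J h a) + (b - J h b).
  by rewrite /J !VD// opprD addrACA.
apply: le_trans (K_functional_le _ u0 Ab') _.
rewrite [leRHS]mulrDr; apply: lerD; first exact: J_le.
rewrite mulrCA ler_wpM2l// /graph_norm mulrDr; apply: lerD; first exact: J_le.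
rewrite -[rnorm (A (b - _))]rnormN Eb' -[rnorm (A b)]rnormN; exact: J_le.
Qed.

Variables (c : R[i]) (s : seq (R[i] * R[i])).
Hypothesis sP : forall cl, cl \in s -> 0 < complex.Re cl.2.
Hypothesis F0 : hfrac c s 0 = 1.
Hypothesis F1 : hder c s = 1.

Let G h := hop (hres T h) c s.

Variables (theta C : R) (theta0 : 0 <= theta) (theta1 : theta < 1) (C0 : 0 <= C).

Let term l x := (2 ^ l)%:R `^ theta * K_functional A (2 ^ l)%:R^-1 x.

Hypothesis stab : forall h n x S, 0 < h -> (forall L, \sum_(l < L) term l x <= S) ->
  rnorm (iter n (G h) x) <= C * S.

Let inv0 l : 0 <= (2 ^ l)%:R^-1 :> R. Proof. by rewrite invr_ge0. Qed.

Let pow1 l : 1 <= (2 ^ l)%:R `^ theta.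
Proof.
have h : 1 <= (2 ^ l)%:R :> R by rewrite ler1n expn_gt0.
by have := ler_powR h theta0; rewrite powRr0.
Qed.

Let term_ge0 l x : 0 <= term l x.
Proof. by rewrite mulr_ge0 ?powR_ge0 ?K_functional_ge0. Qed.

Variables (x : X) (S : R).
Hypothesis xS : forall L, \sum_(l < L) term l x <= S.

(** The terms have bounded sums and the weights are at least 1, so K(2^-l, x) becomes arbitrarily
    small; a good splitting then gives b. *)
Let dense eps : 0 < eps -> exists b w, gen T b w /\ rnorm (x - b) <= eps.
Proof.
move=> eps0; have [l hl] : exists l, term l x < eps.
  apply: contrapT => /forallNP h; pose L := (Num.truncn (S / eps)).+1.
  have : L%:R * eps <= S.
    apply: le_trans (xS L); rewrite mulr_natl -[L in _ *+ L]card_ord -sumr_const.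
    by apply: ler_sum => l _; rewrite leNgt; apply/negP/h.
  by rewrite -ler_pdivlMr// leNgt truncnS_gt.
have Kl : K_functional A (2 ^ l)%:R^-1 x < eps.
  by apply: le_lt_trans hl; rewrite ler_peMl ?K_functional_ge0.
apply: contrapT => /forallNP h; move: Kl; rewrite ltNge => /negP; apply.
apply: K_functional_ge; first by exists x, 0; rewrite addr0.
move=> a b Ab abx; have /forallNP/(_ (- A b))/not_andP := h b.
case => [|/negP]; first by case; apply/genA.
rewrite -ltNge -abx addrK => /ltW/le_trans; apply.
by rewrite lerDl mulr_ge0// graph_norm_ge0.
Qed.

Let tail eps : 0 < eps -> exists L0, forall L, \sum_(l < L) term (L0 + l)%N x <= eps.
Proof.
move=> eps0; pose E := [set y | exists L, y = \sum_(l < L) term l x].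
have Esup : has_sup E.
  by split; [exists (\sum_(l < 0) term l x), 0%N|exists S => _ [L ->]; exact: xS].
have [_ [L0 ->] hL0] := sup_adherent eps0 Esup.
exists L0 => L; rewrite -(lerD2l (\sum_(l < L0) term l x)).
have -> : \sum_(l < L0) term l x + \sum_(l < L) term (L0 + l)%N x = \sum_(l < L0 + L) term l x.
  by rewrite big_split_ord.
rewrite ltrBlDr in hL0; apply: le_trans (ltW hL0).
by apply: sup_ubound; [exact: Esup.2|exists (L0 + L)%N].
Qed.

Let GB h y z : 0 < h -> G h (y - z) = G h y - G h z.
Proof. by move=> h0; rewrite /G -{1}[y]scale1r (hopB TC0 M0 leT)// scale1r. Qed.

(** The choices are made in the order [L0], [a], [N]: the tail beyond [L0] is small uniformly in
    [a], then [a] makes the first [L0] terms small, and [N] may depend on the regularised vector. *)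
Lemma hop_cvg tau eps : 0 <= tau -> 0 < eps -> exists N, forall n h, (N <= n)%N ->
  0 < h -> n%:R * h <= tau -> rnorm (iter n (G h) x - T (n%:R * h) x) <= eps.
Proof.
move=> tau0 eps0; set c3 := 1 + M ^+ 3; have c30 : 0 <= c3 by rewrite addr_ge0// exprn_ge0.
have small k : 0 <= k -> 0 < eps / 4 / (k + 1) /\ k * (eps / 4 / (k + 1)) <= eps / 4.
  move=> k0; have k1 : 0 < k + 1 by rewrite ltr_wpDl.
  split; first by rewrite !divr_gt0.
  rewrite mulrCA ler_piMr ?divr_ge0 ?(ltW eps0)//.
  by rewrite ler_pdivrMr// mul1r lerDl.
have [e1 s1] := small (C * c3) (mulr_ge0 C0 c30).
have [L0 hL0] := tail e1; set H := \sum_(l < L0) (2 ^ l)%:R `^ theta.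
have H0 : 0 <= H by apply: sumr_ge0 => l _; exact: powR_ge0.
have M2 : 0 < M ^+ 2 + M + 1 by rewrite ltr_wpDl// addr_ge0// exprn_ge0.
have CHM : 0 <= (C * H + M) * (M ^+ 2 + M + 1) by rewrite mulr_ge0 ?(ltW M2)// addr_ge0// mulr_ge0.
have [e2 s2] := small _ CHM.
have [a a0 ha] := V_cvg dense e2.
set w := x - J a x.
have w_le : (C * H + M) * rnorm w <= eps / 4.
  apply: (@le_trans _ _ ((C * H + M) * ((M ^+ 2 + M + 1) * rnorm (V a x - x)))).
    by rewrite ler_wpM2l ?J_diff// addr_ge0// mulr_ge0.
  by rewrite mulrA; apply: le_trans (ler_wpM2l CHM ha) s2.
(* Below [L0] the K-functional of [w] is at most its norm, from the splitting w + 0; from [L0] on,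
   [K_J] compares it with the tail for [x]. *)
have wS L : \sum_(l < L) term l w <= H * rnorm w + c3 * (eps / 4 / (C * c3 + 1)).
  apply: (@le_trans _ _ (\sum_(l < L0 + L) term l w)).
    by rewrite addnC big_split_ord/= lerDl sumr_ge0.
  rewrite big_split_ord/=; apply: lerD.
    rewrite /H mulr_suml; apply: ler_sum => l _; rewrite ler_wpM2l ?powR_ge0//.
    rewrite -[w in leLHS]addr0; apply: le_trans (K_functional_le _ _ dom0) _ => //.
    by rewrite /graph_norm A0 rnorm0 addr0 mulr0 addr0.
  apply: le_trans (ler_wpM2l c30 (hL0 L)); rewrite mulr_sumr; apply: ler_sum => l _.
  by rewrite /term mulrCA ler_wpM2l ?powR_ge0// K_J.
have [z1 [z2 [z3 [g1 g2 g3]]]] := J_smooth x a0.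
set Q := C * ((1 - 2 `^ theta / 2)^-1 * (M * ((hrem M c s + M) * (rnorm z2 + rnorm z3)))).
(* The smooth error is (n h)^2 Q / n, at most tau^2 |Q| / n, which is to be below eps / 2. *)
pose N := (Num.truncn (tau ^+ 2 * `|Q| / (eps / 2))).+1.
exists N => n h Nn h0 nh.
have n0 : 0 < n%:R :> R by rewrite ltr0n; case: n Nn {nh}.
have nh0 : 0 <= n%:R * h by rewrite mulr_ge0// ltW.
have iterB m y z : iter m (G h) (y - z) = iter m (G h) y - iter m (G h) z.
  by elim: m => [//|m ih]; rewrite !iterS ih GB.
have -> : iter n (G h) x - T (n%:R * h) x =
    iter n (G h) w + ((iter n (G h) (J a x) - T (n%:R * h) (J a x)) - T (n%:R * h) w).
  by rewrite /w iterB [T _ (_ - _)]linearB/=; exact: split_error.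
have b1 : rnorm (iter n (G h) w) <= C * (H * rnorm w) + eps / 4.
  apply: le_trans (stab n h0 wS) _; rewrite mulrDr lerD2l mulrA.
  exact: s1.
have b2 : rnorm (T (n%:R * h) w) <= M * rnorm w by exact: leT.
have b3 : rnorm (iter n (G h) (J a x) - T (n%:R * h) (J a x)) <= eps / 2.
  apply: le_trans (smooth_error TC0 M0 leT genA sP F0 F1 theta1 C0 stab n h0 g1 g2 g3) _.
  have -> : n%:R * (C * ((1 - 2 `^ theta / 2)^-1 *
      (M * ((hrem M c s + M) * h ^+ 2 * (rnorm z2 + rnorm z3))))) = (n%:R * h) ^+ 2 * Q / n%:R.
    by rewrite /Q; move: (_^-1) => D; field; exact: lt0r_neq0.
  rewrite ler_pdivrMr//; apply: (@le_trans _ _ (tau ^+ 2 * `|Q|)).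
    apply: le_trans (ler_norm _) _; rewrite normrM ler_wpM2r// ger0_norm ?sqr_ge0//.
    by rewrite lerXn2r ?nnegrE.
  rewrite -ler_pdivrMl ?divr_gt0// mulrC.
  by apply: (le_trans (ltW (truncnS_gt _))); rewrite ler_nat.
apply: le_trans (rnormD _ _) _; apply: le_trans (lerD b1 (rnormB _ _)) _.
apply: le_trans (lerD (lexx _) (lerD b3 b2)) _.
move: w_le; rewrite mulrDl -mulrA => w_le.
lra.
Qed.

End Convergence.

(** * Identification of the scheme and conclusion *)

Lemma hfrac_le1 (R : realType) (r : ratfun R) a c s z : A_stable r -> a != 0 ->
  Defs.den r = a *: hden s -> Defs.num r = a *: hnum c s -> complex.Re z <= 0 ->
  cabs (hfrac c s z) <= 1.
Proof.
move=> rA a0 dE nE z0.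
have d0 : (Defs.den r).[z] != 0.
  by apply/negP => /(A_stable_root rA); rewrite ltNge z0.
have := A_stable_le rA z0; move: d0; rewrite dE nE !hornerZ mulf_eq0 negb_or => /andP[_ hz].
rewrite !cabsM ler_pM2l; last by rewrite lt_neqAle cabs_ge0 eq_sym cabs_eq0 a0.
rewrite -hfracE// cabsM cabsV ler_pdivrMr ?mul1r//.
by rewrite lt_neqAle cabs_ge0 eq_sym cabs_eq0 hz.
Qed.

(** At t = 0 the scheme uses the zero operator, whose resolvents are the scalars l^-1; the Horner
    form then evaluates to r(0) = 1. *)
Lemma ratfun_op_scale0 (R : realType) (X : normedModType R[i]) (A : operator X)
    (r : ratfun R) a c s x : a != 0 ->
  Defs.den r = a *: hden s -> Defs.num r = a *: hnum c s ->
  (forall cl, cl \in s -> 0 < complex.Re cl.2) -> hfrac c s 0 = 1 ->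
  ratfun_op r (scale_op 0 A) x = x.
Proof.
move=> a0 dE nE sP F0; rewrite /scale_op eqxx.
have l0 (l : R[i]) : 0 < complex.Re l -> l != 0.
  by move=> h; apply: contraTneq h => ->; rewrite /= ltxx.
rewrite (@ratfun_op_hop _ _ _ (fun l x => l^-1 *: x) _ _ _ _ _ r a c s)//=.
- rewrite -[RHS]scale1r -F0; elim: (s) => [//|cl s' ih] /=.
  by rewrite ih subr0 scalerA -scalerDl.
- by move=> *; rewrite scaler0 subrr.
- by move=> l b y z _; rewrite scalerBr !scalerA mulrC.
- by move=> l y /l0 ln0; rewrite scalerA divff// scale1r subrr.
- by move=> l u /l0 ln0 _; rewrite subr0 scalerA mulVf// scale1r.
Qed.

Lemma ratfun_op_scale (R : realType) (X : completeNormedModType R[i]) (A : operator X)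
    (T : R -> {linear X -> X}) M (r : ratfun R) a c s h x : C0_semigroup T -> 0 <= M ->
  (forall t x, 0 <= t -> rnorm (T t x) <= M * rnorm x) ->
  (forall b w, gen T b w <-> dom A b /\ - A b = w) -> a != 0 ->
  Defs.den r = a *: hden s -> Defs.num r = a *: hnum c s ->
  (forall cl, cl \in s -> 0 < complex.Re cl.2) -> 0 < h ->
  ratfun_op r (scale_op (- h)%:C A) x = hop (hres T h) c s x.
Proof.
move=> TC0 M0 leT genA a0 dE nE sP h0.
have hn0 : h%:C != 0 :> R[i] by rewrite -cabs_eq0 cabs_real normr_eq0 gt_eqF.
have hN0 : ((- h)%:C == 0 :> R[i]) = false by rewrite rmorphN/= oppr_eq0 (negbTE hn0).
rewrite /scale_op hN0.
have BE u : (- h)%:C *: A u = h%:C *: (- A u) by rewrite rmorphN/= scaleNr scalerN.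
have g u : dom A u -> gen T u (- A u) by move=> Au; apply/genA.
rewrite (@ratfun_op_hop _ _ _ (hres T h) _ _ _ _ _ r a c s)//=.
- move=> b u v Au Av.
  have gu : gen T (b *: u - v) (b *: (- A u) - (- A v)).
    by apply: genB; [apply: gen_scale|]; exact: g.
  have [Auv EA] := (genA _ _).1 gu; split=> //.
  by rewrite !BE EA scalerBr !scalerA mulrC.
- by move=> l b y z l0; exact: (hresP TC0 M0 leT).
- by move=> l y l0; have [] := (genA _ _).1 (gen_hres TC0 M0 leT h0 (x := y) l0).
- move=> l y l0; have [_ E] := (genA _ _).1 (gen_hres TC0 M0 leT h0 (x := y) l0).
  by rewrite BE E scalerA -rmorphM/= divff ?gt_eqF// scale1r.
- move=> l u l0 Au; rewrite BE; exact: (hres_gen TC0 M0 leT h0 l0 (g u Au)).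
Qed.

Lemma cvg_uniform_itv (R : realType) (X : normedModType R[i]) (u : nat -> R -> X) f (tau : R) :
  (forall eps : R, 0 < eps -> exists N, forall n t, (N <= n)%N -> 0 <= t -> t <= tau ->
    rnorm (u n t - f t) <= eps) ->
  {uniform `[0, tau], u @ \oo --> f}.
Proof.
move=> h P /uniform_nbhs[E [entE EP]].
move: entE; rewrite -entourage_ballE => -[e /= e0 eE].
have ee : e = (complex.Re e)%:C by rewrite RRe_real// gtr0_real.
have d0 : 0 < complex.Re e by rewrite -ltcR -ee.
have [N hN] := h (complex.Re e / 2) ltac:(by rewrite divr_gt0).
exists N => // n /= Nn; apply: EP => t /=; rewrite in_itv/= => /andP[t0 tt].
apply: eE => /=; rewrite -ball_normE/= rnormE ee ltcR rdistC.
apply: le_lt_trans (hN n t Nn t0 tt) _.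
by rewrite ltr_pdivrMr// mulr_natr mulr2n ltrDl.
Qed.

Theorem corollary7p4 (R : realType) (d : measure_display)
  (Omega : measurableType d) (P : probability Omega R)
  (gamma : nat -> Omega -> R[i]) (gammaP : gaussian_sequence P gamma)
  (r : ratfun R) (k : nat) (k_gt0 : (0 < k)%N)
  (r_stable : A_stable r) (r_approx : exp_approximation r k)
  (X : completeNormedModType R[i]) (X_neq0 : exists x : X, x != 0)
  (A : operator X) (T : R -> {linear X -> X})
  (T_semigroup : C0_semigroup T) (T_gen : is_generator (scale_op (-1) A) T)
  (T_stable : exponentially_stable T)
  (p q : R) (X_type : has_type P gamma X p) (X_cotype : has_cotype P gamma X q)
  (T_inv : forall t : R, 0 <= t -> boundedly_invertible (T t)) :
  forall x, real_interpolation A (p^-1 - q^-1) 1 x ->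
  forall tau : R, 0 <= tau ->
    {uniform `[0, tau],
      (fun (n : nat) (t : R) =>
         iter n (ratfun_op r (scale_op (- (t / n%:R))%:C A)) x) @ \oo
      --> (fun t : R => T t x)}.
Proof.
move=> x xA tau tau0.
have [/andP[p1 p2] _] := X_type; have [q2 _] := X_cotype.
have p0 : 0 < p := lt_le_trans ltr01 p1.
have q0 : 0 < q := lt_le_trans (ltr0Sn R 1) q2.
have theta0 : 0 <= p^-1 - q^-1.
  by rewrite subr_ge0 lef_pV2 ?posrE// (le_trans p2).
have theta1 : p^-1 - q^-1 < 1.
  by rewrite ltrBlDr ltr_pwDr ?invr_gt0// invf_le1.
have [C C0 clepq] := cle_type_cotype gammaP X_type X_cotype.
have [M [omega [M1 omega0 T_le]]] := T_stable.
have leTe t y : 0 <= t -> rnorm (T t y) <= M * expR (- omega * t) * rnorm y.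
  by move=> t0; exact: T_le.
have M0 : 0 <= M := le_trans ler01 M1.
have leT := leT_exp M0 omega0 leTe.
have genA b w : gen T b w <-> dom A b /\ - A b = w.
  have := T_gen b w; rewrite /scale_op oppr_eq0 oner_eq0/= scaleN1r => h.
  by split => [/h|?]//; apply/h.
have dom0 : dom A 0.
  suff : gen T 0 0 by case/genA.
  by rewrite /gen; under eq_fun do rewrite linear0 subrr scaler0; exact: cvg_cst.
have [S' [cS' _ TS']] := T_inv 1 ler01.
have [CS CS0 leS] := linear_rnorm_bounded cS'.
have gA b : dom A b -> gen T b (- A b) by move=> Ab; apply/genA.
have [D D0 stable] :=
  dyadic_stability p1 q0 C0 clepq T_semigroup M0 omega0 leTe gA dom0 CS0 TS' leS.
have [a [c [s [a0 dE nE sP]]]] := ratfun_hfrac r_stable.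
have [F0 F1] := exp_approximation_hder r_stable r_approx k_gt0 a0 dE nE sP.
have stab h n y Sy : 0 < h -> (forall L, \sum_(l < L) (2 ^ l)%:R `^ (p^-1 - q^-1) *
    K_functional A (2 ^ l)%:R^-1 y <= Sy) -> rnorm (iter n (hop (hres T h) c s) y) <= D * Sy.
  move=> h0; apply: (hop_stability T_semigroup M0 leT D0 stable) => //.
  by move=> z; exact: (hfrac_le1 r_stable a0 dE nE).
have [S xS] := real_interpolation_sum dom0 theta0 xA.
apply: cvg_uniform_itv => eps eps0.
have [N hN] := hop_cvg T_semigroup M0 leT genA sP F0 F1 theta0 theta1 D0 stab xS tau0 eps0.
(* The successor keeps [n] positive in t / n, and t = 0 is treated apart because [hres] requires a
   positive step. *)
exists N.+1 => n t Nn; rewrite le_eqVlt => /predU1P[<- _|t0 tt].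
  rewrite mul0r oppr0 (semigroup0 T_semigroup).
  have -> : iter n (ratfun_op r (scale_op 0%:C A)) x = x.
    elim: (n) => [//|m ih]; rewrite iterS ih.
    exact: (ratfun_op_scale0 _ _ a0 dE nE sP F0).
  by rewrite subrr rnorm0 ltW.
have n0 : 0 < n%:R :> R by rewrite ltr0n; case: n Nn.
have h0 : 0 < t / n%:R by rewrite divr_gt0.
have nh : n%:R * (t / n%:R) = t by rewrite mulrC divfK// gt_eqF.
rewrite (eq_iter (f' := hop (hres T (t / n%:R)) c s)).
  by rewrite -{2}nh; apply: hN; rewrite ?nh// ltnW.
by move=> y; exact: (ratfun_op_scale _ T_semigroup M0 leT genA a0 dE nE sP h0).
Qed.
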